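(* Let $g(\cdot) \in \{ \mathrm{cc}(\cdot), \mathrm{cm}_0(\cdot), \mathrm{cm}_1(\cdot), \mathrm{cm}_2(\cdot), \mathrm{cm}_3(\cdot)\}$ and let $P$ be a Koebe polyhedron. Then there is a Möbius transformation $T : \mathbb{S}^2 \to \mathbb{S}^2$ such that $g(T(P)) \notin \mathbf{B}^3$. Furthermore, if $P$ is simplicial, the same statement holds for $g(\cdot) = \mathrm{ccm}(\cdot)$.
   Context: $\mathbb{S}^2$ is the unit sphere of $\mathbb{R}^3$ centered at the origin $o$, and $\mathbf{B}^3$ is the closed unit ball of $\mathbb{R}^3$ centered at $o$. A Koebe polyhedron is a convex polyhedron (convex polytope with nonempty interior in $\mathbb{R}^3$) midscribed to $\mathbb{S}^2$, that is, all of whose edges are tangent to $\mathbb{S}^2$. The face circles of a Koebe polyhedron are the incircles of its faces (the intersections of the face planes with $\mathbb{S}^2$; each passes through the tangency points of the edges of the face). The vertex circle of a vertex is the circle on $\mathbb{S}^2$ passing through the tangency points of all edges starting at that vertex. If $P$ is a Koebe polyhedron and $T$ is a Möbius transformation of $\mathbb{S}^2$, then $T(P)$ denotes the (Koebe) polyhedron whose face circles and vertex circles are the images under $T$ of the face circles and vertex circles of $P$; existence statements about $T(P)$ include that $T(P)$ is such a convex polyhedron. For a convex polyhedron $P \subset \mathbb{R}^3$: $\mathrm{cc}(P)$ is the center of the unique smallest ball containing $P$; for $k=0,1,2,3$, $\mathrm{cm}_k(P) = \frac{\int_{p \in \mathrm{skel}_k(P)} p \, dv_k}{\int_{p \in \mathrm{skel}_k(P)}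 dv_k}$ is the center of mass of the $k$-skeleton $\mathrm{skel}_k(P)$ of $P$, where $v_k$ is the $k$-dimensional Lebesgue measure (counting measure on the vertices for $k=0$; $\mathrm{skel}_3(P)=P$). $P$ is simplicial if all its faces are triangles. For an (oriented) simplicial $P$, the circumcenter of mass $\mathrm{ccm}(P)$ is defined as follows: choose a reference point $x$ not contained in any of the facet planes of $P$, triangulate $P$ by the simplices whose bases are the facets of $P$ and whose apex is $x$, let $p_i$ be the circumcenter (the center of the unique sphere through all four vertices) and $m_i$ the volume (signed according to the orientation) of the $i$th simplex, and put $\mathrm{ccm}(P) = \frac{\sum_i m_i p_i}{\sum_i m_i}$; it is known that this does not depend on the choice of $x$. *)

(* Defs.v *)
From HB Require Import structures.
From mathcomp Require Import all_boot all_order all_algebra.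
From mathcomp Require Import all_classical all_reals all_analysis.

Set Implicit Arguments.
Unset Strict Implicit.
Unset Printing Implicit Defensive.

Import Order.TTheory GRing.Theory Num.Theory.
Import numFieldNormedType.Exports.

Local Open Scope classical_set_scope.
Local Open Scope ring_scope.

Section Euclidean.
Context {R : realType}.
Local Notation V := 'rV[R]_3.
Implicit Types (x y u : V) (S F : set V).

Definition dot x y : R := (x *m y^T) 0 0.

(* The norm `|x| that the library puts on 'rV[R]_3 is the sup norm. *)
Definition enorm x : R := Num.sqrt (dot x x).

Definition eball (c : V) (r : R) : set V := [set x | enorm (x - c) <= r].

Definition S2 : set V := [set x | enorm x = 1].

Definition B3 : set V := eball 0 1.

Definition aff_hull S : set V :=
  [set x | exists n (w : 'I_n -> R) (p : 'I_n -> V),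
     (forall i, S (p i)) /\ \sum_i w i = 1 /\ x = \sum_i w i *: p i].

Definition conv_hull S : set V :=
  [set x | exists n (w : 'I_n -> R) (p : 'I_n -> V),
     (forall i, 0 <= w i) /\ (forall i, S (p i)) /\
     \sum_i w i = 1 /\ x = \sum_i w i *: p i].

Definition flat k (o : V) (A : 'M[R]_(k, 3)) : set V :=
  [set o + t *m A | t in [set: 'rV[R]_k]].

Definition has_dim S k :=
  exists o (A : 'M[R]_(k, 3)), row_free A /\ aff_hull S = flat o A.

Definition det3 (a b c : V) : R := \det (\matrix_(i < 3) [:: a; b; c]`_i).

End Euclidean.

Section Polyhedra.
Context {R : realType}.
Local Notation V := 'rV[R]_3.
Implicit Types (P Q F E C : set V) (v t x : V).

Definition convex_polyhedron P :=
  (exists S, finite_set S /\ P = conv_hull S) /\ interior P !=set0.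

(* u = 0 is allowed, so that P is a face of itself. *)
Definition is_face P F :=
  F !=set0 /\
  exists (u : V) (c : R),
    P `<=` [set x | dot u x <= c] /\ F = P `&` [set x | dot u x = c].

Definition faces k P : set (set V) := [set F | is_face P F /\ has_dim F k].

Definition vertices P : set V := [set v | faces 0 P [set v]].

Definition triangle F := exists a b c, F = conv_hull [set a; b; c].

Definition simplicial P := forall F, faces 2 P F -> triangle F.

(* The line of E meets S2 in the single point t, which lies on E itself. *)
Definition tangent_at E t := E t /\ aff_hull E `&` S2 = [set t].

Definition koebe P :=
  convex_polyhedron P /\ forall E, faces 1 P E -> exists t, tangent_at E t.

Definition is_circle C :=
  (exists (u : V) (c : R), u != 0 /\ C = S2 `&` [set x | dot u x = c]) /\
  exists x y, C x /\ C y /\ x <> y.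

Definition face_circles P : set (set V) :=
  [set aff_hull F `&` S2 | F in faces 2 P].

Definition vertex_circle P v C :=
  is_circle C /\
  forall E t, faces 1 P E -> E v -> tangent_at E t -> C t.

Definition vertex_circles P : set (set V) :=
  [set C | exists v, vertices P v /\ vertex_circle P v C].

(* Inversion in the sphere of center a and squared radius dot a a - 1: when
   1 < dot a a, this is the sphere centered at a that is orthogonal to S2, and
   the inversion restricts to the inversion of S2 in a circle. *)
Definition inversion (a x : V) : V :=
  a + ((dot a a - 1) / dot (x - a) (x - a)) *: (x - a).

(* The limit case of the above, for great circles. *)
Definition reflection (u x : V) : V := x - (dot u x / dot u u *+ 2) *: u.

(* The group generated by the inversions of S2 in circles, which includes the
   orientation-reversing maps. Only the restriction of T to S2 is relevant. *)
Inductive mobius : (V -> V) -> Prop :=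
| mobius_id : mobius id
| mobius_inversion a T :
    1 < dot a a -> mobius T -> mobius (inversion a \o T)
| mobius_reflection u T :
    u != 0 -> mobius T -> mobius (reflection u \o T).

(* Q is T(P). The circles determine the face planes and vertices of Q, so
   there is at most one such Q. *)
Definition mobius_image (T : V -> V) P Q :=
  [/\ koebe Q,
      face_circles Q = [set T @` C | C in face_circles P] &
      vertex_circles Q = [set T @` C | C in vertex_circles P]].

End Polyhedra.

Section Centers.
Context {R : realType}.
Local Notation V := 'rV[R]_3.
Implicit Types (P F : set V) (x : V).

(* Each choice by xget below defaults to 0, a point of B3. *)

Definition cc P : V :=
  xget 0 [set c | exists r, P `<=` eball c r /\
                  forall c' r', P `<=` eball c' r' -> r <= r'].

(* Lebesgue measure on R^k, as an iterated product. *)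
Fixpoint lebesgue k : set (k.-tuple (measurableTypeR R)) -> \bar R :=
  match k with
  | 0%N => dirac [tuple]
  | k'.+1 =>
      pushforward (product_measure1 (@lebesgue_measure R) (@lebesgue k'))
        (fun p => [tuple of p.1 :: p.2])
  end.

(* An origin and an orthonormal basis for the affine hull of F. *)
Definition frame k F : V * 'M[R]_(k, 3) :=
  xget (0, 0) [set oA | oA.2 *m oA.2^T = 1%:M /\ aff_hull F = flat oA.1 oA.2].

Definition frame_map k F (t : k.-tuple R) : V :=
  (frame k F).1 + (\row_i tnth t i) *m (frame k F).2.

(* Integral over F with respect to the k-dimensional Lebesgue measure of its
   affine hull, carried over from R^k by an isometry. *)
Definition face_integral k F (f : V -> R) : R :=
  fine (\int[@lebesgue k]_(t in frame_map F @^-1` F) (f (frame_map F t))%:E)%E.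

(* Distinct k-faces overlap in a set of k-dimensional measure 0. *)
Definition skel_integral k P (f : V -> R) : R :=
  \sum_(F \in faces k P) face_integral k F f.

Definition cm k P : V :=
  (skel_integral k P (fun=> 1))^-1 *:
    \row_i skel_integral k P (fun p => p 0 i).

Definition off_facet_planes P x := forall F, faces 2 P F -> ~ aff_hull F x.

Definition circumcenter x F : V :=
  xget 0 [set p | exists r, enorm (x - p) = r /\
                  forall y, vertices F y -> enorm (y - p) = r].

(* Signed volume of the simplex with base the triangle F and apex x. The
   vertices a, b, c of F are so ordered that the normal (b - a) x (c - a)
   points out of P, and the volume is positive when x is interior to P. *)
Definition signed_volume P x F : R :=
  xget 0 [set m | exists a b c,
    [/\ F = conv_hull [set a; b; c],
        forall y, P y -> det3 (b - a) (c - a) (y - a) <= 0 &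
        m = det3 (a - x) (b - x) (c - x) / 6]].

Definition ccm_from P x : V :=
  (\sum_(F \in faces 2 P) signed_volume P x F)^-1 *:
    \sum_(F \in faces 2 P) signed_volume P x F *: circumcenter x F.

Definition ccm P : V := ccm_from P (xget 0 [set x | off_facet_planes P x]).

End Centers.

(* Main.v *)
(* An inversion of S2 with center [a], |a| > 1, extends to a projective map [A]
   of R^3 that preserves S2: [A] is an involution whose denominator [D] vanishes
   on a plane orthogonal to [a]. If [D > 0] on the polyhedron [P], then [A @` P] is
   the polyhedron whose face and vertex circles are the images of those of [P].

   Let [v] be a vertex of [P] of largest norm, so |v| > 1, and place [a] on the
   ray of [v] so that [D v = eps]. As [eps] tends to 0, [A v] runs off to infinity
   in the direction of [- v], while the images of the other vertices stay in a
   fixed ball. Then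
   - the smallest ball containing [A @` P] has its center near [A v / 2];
   - the k-faces through [A v] make the integral of [dot (- v) x - |v|] over the
     k-skeleton tend to infinity, because the part of the skeleton where this
     function is negative has bounded volume;
   - the circumcenter of mass is a quotient of two sums over the facets, a sum of
     vectors [phi] over twice a sum of determinants; for the facets through [A v],
     the component of [phi] along [A v] is the determinant times |A v|, the other
     facets contribute bounded amounts, and the sum of the determinants tends to
     infinity. *)

From HB Require Import structures.
Require Import Defs.
From mathcomp Require Import all_boot all_order all_algebra finmap.
From mathcomp Require Import all_classical all_reals all_analysis.
From mathcomp Require Import ring lra zify.

Set Implicit Arguments.
Unset Strict Implicit.
Unset Printing Implicit Defensive.

Import Order.TTheory GRing.Theory Num.Theory.
Import numFieldNormedType.Exports.

Local Open Scope classical_set_scope.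
Local Open Scope ring_scope.

(** * Euclidean space *)

(** Off the sphere an inversion bends planes, so it cannot carry faces to faces. On the sphere it
    agrees with a quotient of affine functions, and this quotient is used on the whole space: it
    respects planes, convex hulls, dimension and tangency, and since it is an involution, each
    converse inclusion is the direct one applied to the image.

    Tangency of the edges forces |v| > 1, because an edge at v leaves the ball. The choice of
    largest norm makes v exposed by the functional v itself; the gap between |v|^2 and the values of
    that functional at the other generators keeps their denominators away from 0 while eps tends to
    0.

    The center of inversion moves with eps, so every constant must be fixed before it: the bounds
    depend on the polyhedron, v and M only. Except for the smallest ball, the test for leaving the
    unit ball is that the functional -v exceeds |v|.

    Smallest ball, orthonormal frame, circumcenter, ordering of a facet and reference point are all
    selected by [xget]; each needs an existence proof, and where the value matters a uniqueness
    proof, before its properties can be used. *)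

Section Euclid.
Context {R : realType}.
Local Notation V := 'rV[R]_3.
Implicit Types (x y z u v : V) (a b : R).

Lemma dotE x y : dot x y = \sum_i x 0 i * y 0 i.
Proof. by rewrite /dot mxE; apply: eq_bigr => i _; rewrite mxE. Qed.

Definition i0 : 'I_3 := 0.
Definition i1 : 'I_3 := 1.
Definition i2 : 'I_3 := 2%:R.

Lemma sum3 (U : nmodType) (F : 'I_3 -> U) : \sum_i F i = F i0 + F i1 + F i2.
Proof.
rewrite !big_ord_recl big_ord0 addr0 addrA.
by congr (F _ + F _ + F _); apply/val_inj.
Qed.

Lemma ord3P (Q : 'I_3 -> Prop) : Q i0 -> Q i1 -> Q i2 -> forall i, Q i.
Proof.
move=> Q0 Q1 Q2 [[|[|[|//]]] h].
- by rewrite (_ : Ordinal h = i0) //; apply/val_inj.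
- by rewrite (_ : Ordinal h = i1) //; apply/val_inj.
- by rewrite (_ : Ordinal h = i2) //; apply/val_inj.
Qed.

Lemma dot3 x y : dot x y = x 0 i0 * y 0 i0 + x 0 i1 * y 0 i1 + x 0 i2 * y 0 i2.
Proof. by rewrite dotE sum3. Qed.

Lemma rowP3 x y : x 0 i0 = y 0 i0 -> x 0 i1 = y 0 i1 -> x 0 i2 = y 0 i2 -> x = y.
Proof. by move=> h0 h1 h2; apply/rowP; apply: ord3P. Qed.

Lemma dotC x y : dot x y = dot y x.
Proof. by rewrite !dot3; ring. Qed.
Lemma dotDl x y z : dot (x + y) z = dot x z + dot y z.
Proof. by rewrite !dot3 !mxE; ring. Qed.
Lemma dotDr x y z : dot z (x + y) = dot z x + dot z y.
Proof. by rewrite !dot3 !mxE; ring. Qed.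
Lemma dotZl a x y : dot (a *: x) y = a * dot x y.
Proof. by rewrite !dot3 !mxE; ring. Qed.
Lemma dotZr a x y : dot x (a *: y) = a * dot x y.
Proof. by rewrite !dot3 !mxE; ring. Qed.
Lemma dotNl x y : dot (- x) y = - dot x y.
Proof. by rewrite !dot3 !mxE; ring. Qed.
Lemma dotNr x y : dot x (- y) = - dot x y.
Proof. by rewrite !dot3 !mxE; ring. Qed.
Lemma dot0l x : dot 0 x = 0.
Proof. by rewrite !dot3 !mxE; ring. Qed.
Lemma dot0r x : dot x 0 = 0.
Proof. by rewrite !dot3 !mxE; ring. Qed.
Definition dotL := (dotDl, dotDr, dotNl, dotNr, dotZl, dotZr, dot0l, dot0r).

Lemma dot_sumr (I : Type) (r : seq I) (Q : pred I) (F : I -> V) x :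
  dot x (\sum_(i <- r | Q i) F i) = \sum_(i <- r | Q i) dot x (F i).
Proof. by elim/big_rec2: _ => [|i a y _ <-]; rewrite dotL. Qed.

Lemma dot_ge0 x : 0 <= dot x x.
Proof. by rewrite dotE sumr_ge0 // => i _; rewrite -expr2 sqr_ge0. Qed.

Lemma dot_eq0 x : dot x x = 0 -> x = 0.
Proof.
rewrite dotE => /psumr_eq0P h; apply/rowP => i; rewrite mxE.
apply/eqP; rewrite -sqrf_eq0 expr2; apply/eqP; apply: h => // j _.
by rewrite -expr2 sqr_ge0.
Qed.

Lemma dot_gt0 x : x != 0 -> 0 < dot x x.
Proof.
by move=> x0; rewrite lt_neqAle dot_ge0 andbT eq_sym; apply: contra x0 => /eqP/dot_eq0->.
Qed.

Lemma dot_sqr_le x y : dot x y ^+ 2 <= dot x x * dot y y.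
Proof.
rewrite -subr_ge0 !dot3.
set a := x 0 i0; set b := x 0 i1; set c := x 0 i2.
set d := y 0 i0; set e := y 0 i1; set f := y 0 i2.
have -> : (a * a + b * b + c * c) * (d * d + e * e + f * f)
    - (a * d + b * e + c * f) ^+ 2 =
  (a * e - b * d) ^+ 2 + (b * f - c * e) ^+ 2 + (a * f - c * d) ^+ 2 by ring.
by rewrite !addr_ge0 ?sqr_ge0.
Qed.

Lemma enorm_ge0 x : 0 <= enorm x. Proof. exact: sqrtr_ge0. Qed.

Lemma sqr_enorm x : enorm x ^+ 2 = dot x x.
Proof. by rewrite sqr_sqrtr // dot_ge0. Qed.

Lemma dot_le x y : `|dot x y| <= enorm x * enorm y.
Proof.
rewrite -(ler_pXn2r (n := 2)) ?nnegrE ?mulr_ge0 ?enorm_ge0 //.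
by rewrite -normrX exprMn !sqr_enorm ger0_norm ?sqr_ge0 ?dot_sqr_le.
Qed.

Lemma enorm_le_sqr x r : 0 <= r -> (enorm x <= r) = (dot x x <= r ^+ 2).
Proof. by move=> r0; rewrite -sqr_enorm ler_pXn2r ?nnegrE ?enorm_ge0. Qed.

Lemma enorm0 : enorm (0 : V) = 0.
Proof. by rewrite /enorm dot0l sqrtr0. Qed.
Lemma enormN x : enorm (- x) = enorm x.
Proof. by rewrite /enorm dotNl dotNr opprK. Qed.
Lemma enormB x y : enorm (x - y) = enorm (y - x).
Proof. by rewrite -enormN opprB. Qed.
Lemma enormZ a x : enorm (a *: x) = `|a| * enorm x.
Proof.
by rewrite /enorm dotZl dotZr mulrA -expr2 sqrtrM ?sqr_ge0 // sqrtr_sqr.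
Qed.

Lemma enormD x y : enorm (x + y) <= enorm x + enorm y.
Proof.
rewrite enorm_le_sqr ?addr_ge0 ?enorm_ge0 // !dotL sqrrD !sqr_enorm.
have := dot_le x y; rewrite ler_norml => /andP[_ h].
by rewrite (dotC y x) mulr2n; lra.
Qed.

Lemma enorm_dist x y : `|enorm x - enorm y| <= enorm (x - y).
Proof.
have := enormD (x - y) y; rewrite subrK => h1.
have := enormD (y - x) x; rewrite subrK enormB => h2.
by rewrite ler_norml; lra.
Qed.

Lemma enorm_sum (I : Type) (r : seq I) (Q : pred I) (F : I -> V) :
  enorm (\sum_(i <- r | Q i) F i) <= \sum_(i <- r | Q i) enorm (F i).
Proof.
elim/big_rec2: _ => [|i a y _ h]; first by rewrite enorm0.
by apply: le_trans (enormD _ _) _; rewrite lerD2l.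
Qed.

Lemma enorm_gt0 x : x != 0 -> 0 < enorm x.
Proof. by move=> /dot_gt0; rewrite /enorm sqrtr_gt0. Qed.

Lemma coord_le_enorm x i : `|x 0 i| <= enorm x.
Proof.
rewrite -(ler_pXn2r (n := 2)) ?nnegrE ?enorm_ge0 // sqr_enorm.
rewrite -normrX ger0_norm ?sqr_ge0 // dotE (bigD1 i) //= -expr2 lerDl.
by rewrite sumr_ge0 // => j _; rewrite -expr2 sqr_ge0.
Qed.

Lemma enorm_le_coord x r : (forall i, `|x 0 i| <= r) -> enorm x <= 3%:R * r.
Proof.
move=> h; have r0 : 0 <= r by apply: le_trans (h i0).
rewrite enorm_le_sqr ?mulr_ge0 // dotE.
have -> : (3%:R * r) ^+ 2 = \sum_(i < 3) 3%:R * (r ^+ 2).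
  by rewrite sum3; ring.
apply: ler_sum => i _; rewrite -expr2 -real_normK ?num_real //.
have : `|x 0 i| ^+ 2 <= r ^+ 2 by rewrite ler_pXn2r ?nnegrE.
by have := sqr_ge0 r; lra.
Qed.

Lemma enorm_le_norm x : enorm x <= 3%:R * `|x|.
Proof.
apply: enorm_le_coord => i.
have -> : `|x| = mx_norm x by [].
by rewrite mx_normrE; exact: (le_bigmax _ (fun ij : 'I_1 * 'I_3 => `|x ij.1 ij.2|) (0, i)).
Qed.

(** By Cauchy-Schwarz the half-space beyond the supporting plane with normal [u] misses the unit
    ball. It is applied with [u = - v]. *)
Lemma not_B3 u x : enorm u < dot u x -> ~ B3 x.
Proof.
move=> h; rewrite /B3 /eball /= subr0 => x1.
have := lt_le_trans h (le_trans (ler_norm _) (dot_le u x)).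
by have := ler_wpM2l (enorm_ge0 u) x1; rewrite mulr1; lra.
Qed.

End Euclid.

(** * Convex hulls and faces *)

Section Hulls.
Context {R : realType}.
Local Notation V := 'rV[R]_3.
Implicit Types (x y z u : V) (S F P : set V).

(** The generators form a fixed family in which repetitions are allowed, so only the weights vary,
    and the image under a projective map is generated by the composed family on the same index
    set. *)
Definition cvx n (p : 'I_n -> V) : set V :=
  [set x | exists w : 'I_n -> R,
     (forall i, 0 <= w i) /\ \sum_i w i = 1 /\ x = \sum_i w i *: p i].

Definition afc n (p : 'I_n -> V) : set V :=
  [set x | exists w : 'I_n -> R, \sum_i w i = 1 /\ x = \sum_i w i *: p i].

Lemma sum_delta (U : lmodType R) n (j : 'I_n) (p : 'I_n -> U) :
  \sum_i (i == j)%:R *: p i = p j.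
Proof.
rewrite (bigD1 j) //= eqxx scale1r big1 ?addr0 // => i /negbTE->.
by rewrite scale0r.
Qed.

Lemma sum_delta1 n (j : 'I_n) : \sum_i (i == j)%:R = 1 :> R.
Proof. by rewrite (bigD1 j) //= eqxx big1 ?addr0 // => i /negbTE->. Qed.

Lemma cvx_vertex n (p : 'I_n -> V) j : cvx p (p j).
Proof.
by exists (fun i => (i == j)%:R); split=> //; rewrite sum_delta1 sum_delta.
Qed.

Lemma cvx_afc n (p : 'I_n -> V) : cvx p `<=` afc p.
Proof. by move=> x [w [_ h]]; exists w. Qed.

Lemma afc_comb n m (p : 'I_n -> V) (q : 'I_m -> V) :
  (forall i, afc p (q i)) -> afc q `<=` afc p.
Proof.
move=> /choice[v hv] _ [w [w1 ->]].
exists (fun j => \sum_i w i * v i j); split.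
  rewrite exchange_big /= -[RHS]w1; apply: eq_bigr => i _.
  by rewrite -mulr_sumr (hv i).1 mulr1.
under [RHS]eq_bigr do rewrite scaler_suml.
rewrite exchange_big /=; apply: eq_bigr => i _.
by rewrite (hv i).2 scaler_sumr; apply: eq_bigr => j _; rewrite scalerA.
Qed.

Lemma cvx_comb n m (p : 'I_n -> V) (q : 'I_m -> V) :
  (forall i, cvx p (q i)) -> cvx q `<=` cvx p.
Proof.
move=> /choice[v hv] _ [w [w0 [w1 ->]]].
exists (fun j => \sum_i w i * v i j); split; first by
  move=> j; apply: sumr_ge0 => i _; rewrite mulr_ge0 // (hv i).1.
split.
  rewrite exchange_big /= -[RHS]w1; apply: eq_bigr => i _.
  by rewrite -mulr_sumr (hv i).2.1 mulr1.
under [RHS]eq_bigr do rewrite scaler_suml.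
rewrite exchange_big /=; apply: eq_bigr => i _.
by rewrite (hv i).2.2 scaler_sumr; apply: eq_bigr => j _; rewrite scalerA.
Qed.

Lemma conv_hull_range n (p : 'I_n -> V) : conv_hull (range p) = cvx p.
Proof.
apply/seteqP; split => [x [m [w [q [w0 [qS [w1 ->]]]]]]|x [w [w0 [w1 ->]]]].
  apply: (@cvx_comb _ _ p q); last by exists w.
  by move=> i; have [j _ <-] := qS i; exact: cvx_vertex.
by exists n, w, p; split => //; split => // i; exists i.
Qed.

Lemma aff_hull_cvx n (p : 'I_n -> V) : aff_hull (cvx p) = afc p.
Proof.
apply/seteqP; split => [x [m [w [q [qS [w1 ->]]]]]|x [w [w1 ->]]].
  by apply: (@afc_comb _ _ p q); [move=> i; exact: cvx_afc|exists w].
by exists n, w, p; split => // i; exact: cvx_vertex.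
Qed.

Lemma sub_aff_hull S : S `<=` aff_hull S.
Proof.
by move=> x Sx; exists 1%N, (fun=> 1), (fun=> x); rewrite !big_ord1 scale1r.
Qed.

Lemma aff_hull_line S x y t :
  aff_hull S x -> aff_hull S y -> aff_hull S (x + t *: (y - x)).
Proof.
move=> [n [w [p [pS [w1 ->]]]]] [m [v [q [qS [v1 ->]]]]].
exists (n + m)%N, (fun i => match fintype.split i with inl j => (1 - t) * w j | inr j => t * v j end),
  (fun i => match fintype.split i with inl j => p j | inr j => q j end).
have sl (j : 'I_n) : fintype.split (lshift m j) = inl j by exact: (unsplitK (inl j)).
have sr (j : 'I_m) : fintype.split (rshift n j) = inr j by exact: (unsplitK (inr j)).
split; first by move=> i; case: (fintype.split i).
rewrite !big_split_ord /=.
under eq_bigr => i _ do rewrite sl.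
under [X in _ + X = 1]eq_bigr => i _ do rewrite sr.
split; first by rewrite -!mulr_sumr w1 v1; ring.
under [X in _ = X + _]eq_bigr => i _ do rewrite sl -scalerA.
under [X in _ = _ + X]eq_bigr => i _ do rewrite sr -scalerA.
rewrite -!scaler_sumr scalerBl scale1r scalerBr.
by rewrite addrA addrAC.
Qed.

Lemma finite_range S : finite_set S -> exists n (p : 'I_n -> V), S = range p.
Proof.
move=> /finite_seqP[s ->]; exists (size s), (fun i => nth 0 s i).
apply/seteqP; split => x /=.
  by move=> xs; exists (Ordinal (eq_ind_r is_true xs (index_mem x s))) => //=; rewrite nth_index.
by move=> [i _ <-]; exact: mem_nth.
Qed.

Lemma range_finite n (p : 'I_n -> V) : finite_set (range p).
Proof. exact/finite_image/finite_finset. Qed.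

Lemma dot_comb n (p : 'I_n -> V) w u c : \sum_i w i = 1 ->
  dot u (\sum_i w i *: p i) - c = \sum_i w i * (dot u (p i) - c).
Proof.
move=> w1; rewrite dot_sumr -[c in LHS]mulr1 -w1 mulr_sumr -sumrB.
by apply: eq_bigr => i _; rewrite dotL; ring.
Qed.

Lemma cvx_le n (p : 'I_n -> V) u c :
  (forall i, dot u (p i) <= c) -> cvx p `<=` [set x | dot u x <= c].
Proof.
move=> h _ [w [w0 [w1 ->]]] /=; rewrite -subr_le0 (dot_comb _ _ _ w1).
by apply: sumr_le0 => i _; rewrite mulr_ge0_le0 // subr_le0.
Qed.

Lemma cvx_ball n (p : 'I_n -> V) c r :
  (forall i, eball c r (p i)) -> cvx p `<=` eball c r.
Proof.
move=> h _ [w [w0 [w1 ->]]] /=; rewrite /eball /=.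
have -> : \sum_i w i *: p i - c = \sum_i w i *: (p i - c).
  rewrite -[c in LHS]scale1r -w1 scaler_suml -sumrB.
  by apply: eq_bigr => i _; rewrite scalerBr.
apply: le_trans (enorm_sum _ _ _) _.
rewrite -[r]mul1r -w1 mulr_suml; apply: ler_sum => i _.
by rewrite enormZ ger0_norm // ler_wpM2l //; exact: h.
Qed.

Lemma cvx_line n (p : 'I_n -> V) x y t : 0 <= t <= 1 ->
  cvx p x -> cvx p y -> cvx p (x + t *: (y - x)).
Proof.
move=> /andP[t0 t1] [w [w0 [w1 ->]]] [v [v0 [v1 ->]]].
exists (fun i => w i + t * (v i - w i)); split.
  move=> i; have -> : w i + t * (v i - w i) = (1 - t) * w i + t * v i by ring.
  by rewrite addr_ge0 // mulr_ge0 // subr_ge0.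
split.
  by rewrite big_split /= -mulr_sumr sumrB w1 v1; ring.
rewrite -sumrB scaler_sumr -big_split /=; apply: eq_bigr => i _.
by rewrite -scalerBl scalerA -scalerDl.
Qed.

(* The same index set serves for every face: a generator off the face is
   replaced by one that lies on it. *)
Lemma face_cvx n (p : 'I_n -> V) F : is_face (cvx p) F ->
  exists q : 'I_n -> V, [/\ F = cvx q, forall i, F (q i),
    forall i, exists j, q i = p j & forall i, F (p i) -> q i = p i].
Proof.
move=> [F0 [u [c [Pu FE]]]].
(* The numbers [w i * (dot u (p i) - c)] are all nonpositive and add up to 0, so each vanishes: a
   point of the face only uses generators on the face. *)
have key w : (forall i, 0 <= w i) -> \sum_i w i = 1 ->
    dot u (\sum_i w i *: p i) = c -> forall i, w i != 0 -> F (p i).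
  move=> w0 w1 uw i wi; rewrite FE; split; first exact: cvx_vertex.
  have := dot_comb p u c w1; rewrite uw subrr => /esym/eqP.
  rewrite -oppr_eq0 -sumrN psumr_eq0 => [/allP /(_ i)|j _]; last first.
    by rewrite -mulrN mulr_ge0 // oppr_ge0 subr_le0; exact/Pu/cvx_vertex.
  rewrite mem_index_enum => /(_ isT) /=.
  by rewrite oppr_eq0 mulf_eq0 (negbTE wi) /= subr_eq0 => /eqP.
have [i0 Fi0] : exists i, F (p i).
  have [x] := F0; rewrite {1}FE => -[[w [w0 [w1 ->]]] /(key w w0 w1) h].
  apply: contrapT => /forallNP N; move: w1; rewrite big1 => [/esym/eqP|i _].
    by rewrite oner_eq0.
  by apply/eqP; apply: contraT => /h /N.
exists (fun i => if `[< F (p i) >] then p i else p i0).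
have Fq i : F (if `[< F (p i) >] then p i else p i0).
  by case: asboolP.
split=> //; first last.
- by move=> i /asboolP ->.
- by move=> i; case: ifP => _; [exists i|exists i0].
apply/seteqP; split.
  move=> x; rewrite {1}FE => -[[w [w0 [w1 ->]]] /(key w w0 w1) h].
  exists w; split => //; split => //; apply: eq_bigr => i _.
  by have [->|/h/asboolP->] := eqVneq (w i) 0; rewrite ?scale0r.
move=> x xq; rewrite FE; split.
  by move: x xq; apply: cvx_comb => i; case: ifP => _; exact: cvx_vertex.
move: xq => [w [_ [w1 ->]]] /=; apply/eqP; rewrite -subr_eq0 (dot_comb _ _ _ w1).
apply/eqP/big1 => i _; have := Fq i; rewrite {1}FE => -[_ /= ->].
by rewrite subrr mulr0.
Qed.

End Hulls.

(** * Inversions as projective maps *)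

Section Inversion.
Context {R : realType}.
Local Notation V := 'rV[R]_3.
Implicit Types (x y z u d : V) (S F P : set V).
Variable a : V.
Local Notation m := (dot a a).
Hypothesis m1 : 1 < m.

(** For |x| = 1 the squared distance from [x] to [a] is [1 + m - 2 * dot a x]. Substituting this in
    the formula of the inversion leaves a quotient of affine functions, taken here as a definition
    off the sphere as well. *)
Definition idenom x : R := 1 + m - 2 * dot a x.
Definition iproj x : V :=
  (idenom x)^-1 *: ((m - 1) *: x + (2 - 2 * dot a x) *: a).

Lemma S2E x : S2 x <-> dot x x = 1.
Proof.
rewrite /S2 /=; split => [h|h]; first by rewrite -sqr_enorm h expr1n.
by rewrite /enorm h sqrtr1.
Qed.

Lemma idenom_S2 x : S2 x -> 0 < idenom x.
Proof.
move=> /S2E x1.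
have -> : idenom x = dot (x - a) (x - a).
  by rewrite /idenom !dotL x1 (dotC x a); ring.
apply: dot_gt0; rewrite subr_eq0; apply/eqP => xa.
by move: m1; rewrite -xa x1 ltxx.
Qed.

Lemma inversion_S2 x : S2 x -> inversion a x = iproj x.
Proof.
move=> x1; have := idenom_S2 x1; move/S2E : x1 => x1.
have E : dot (x - a) (x - a) = idenom x.
  by rewrite /idenom !dotL x1 (dotC x a); ring.
rewrite /inversion /iproj E => h; apply/rowP => i; rewrite !mxE.
by move: h; rewrite /idenom => h; field; lra.
Qed.

Lemma idenom_iproj x : idenom x != 0 -> idenom (iproj x) = (m - 1) ^+ 2 / idenom x.
Proof.
by rewrite /iproj {2}/idenom !dotL; rewrite /idenom => h; field.
Qed.

Lemma iprojK x : idenom x != 0 -> iproj (iproj x) = x.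
Proof.
move=> h; have h2 : m - 1 != 0 by rewrite subr_eq0 gt_eqF.
rewrite {1}/iproj idenom_iproj //; apply/rowP => i.
rewrite /iproj !dotL !mxE; move: h; rewrite /idenom => h; field.
by rewrite h h2.
Qed.

Lemma dot_iproj x : idenom x != 0 ->
  dot (iproj x) (iproj x) - 1 = (m - 1) ^+ 2 * (dot x x - 1) / idenom x ^+ 2.
Proof.
move=> h; rewrite /iproj !dotL (dotC x a).
by move: h; rewrite /idenom => h; field.
Qed.

Lemma iproj_S2 x : S2 x -> S2 (iproj x).
Proof.
move=> x1; have h := idenom_S2 x1; apply/S2E; apply/eqP; rewrite -subr_eq0.
by rewrite dot_iproj ?lt0r_neq0 // (S2E x).1 // subrr mulr0 mul0r.
Qed.

Lemma idenom_comb n (p : 'I_n -> V) w : \sum_i w i = 1 ->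
  idenom (\sum_i w i *: p i) = \sum_i w i * idenom (p i).
Proof.
move=> w1; have := dot_comb p a 0 w1; rewrite subr0 /idenom => ->.
under [RHS]eq_bigr do rewrite mulrBr.
rewrite sumrB -mulr_suml w1 mul1r; congr (_ - _).
by rewrite mulr_sumr; apply: eq_bigr => i _; ring.
Qed.

Lemma iproj_num_comb n (p : 'I_n -> V) w : \sum_i w i = 1 ->
  (m - 1) *: (\sum_i w i *: p i) + (2 - 2 * dot a (\sum_i w i *: p i)) *: a =
  \sum_i w i *: ((m - 1) *: p i + (2 - 2 * dot a (p i)) *: a).
Proof.
move=> w1.
have -> : 2 - 2 * dot a (\sum_i w i *: p i) = \sum_i w i * (2 - 2 * dot a (p i)).
  have := dot_comb p a 1 w1 => h.
  rewrite (_ : 2 - _ = - 2 * (dot a (\sum_i w i *: p i) - 1)); last by ring.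
  by rewrite h mulr_sumr; apply: eq_bigr => i _; ring.
rewrite scaler_sumr scaler_suml -big_split /=; apply: eq_bigr => i _.
by rewrite scalerDr !scalerA (mulrC (m - 1)).
Qed.

Lemma iproj_comb n (p : 'I_n -> V) w : \sum_i w i = 1 ->
  (forall i, idenom (p i) != 0) ->
  iproj (\sum_i w i *: p i) =
  \sum_i (w i * idenom (p i) / idenom (\sum_i w i *: p i)) *: iproj (p i).
Proof.
move=> w1 h; rewrite {1}/iproj iproj_num_comb // scaler_sumr.
apply: eq_bigr => i _; rewrite /iproj !scalerA; congr (_ *: _).
by rewrite mulrAC mulfK // mulrC.
Qed.

Lemma iproj_half u c x : idenom x != 0 ->
  dot u (iproj x) - c =
  (dot ((m - 1) *: u + (2 * (c - dot u a)) *: a) x - (c * (1 + m) - 2 * dot u a))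
  / idenom x.
Proof.
by move=> h; rewrite /iproj !dotL; move: h; rewrite /idenom => h; field.
Qed.

(** An exact difference formula instead of a derivative: [iproj (o + d) - iproj o] is this linear
    function of [d] divided by [idenom (o + d)]. Hence images of flats are spanned by images of
    directions, and Lipschitz bounds reduce to bounds on the denominator. *)
Definition itangent o d : V := (m - 1) *: d + (2 * dot a d) *: (iproj o - a).

Lemma iproj_add o d : idenom o != 0 -> idenom (o + d) != 0 ->
  iproj (o + d) = iproj o + (idenom (o + d))^-1 *: itangent o d.
Proof.
move=> h; rewrite /iproj /itangent /iproj => h2; apply/rowP => i; rewrite !mxE !dotL.
move: h h2; rewrite /idenom !dotL => h h2; field.
by rewrite h h2.
Qed.

Definition itangent_mx o : 'M[R]_3 := (m - 1)%:M + 2 *: (a^T *m (iproj o - a)).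

Lemma itangentE o d : d *m itangent_mx o = itangent o d.
Proof.
rewrite /itangent_mx mulmxDr mul_mx_scalar -scalemxAr mulmxA; congr (_ + _).
rewrite -scalerA; congr (_ *: _).
have -> : d *m a^T = (dot a d)%:M.
  by rewrite [LHS]mx11_scalar dotC.
by rewrite mul_scalar_mx.
Qed.

(** The product of [itangent o d] with [a] is [- dot a d * idenom (iproj o)], whose second factor is
    nonzero. So [dot a d = 0], and what remains is [(m - 1) *: d]. *)
Lemma itangent_inj o d : idenom o != 0 -> itangent o d = 0 -> d = 0.
Proof.
move=> h h0; have h2 : m - 1 != 0 by rewrite subr_eq0 gt_eqF.
have h1 : dot a d * idenom (iproj o) = 0.
  have : dot a (itangent o d) = 0 by rewrite h0 dotL.
  by rewrite /itangent /idenom !dotL => E; rewrite -[RHS]oppr0 -{}E; ring.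
have ad : dot a d = 0.
  apply/eqP; move/eqP : h1; rewrite mulf_eq0 idenom_iproj // => /orP[//|].
  by rewrite mulf_eq0 invr_eq0 (negbTE h) orbF sqrf_eq0 (negbTE h2).
move: h0; rewrite /itangent ad mulr0 scale0r addr0 => /eqP.
by rewrite scaler_eq0 (negbTE h2) /= => /eqP.
Qed.

Lemma itangent_mx_unit o : idenom o != 0 -> itangent_mx o \in unitmx.
Proof.
move=> h; rewrite -row_free_unit -kermx_eq0; apply/eqP/row_matrixP => i.
rewrite row0; apply: (itangent_inj h); rewrite -itangentE.
by rewrite -row_mul mulmx_ker row0.
Qed.

End Inversion.

(** * Flats, dimension and relative balls *)

Section Flats.
Context {R : realType}.
Local Notation V := 'rV[R]_3.
Implicit Types (x y z u d : V) (S F P : set V).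

(** The ball is taken inside the affine hull, so that faces of every dimension contain one. *)
Definition rel_ball F x0 r :=
  [/\ 0 < r, F x0 & forall z, aff_hull F z -> enorm (z - x0) <= r -> F z].

Lemma flat_comb k o (B : 'M[R]_(k, 3)) n (p : 'I_n -> V) w :
  (forall i, flat o B (p i)) -> \sum_i w i = 1 -> flat o B (\sum_i w i *: p i).
Proof.
move=> h w1.
have /choice[t ht] i : exists t, p i = o + t *m B by have [t _ <-] := h i; exists t.
exists (\sum_i w i *: t i) => //.
rewrite mulmx_suml -[X in X + _ = _]scale1r -w1 scaler_suml -big_split /=.
by apply: eq_bigr => i _; rewrite ht scalerDr scalemxAl.
Qed.

Lemma flat_sub k o (B : 'M[R]_(k, 3)) x y : flat o B x -> flat o B y ->
  exists t, y = x + t *m B.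
Proof.
move=> [t _ <-] [s _ <-]; exists (s - t); rewrite mulmxBl.
by rewrite addrAC addrA subrK.
Qed.

Lemma flat_rebase k o (B : 'M[R]_(k, 3)) x : flat o B x -> flat o B = flat x B.
Proof.
move=> [t _ <-]; apply/seteqP; split => _ [s _ <-].
  by exists (s - t) => //; rewrite mulmxBl addrAC -addrA subrK.
by exists (t + s) => //; rewrite mulmxDl addrA.
Qed.

(** The ball is centered at the barycenter, where all weights are 1/n. Each basis direction of the
    hull is a combination of the generators with total weight 0, so a small displacement perturbs
    the weights by at most 1/n. *)
Lemma cvx_rel_ball n (q : 'I_n -> V) k :
  has_dim (cvx q) k -> exists x0 r, rel_ball (cvx q) x0 r.
Proof.
move=> [pt [B [/row_freeP[E BE]]]]; rewrite aff_hull_cvx => FE.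
have n0 : (0 < n)%N.
  case: n => // in q FE *; have : afc q pt by rewrite FE; exists 0; rewrite ?mul0mx ?addr0.
  by case=> w [/esym/eqP]; rewrite big_ord0 oner_eq0.
have nR : 0 < n%:R :> R by rewrite ltr0n.
have /choice[c hc] (j : 'I_k) : exists c : 'I_n -> R,
    \sum_i c i = 0 /\ row j B = \sum_i c i *: q i.
  have [w [w1 wo]] : afc q pt by rewrite FE; exists 0; rewrite ?mul0mx ?addr0.
  have [v [v1 vo]] : afc q (pt + delta_mx 0 j *m B) by rewrite FE; exists (delta_mx 0 j).
  exists (fun i => v i - w i); split; first by rewrite sumrB w1 v1 subrr.
  under eq_bigr do rewrite scalerBl.
  by rewrite sumrB -wo -vo rowE addrAC subrr add0r.
have x0w : \sum_(i < n) n%:R^-1 = 1 :> R.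
  by rewrite sumr_const card_ord -[_ *+ n]mulr_natr mulVf // lt0r_neq0.
pose x0 := \sum_i n%:R^-1 *: q i.
have x0q : cvx q x0 by exists (fun=> n%:R^-1); split => // i; rewrite invr_ge0 ltW.
(* [K] bounds the coordinates of a displacement in the basis [B], and [C] the change of weights that
   these coordinates cause; the added 1 below keeps the radius defined when both vanish. *)
pose K := \sum_l \sum_j `|E l j|; pose C := \sum_j \sum_i `|c j i|.
have K0 : 0 <= K by do 2![apply: sumr_ge0 => ? _].
have C0 : 0 <= C by do 2![apply: sumr_ge0 => ? _].
have KC1 : 0 < K * C + 1 by rewrite ltr_wpDl // mulr_ge0.
exists x0, (n%:R * (K * C + 1))^-1; split => //; first by rewrite invr_gt0 mulr_gt0.
move=> z; rewrite aff_hull_cvx => zq zr.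
have [t zE] : exists t, z = x0 + t *m B.
  by apply: (@flat_sub _ pt); rewrite -FE //; exact: cvx_afc.
have tE : t = (z - x0) *m E by rewrite zE addrAC subrr add0r -mulmxA BE mulmx1.
have tK j : `|t 0 j| <= (n%:R * (K * C + 1))^-1 * K.
  rewrite tE mxE; apply: le_trans (ler_norm_sum _ _ _) _.
  rewrite /K mulr_sumr; apply: ler_sum => l _; rewrite normrM ler_pM //.
    by apply: le_trans zr; exact: coord_le_enorm.
  by rewrite (bigD1 j) //= lerDl sumr_ge0.
exists (fun i => n%:R^-1 + \sum_j t 0 j * c j i); split.
  move=> i; rewrite -lerBlDl sub0r lerNl.
  apply: le_trans (ler_norm _) _; rewrite normrN.
  apply: le_trans (ler_norm_sum _ _ _) _.
  apply: (@le_trans _ _ ((n%:R * (K * C + 1))^-1 * K * C)).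
    rewrite /C mulr_sumr; apply: ler_sum => j _; rewrite normrM ler_pM //.
    by rewrite (bigD1 i) //= lerDl sumr_ge0.
  rewrite invfM -!mulrA ger_pMr ?invr_gt0 // mulrC ler_pdivrMr // mul1r.
  by rewrite lerDl.
split.
  rewrite big_split /= x0w exchange_big /= big1 ?addr0 // => j _.
  by rewrite -mulr_sumr (hc j).1 mulr0.
under eq_bigr do rewrite scalerDl.
rewrite big_split /= zE; congr (_ + _).
under eq_bigr do rewrite scaler_suml.
rewrite exchange_big /= mulmx_sum_row; apply: eq_bigr => j _.
by rewrite (hc j).2 scaler_sumr; apply: eq_bigr => i _; rewrite scalerA.
Qed.

Lemma interior_enorm P x r : 0 < r -> (forall z, enorm (z - x) <= r -> P z) ->
  interior P x.
Proof.
move=> r0 h; rewrite /interior /= nbhs_ballP; exists (r / 3%:R) => /=.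
  by rewrite divr_gt0.
move=> z; rewrite -ball_normE /= => zr; apply: h.
rewrite enormB; apply: le_trans (enorm_le_norm _) _.
by rewrite mulrC -ler_pdivlMr // ltW.
Qed.

Lemma interior_ball P x : interior P x ->
  exists2 r, 0 < r & forall z, enorm (z - x) <= r -> P z.
Proof.
rewrite /interior /= nbhs_ballP => -[e /= e0 h]; exists (e / 2).
  by rewrite divr_gt0.
move=> z zr; apply: h; rewrite -ball_normE /= distrC.
have -> : `|z - x| = mx_norm (z - x) by [].
rewrite mx_normrE; apply: (@le_lt_trans _ _ (e / 2)); last by lra.
apply: bigmax_le => [|[i j] _]; first by rewrite ltW // divr_gt0.
by rewrite (ord1 i); exact: le_trans (coord_le_enorm _ _) zr.
Qed.

Lemma interior_has_dim P x : interior P x -> has_dim P 3.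
Proof.
move=> /interior_ball[r r0 h]; exists 0, 1%:M; split.
  by rewrite row_free_unit unitmx1.
apply/seteqP; split => z _; first by exists z; rewrite ?mulmx1 ?add0r.
have [->|zx] := eqVneq z x.
  by apply: sub_aff_hull; apply: h; rewrite subrr enorm0 ltW.
have e0 : 0 < enorm (z - x) by apply: enorm_gt0; rewrite subr_eq0.
have -> : z = x + (enorm (z - x) / r) *: ((x + (r / enorm (z - x)) *: (z - x)) - x).
  rewrite [x + _ - x]addrAC subrr add0r scalerA mulrA divfK ?lt0r_neq0 //.
  by rewrite divff ?lt0r_neq0 // scale1r addrCA subrr addr0.
apply: aff_hull_line; apply: sub_aff_hull; apply: h.
  by rewrite subrr enorm0 ltW.
rewrite addrAC subrr add0r enormZ ger0_norm ?divfK ?lt0r_neq0 //.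
by rewrite divr_ge0 // ltW.
Qed.

Lemma has_dim3_interior n (q : 'I_n -> V) :
  has_dim (cvx q) 3 -> interior (cvx q) !=set0.
Proof.
move=> d3; have [x0 [r [r0 _ h]]] := cvx_rel_ball d3.
exists x0; apply: (interior_enorm r0) => z zr; apply: h => //.
have [pt [A [Af ->]]] := d3.
exists ((z - pt) *m invmx A) => //.
by rewrite mulmxKV -?row_free_unit // addrC subrK.
Qed.

Lemma convex_polyhedronE P : convex_polyhedron P <->
  (exists n (p : 'I_n -> V), P = cvx p) /\ has_dim P 3.
Proof.
split=> [[[S [/finite_range[n [p ->]] ->]] [x xP]]|[[n [p ->]] d3]].
  by split; [exists n, p; rewrite conv_hull_range|exact: interior_has_dim xP].
split; last exact: has_dim3_interior.
by exists (range p); split; [exact: range_finite|rewrite conv_hull_range].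
Qed.

End Flats.

(** * Images of faces under the projective map *)

Section Projective.
Context {R : realType}.
Local Notation V := 'rV[R]_3.
Implicit Types (x y z u d : V) (S F P : set V).
Variable a : V.
Local Notation m := (dot a a).
Hypothesis m1 : 1 < m.
Local Notation A := (iproj a).
Local Notation D := (idenom a).

Definition Dpos S := forall x, S x -> 0 < D x.

Lemma Dpos_cvx n (p : 'I_n -> V) : (forall i, 0 < D (p i)) -> Dpos (cvx p).
Proof.
move=> h _ [w [w0 [w1 ->]]]; rewrite idenom_comb // lt0r.
rewrite sumr_ge0 ?andbT => [|i _]; last by rewrite mulr_ge0 // ltW.
rewrite psumr_eq0 => [|i _]; last by rewrite mulr_ge0 // ltW.
apply/negP => /allP N; have : \sum_i w i = 0; last by rewrite w1 => /eqP; rewrite oner_eq0.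
apply: big1 => i _; have := N i; rewrite mem_index_enum => /(_ isT) /=.
by rewrite mulf_eq0 (gt_eqF (h i)) orbF => /eqP.
Qed.

Lemma Dpos_image S : Dpos S -> Dpos (A @` S).
Proof.
move=> h _ [x /h Dx <-]; rewrite idenom_iproj ?lt0r_neq0 // divr_gt0 //.
by rewrite exprn_gt0 // subr_gt0.
Qed.

Lemma imageK S : Dpos S -> A @` (A @` S) = S.
Proof.
move=> h; apply/seteqP; split => [_ [_ [x Sx <-] <-]|x Sx].
  by rewrite iprojK ?lt0r_neq0 ?h.
by exists (A x); [exists x|rewrite iprojK ?lt0r_neq0 ?h].
Qed.

Lemma image_inj S S' : Dpos S -> Dpos S' -> A @` S = A @` S' -> S = S'.
Proof. by move=> h h' /(congr1 (fun S => A @` S)); rewrite !imageK. Qed.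

Lemma image_cvx n (p : 'I_n -> V) : (forall i, 0 < D (p i)) ->
  A @` cvx p = cvx (A \o p).
Proof.
(* One inclusion suffices: applied to [A \o p], it gives the other because [A] is an involution. *)
have sub (q : 'I_n -> V) : (forall i, 0 < D (q i)) -> A @` cvx q `<=` cvx (A \o q).
  move=> h _ [x xq <-]; have Dx := Dpos_cvx h xq.
  move: xq Dx => [w [w0 [w1 ->]]] Dx.
  have h' i : D (q i) != 0 by rewrite lt0r_neq0.
  rewrite iproj_comb //.
  exists (fun i => w i * D (q i) / D (\sum_i w i *: q i)); split.
    by move=> i; rewrite divr_ge0 ?mulr_ge0 // ltW.
  by split => //; rewrite -mulr_suml -idenom_comb // divff // lt0r_neq0.
move=> h; apply/seteqP; split; first exact: sub.
have h2 i : 0 < D ((A \o p) i).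
  by apply: (@Dpos_image [set p i]); [move=> _ ->|exists (p i)].
move=> x xq; have Dx := Dpos_cvx h2 xq; exists (A x); last first.
  by rewrite iprojK ?lt0r_neq0.
have -> : cvx p = cvx (A \o (A \o p)).
  by congr cvx; apply/funext => i /=; rewrite iprojK ?lt0r_neq0.
by apply: sub => //; exists x.
Qed.

Lemma image_is_face P F : Dpos P -> is_face P F -> is_face (A @` P) (A @` F).
Proof.
move=> DP [[x0 Fx0] [u [c [Pu FE]]]]; split; first by exists (A x0), x0.
exists ((m - 1) *: u + (2 * (c - dot u a)) *: a), (c * (1 + m) - 2 * dot u a).
(* The defect of the supporting inequality is multiplied by the positive number [D (A x)], so its
   sign and its zeros are kept. *)
have key x : P x ->
    dot ((m - 1) *: u + (2 * (c - dot u a)) *: a) (A x) - (c * (1 + m) - 2 * dot u a)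
    = (dot u x - c) * D (A x).
  move=> Px; have DA : D (A x) != 0 by rewrite lt0r_neq0 //; apply: (Dpos_image DP); exists x.
  have := iproj_half u c DA; rewrite iprojK // ?lt0r_neq0 ?DP // => ->.
  by rewrite divfK.
have DAx x : P x -> 0 < D (A x) by move=> Px; apply: (Dpos_image DP); exists x.
split=> [_ [x Px <-] /=|].
  by rewrite -subr_le0 key // mulr_le0_ge0 ?(ltW (DAx _ _)) // subr_le0; exact: Pu.
apply/seteqP; split => [_ [x Fx <-]|_ [[x Px <-]] /= h].
  have [Px /= ux] : (P `&` [set x | dot u x = c]) x by rewrite -FE.
  by split; [exists x|apply/eqP; rewrite -subr_eq0 key // ux subrr mul0r].
exists x => //; rewrite FE; split => //=; apply/eqP; rewrite -subr_eq0.
move/eqP : h; rewrite -subr_eq0 key // mulf_eq0 => /orP[//|].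
by rewrite gt_eqF ?DAx.
Qed.

Lemma aff_image S x : Dpos S -> D x != 0 -> aff_hull S x -> aff_hull (A @` S) (A x).
Proof.
move=> DS Dx [n [w [p [pS [w1 xE]]]]]; rewrite xE in Dx *.
have h i : D (p i) != 0 by rewrite lt0r_neq0 ?DS.
exists n, (fun i => w i * D (p i) / D (\sum_i w i *: p i)), (A \o p).
split; first by move=> i; exists (p i).
split; last by rewrite iproj_comb.
by rewrite -mulr_suml -idenom_comb // divff.
Qed.

(** The affine hull of [F] may meet the plane that goes to infinity even if [F] does not, but its
    points on the sphere have positive denominator. This transports tangency points and face
    circles. *)
Lemma aff_image_S2 F : Dpos F ->
  aff_hull (A @` F) `&` S2 = A @` (aff_hull F `&` S2).
Proof.
move=> DF; apply/seteqP; split => [y [yF y1]|_ [x [xF x1] <-]].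
  have Dy := lt0r_neq0 (idenom_S2 m1 y1).
  exists (A y); last by rewrite iprojK.
  split; last exact: iproj_S2.
  by rewrite -(imageK DF); apply: aff_image => //; exact: Dpos_image.
split; last exact: iproj_S2.
by apply: aff_image => //; exact/lt0r_neq0/idenom_S2.
Qed.

Lemma image_has_dim k F : Dpos F -> F !=set0 -> has_dim F k -> has_dim (A @` F) k.
Proof.
move=> DF -[pt Fo] [pt' [B [Bf FE]]].
have ptF : flat pt' B pt by rewrite -FE; exact: sub_aff_hull.
rewrite (flat_rebase ptF) in FE.
have Dpt := lt0r_neq0 (DF _ Fo).
exists (A pt), (B *m itangent_mx a pt); split.
  by rewrite /row_free mxrankMfree // row_free_unit itangent_mx_unit.
apply/seteqP; split=> [_ [n [w [p [pF [w1 ->]]]]]|_ [t _ <-]].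
  apply: flat_comb => // i; have [x Fx <-] := pF i.
  have [t _ xE] : flat pt B x by rewrite -FE; exact: sub_aff_hull.
  have Dx := lt0r_neq0 (DF _ Fx).
  rewrite -xE in Dx *; rewrite iproj_add //.
  exists ((D (pt + t *m B))^-1 *: t) => //.
  by rewrite -scalemxAl mulmxA itangentE.
pose d := t *m B.
(* The point [pt + d] may lie beyond the plane at infinity. The factor [l] shortens [d] enough for
   the denominator to stay positive; the image of the shortened step is then prolonged along its
   line. *)
pose l := D pt / (2 * (1 + `|2 * dot a d|)).
have q0 : 0 < 2 * (1 + `|2 * dot a d|) by rewrite mulr_gt0 // ltr_wpDr.
have l0 : 0 < l by rewrite divr_gt0 // DF.
have Dl : 0 < D (pt + l *: d).
  have : `|l * (2 * dot a d)| < D pt.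
    rewrite normrM gtr0_norm // /l mulrAC ltr_pdivrMr // ltr_pM2l ?DF //.
    by have := normr_ge0 (2 * dot a d); lra.
  rewrite ltr_norml /idenom !dotL => /andP[_]; lra.
have dE : A pt + d *m itangent_mx a pt = A pt + (D (pt + l *: d) / l) *: (A (pt + l *: d) - A pt).
  rewrite (iproj_add Dpt (lt0r_neq0 Dl)) addrAC subrr add0r scalerA itangentE.
  rewrite -[_ / l * _]mulrAC divff ?lt0r_neq0 // mul1r.
  have -> : itangent a pt (l *: d) = l *: itangent a pt d.
    rewrite /itangent [RHS]scalerDr !scalerA dotZr.
    by congr (_ *: _ + _ *: _); ring.
  by rewrite scalerA mulVf ?lt0r_neq0 // scale1r.
rewrite mulmxA -/d dE; apply: aff_hull_line.
  by apply: sub_aff_hull; exists pt.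
apply: aff_image => //; first exact: lt0r_neq0.
by rewrite FE; exists (l *: t) => //; rewrite -scalemxAl.
Qed.

Lemma image_faces k P F : Dpos P -> faces k P F -> faces k (A @` P) (A @` F).
Proof.
move=> DP [fF dF]; split; first exact: image_is_face.
apply: image_has_dim => //; last exact: fF.1.
by case: fF => _ [u [c [_ ->]]] x [/DP].
Qed.

End Projective.

(** * The image polyhedron and its circles *)

Section MobiusImage.
Context {R : realType}.
Local Notation V := 'rV[R]_3.
Implicit Types (x y z u d t : V) (S F P E C : set V).
Variable a : V.
Local Notation m := (dot a a).
Hypothesis m1 : 1 < m.
Local Notation A := (iproj a).
Local Notation D := (idenom a).

Lemma tangent_image E t : Dpos a E -> tangent_at E t -> tangent_at (A @` E) (A t).
Proof.
move=> DE [Et Ht]; split; first by exists t.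
by rewrite aff_image_S2 // Ht image_set1.
Qed.

Lemma Dpos_face P F k : Dpos a P -> faces k P F -> Dpos a F.
Proof. by move=> DP [[_ [u [c [_ ->]]]] _] x [/DP]. Qed.

Lemma image_facesE k P : Dpos a P ->
  faces k (A @` P) = [set A @` F | F in faces k P].
Proof.
move=> DP; have DA := Dpos_image m1 DP.
apply/seteqP; split => [F FQ|_ [F FP <-]]; last exact: image_faces.
have := image_faces m1 DA FQ; rewrite imageK // => FP.
by exists (A @` F) => //; rewrite imageK //; exact: Dpos_face FQ.
Qed.

Lemma koebe_image P : koebe P -> Dpos a P -> koebe (A @` P).
Proof.
move=> [/convex_polyhedronE[[n [p pE]] d3] PE] DP; split.
  apply/convex_polyhedronE; split.
    exists n, (A \o p); rewrite pE image_cvx // => i.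
    by apply: DP; rewrite pE; exact: cvx_vertex.
  apply: image_has_dim => //; rewrite pE in d3 *.
  by have [x [r [_ Px _]]] := cvx_rel_ball d3; exists x.
move=> E; rewrite image_facesE // => -[E' E'P <-].
have [t tE] := PE _ E'P; exists (A t); apply: tangent_image => //.
exact: Dpos_face E'P.
Qed.

Lemma circle_image C : is_circle C -> is_circle (A @` C).
Proof.
move=> [[u [c [u0 CE]]] [x [y [Cx [Cy xy]]]]].
have CS z : C z -> S2 z by rewrite CE => -[].
have AK z : S2 z -> A (A z) = z.
  by move=> z1; rewrite iprojK // lt0r_neq0 // idenom_S2.
pose u' := (m - 1) *: u + (2 * (c - dot u a)) *: a.
pose c' := c * (1 + m) - 2 * dot u a.
have key z : S2 z -> dot u' (A z) - c' = (dot u z - c) * D (A z).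
  move=> z1; have DA : D (A z) != 0 by rewrite lt0r_neq0 // idenom_S2 //; exact: iproj_S2.
  by have := iproj_half u c DA; rewrite AK // => ->; rewrite divfK.
split; last first.
  exists (A x), (A y); split; [by exists x|split; first by exists y].
  by move=> h; apply: xy; rewrite -(AK x) ?h ?AK //; exact: CS.
exists u', c'; split; last first.
  apply/seteqP; split => [_ [z Cz <-]|z [z1 /= uz]].
    have [z1 /= uz] : (S2 `&` [set x | dot u x = c]) z by rewrite -CE.
    split; first exact: iproj_S2.
    by apply/eqP; rewrite -subr_eq0 key // uz subrr mul0r.
  have Az1 : S2 (A z) by exact: iproj_S2.
  exists (A z); last exact: AK.
  rewrite CE; split => //=; have := key _ Az1; rewrite AK // uz subrr.
  move=> /esym/eqP; rewrite mulf_eq0 subr_eq0 => /orP[/eqP//|].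
  by rewrite gt_eqF // idenom_S2.
(* If the new normal vanished, then so would [c'], and the old plane would contain the whole sphere,
   which fails at the two antipodal points in the direction of [u]. *)
apply/eqP => u'0.
have c'0 : c' = 0.
  have := key x (CS _ Cx); rewrite u'0 dotL.
  have : (S2 `&` [set x | dot u x = c]) x by rewrite -CE.
  by move=> [_ /= ->]; rewrite subrr mul0r sub0r => /eqP; rewrite oppr_eq0 => /eqP.
have all z : S2 z -> dot u z = c.
  move=> z1; have := key z z1; rewrite u'0 c'0 dotL subrr => /esym/eqP.
  by rewrite mulf_eq0 subr_eq0 => /orP[/eqP//|]; rewrite gt_eqF // idenom_S2 //; exact: iproj_S2.
have nu := enorm_gt0 u0.
have z1 : S2 ((enorm u)^-1 *: u).
  by rewrite /S2 /= enormZ ger0_norm ?invr_ge0 ?ltW // mulVf // lt0r_neq0.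
have z2 : S2 (- ((enorm u)^-1 *: u)) by rewrite /S2 /= enormN; exact: z1.
have := all _ z2; rewrite dotNr (all _ z1) => c0; have := all _ z1.
rewrite dotZr -sqr_enorm expr2 mulrA mulVf ?lt0r_neq0 // mul1r => uc.
by move: nu; rewrite uc; lra.
Qed.

Lemma vertices_image P v : Dpos a P -> vertices P v -> vertices (A @` P) (A v).
Proof. by move=> DP vP; rewrite /vertices /= -image_set1; exact: image_faces. Qed.

Lemma vertex_circle_image P v C : Dpos a P -> P v -> vertex_circle P v C ->
  vertex_circle (A @` P) (A v) (A @` C).
Proof.
move=> DP Pv [Cc h]; split; first exact: circle_image.
move=> E t; rewrite image_facesE // => -[E' E'P <-] [w E'w wv] tE.
have DE' := Dpos_face DP E'P.
have wE : w = v.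
  by rewrite -(iprojK m1 (lt0r_neq0 (DE' _ E'w))) wv iprojK // lt0r_neq0 // DP.
have := tangent_image (Dpos_image m1 DE') tE; rewrite imageK // => tE'.
exists (A t); first by apply: h tE' => //; rewrite -wE.
have [[s E's <-] _] := tE; by rewrite (iprojK m1 (lt0r_neq0 (DE' _ E's))).
Qed.

Lemma vertex_in P v : vertices P v -> P v.
Proof.
by move=> [[_ [u [c [_ E]]]] _]; have : [set v] v by []; rewrite E => -[].
Qed.

Lemma mobius_inversion_image P : koebe P -> Dpos a P ->
  mobius (inversion a \o id) /\ mobius_image (inversion a \o id) P (A @` P).
Proof.
move=> kP DP; split; first by apply: mobius_inversion => //; exact: mobius_id.
(* The inversion and its projective extension agree on the sphere, which is where all circles
   lie. *)
have TA C : C `<=` S2 -> (inversion a \o id) @` C = A @` C.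
  by move=> CS; apply/seteqP; split => _ [x Cx <-]; exists x => //=;
    rewrite inversion_S2 //; exact: CS.
have DA := Dpos_image m1 DP.
split; first exact: koebe_image.
  rewrite /face_circles image_facesE //.
  apply/seteqP; split => [_ [_ [F FP <-] <-]|_ [_ [F FP <-] <-]].
    exists (aff_hull F `&` S2); first by exists F.
    by rewrite TA; [rewrite aff_image_S2 //; exact: Dpos_face FP|exact: subIsetr].
  exists (A @` F); first by exists F.
  by rewrite TA; [rewrite aff_image_S2 //; exact: Dpos_face FP|exact: subIsetr].
have CS C : is_circle C -> C `<=` S2 by move=> [[u [c [_ ->]]] _] x [].
apply/seteqP; split => [C [v [vQ vC]]|_ [C [v [vP vC]] <-]]; last first.
  rewrite TA; last by case: vC => /CS.
  exists (A v); split; first exact: vertices_image.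
  by apply: vertex_circle_image => //; exact: vertex_in.
have vP := vertices_image DA vQ.
have vC' := vertex_circle_image DA (vertex_in vQ) vC.
rewrite imageK // in vP vC'.
exists (A @` C); first by exists (A v).
rewrite TA; last by case: vC' => /CS.
by rewrite imageK // => x; case: vC => /CS h _ /h; exact: idenom_S2.
Qed.

End MobiusImage.

(** * Faces at the vertex of largest norm *)

Section FacesAtVertex.
Context {R : realType}.
Local Notation V := 'rV[R]_3.
Implicit Types (x y z u w e f v : V) (S F P : set V).

Lemma dot_sub x y : dot (x - y) (x - y) = dot x x - 2 * dot y x + dot y y.
Proof. by rewrite !dotL (dotC x y); ring. Qed.

Lemma max_ex n (Q : pred 'I_n) (f : 'I_n -> R) j : Q j ->
  exists2 i, Q i & forall k, Q k -> f k <= f i.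
Proof. by move=> Qj; case: (@arg_maxP _ _ _ j Q f Qj) => i Qi h; exists i. Qed.

Lemma orth2 u e : exists w, [/\ w != 0, dot w u = 0 & dot w e = 0].
Proof.
have : kermx (row_mx u^T e^T) != 0.
  rewrite kermx_eq0 /row_free; apply/eqP => h.
  by have := rank_leq_col (row_mx u^T e^T); rewrite h.
move=> /rowV0Pn[w /sub_kermxP wK w0]; exists w; split => //.
  by rewrite /dot -[w *m u^T](row_mxKl _ (w *m e^T)) -mul_mx_row wK linear0 mxE.
by rewrite /dot -[w *m e^T](row_mxKr (w *m u^T)) -mul_mx_row wK linear0 mxE.
Qed.

(** The orthogonal complement of [f] has rank 2, so two independent vectors in it span it. *)
Lemma orth_span2 f e g x : f != 0 -> dot f e = 0 -> dot f g = 0 ->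
  row_free (col_mx e g) -> dot f x = 0 -> exists t : 'rV_(1 + 1), x = t *m col_mx e g.
Proof.
move=> f0 fe fg fr fx; apply/submxP.
have Kf : \rank (kermx f^T) = 2%N by rewrite mxrank_ker mxrank_tr rank_rV f0.
have in_ker y : dot f y = 0 -> (y <= kermx f^T)%MS.
  move=> fy; apply/sub_kermxP; apply/matrixP => i j; rewrite !ord1 [RHS]mxE.
  by have := dotC y f; rewrite fy.
have sub : (col_mx e g <= kermx f^T)%MS by rewrite col_mx_sub !in_ker.
have : (col_mx e g == kermx f^T)%MS.
  by rewrite -(geq_leqif (mxrank_leqif_eq sub)) Kf; move: fr; rewrite /row_free => /eqP ->.
by move=> /eqmxP ->; exact: in_ker.
Qed.

Lemma has_dim_span n (q : 'I_n -> V) k (B : 'M[R]_(k, 3)) v : row_free B ->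
  cvx q v -> (forall i, flat v B (q i)) ->
  (forall j, aff_hull (cvx q) (v + row j B)) -> has_dim (cvx q) k.
Proof.
move=> Bf qv qB Bq; exists v, B; split => //; rewrite aff_hull_cvx in Bq *.
apply/seteqP; split => [_ [w [w1 ->]]|_ [t _ <-]]; first exact: flat_comb.
pose s (j : 'I_(k + 1)) := match fintype.split j with inl j => v + row j B | inr _ => v end.
have sl (j : 'I_k) : fintype.split (lshift 1 j) = inl j by exact: (unsplitK (inl j)).
have sr (j : 'I_1) : fintype.split (rshift k j) = inr j by exact: (unsplitK (inr j)).
apply: (@afc_comb _ _ _ _ s).
  by move=> j; rewrite /s; case: fintype.split => [i|_]; [exact: Bq|exact: cvx_afc].
exists (fun j => match fintype.split j with inl j => t 0 j | inr _ => 1 - \sum_j t 0 j end).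
rewrite !big_split_ord !big_ord1 /= /s sr.
under eq_bigr => i _ do rewrite sl.
under [X in _ = X + _]eq_bigr => i _ do rewrite sl scalerDr.
split; first by rewrite addrCA subrr addr0.
rewrite big_split /= -mulmx_sum_row -scaler_suml addrAC -scalerDl.
by rewrite addrCA subrr addr0 scale1r.
Qed.

Lemma exposed_vertex n (q : 'I_n -> V) x u : cvx q x ->
  (forall i, q i != x -> dot u (q i) < dot u x) -> faces 0 (cvx q) [set x].
Proof.
move=> qx ux.
have fF : is_face (cvx q) (cvx q `&` [set y | dot u y = dot u x]).
  split; first by exists x.
  exists u, (dot u x); split => //; apply: cvx_le => i.
  by have [->|/ux/ltW] := eqVneq (q i) x.
suff E : cvx q `&` [set y | dot u y = dot u x] = [set x].
  rewrite E in fF; split => //; exists x, 0; split.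
    by rewrite /row_free mxrank0.
  apply/seteqP; split => [_ [k [w [r [rx [w1 ->]]]]]|_ [t _ <-]].
    exists 0 => //; rewrite mulmx0 addr0; under eq_bigr do rewrite rx.
    by rewrite -scaler_suml w1 scale1r.
  by rewrite mulmx0 addr0; exact: sub_aff_hull.
have [r [FE Fr rq _]] := face_cvx fF.
apply/seteqP; split => [y|_ ->]; last by split.
have rx i : r i = x.
  have [_ /= h] := Fr i; have [j rj] := rq i; rewrite rj in h *.
  by apply/eqP; apply: contraT => /ux; rewrite h ltxx.
rewrite FE => -[w [_ [w1 ->]]] /=; under eq_bigr do rewrite rx.
by rewrite -scaler_suml w1 scale1r.
Qed.

Section Vertex.
Variables (n : nat) (p : 'I_n -> V) (v : V).
Hypothesis d3 : has_dim (cvx p) 3.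
Hypothesis vmax : forall i, p i != v -> dot v (p i) < dot v v.
Hypothesis vp : exists i, p i = v.

Lemma not_in_plane f c : f != 0 -> exists i, dot f (p i) != c.
Proof.
move=> f0; apply: contrapT => /forallNP N.
have all x : dot f x = c.
  have [pt [B [Bf E]]] := d3.
  have : aff_hull (cvx p) x.
    rewrite E; exists ((x - pt) *m invmx B) => //.
    by rewrite mulmxKV -?row_free_unit // addrC subrK.
  rewrite aff_hull_cvx => -[w [w1 ->]]; apply/eqP.
  rewrite -subr_eq0 (dot_comb _ _ _ w1) big1 // => i _.
  by have /negP := N i; rewrite negbK => /eqP ->; rewrite subrr mulr0.
by have := dot_gt0 f0; rewrite (all f) -(all 0) dot0r ltxx.
Qed.

Lemma vertex_v : cvx p v.
Proof. by have [i <-] := vp; exact: cvx_vertex. Qed.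

Lemma face_of_functional u c : dot u v = c -> (forall i, dot u (p i) <= c) ->
  is_face (cvx p) (cvx p `&` [set x | dot u x = c]).
Proof.
move=> uv h; split; first by exists v; split => //; exact: vertex_v.
by exists u, c; split => //; exact: cvx_le.
Qed.

Lemma face_at0 : faces 0 (cvx p) [set v].
Proof. exact: exposed_vertex vertex_v vmax. Qed.

(* The neighbours of v are the extreme points of its vertex figure; the one of
   maximal norm is exposed by itself. *)
Lemma edge_data : exists u c e, [/\ e != 0, dot u v = c /\ (forall i, dot u (p i) <= c),
  (forall i, dot u (p i) = c -> exists s, p i = v + s *: e) &
  exists i s, [/\ s != 0, dot u (p i) = c & p i = v + s *: e]].
Proof.
have [w [w0 _ _]] := orth2 0 0.
have [j pj] : exists j, p j != v.
  by have [j h] := not_in_plane (dot w v) w0; exists j; apply: contra h => /eqP->.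
(* Vertex figure by central projection from [v]: all [y i] lie on the plane [dot v y = -1]. On it
   the functional [e + dot e e *: v] equals [dot e y - dot e e], which is negative at every [y i]
   other than [e], because [e] has the largest norm among them. *)
pose h i := dot v v - dot v (p i); pose y i := (h i)^-1 *: (p i - v).
have h0 i : p i != v -> 0 < h i by move=> /vmax; rewrite subr_gt0.
have py i : p i != v -> p i = v + h i *: y i.
  by move=> /h0 hi; rewrite scalerA divff ?lt0r_neq0 // scale1r addrCA subrr addr0.
have [k pk kmax] := @max_ex _ (fun i => p i != v) (fun i => dot (y i) (y i)) _ pj.
pose e := y k; have eE : e = y k by [].
have key i : p i != v -> dot (e + dot e e *: v) (p i) - dot (e + dot e e *: v) v
    = h i * (dot e (y i) - dot e e).
  move=> pi; rewrite -dotNr -dotDr {1}(py _ pi) addrAC subrr add0r.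
  rewrite dotZr dotDl dotZl; congr (_ * (_ + _)).
  rewrite -mulrN1; congr (_ * _); rewrite /y dotZr dotDr dotNr -opprB mulrN.
  by rewrite mulVf // lt0r_neq0 // h0.
have le i : p i != v -> dot e (y i) <= dot e e ?= iff (y i == e).
  move=> pi; have m := kmax _ pi; rewrite -eE in m.
  have E : dot (y i - e) (y i - e) = dot (y i) (y i) - 2 * dot e (y i) + dot e e.
    exact: dot_sub.
  have D0 := dot_ge0 (y i - e); split; first by lra.
  apply/eqP/eqP => [h1|->//]; apply/eqP; rewrite -subr_eq0; apply/eqP.
  by apply: dot_eq0; apply/eqP; rewrite eq_le D0 andbT; lra.
exists (e + dot e e *: v), (dot (e + dot e e *: v) v), e; split.
- by apply/eqP => e0; move/eqP : (pk); apply; rewrite (py _ pk) -eE e0 scaler0 addr0.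
- split => // i; have [->//|pi] := eqVneq (p i) v.
  rewrite -subr_le0 key // pmulr_rle0 ?h0 // subr_le0; exact: (le i pi).
- move=> i; have [->|pi] := eqVneq (p i) v; first by exists 0; rewrite scale0r addr0.
  move=> /eqP; rewrite -subr_eq0 key // mulf_eq0 gt_eqF ?h0 //= subr_eq0.
  by rewrite (le i pi).2 => /eqP ye; exists (h i); rewrite -ye -py.
- exists k, (h k); split; [by rewrite lt0r_neq0 // h0| |exact: py].
  by apply/eqP; rewrite -subr_eq0 key // -eE subrr mulr0.
Qed.

Lemma face_at1 : exists F, faces 1 (cvx p) F /\ F v.
Proof.
have [u [c [e [e0 [uv uP] ue [i [s [s0 ui pi]]]]]]] := edge_data.
have fF := face_of_functional uv uP.
exists (cvx p `&` [set x | dot u x = c]); split; last by split; [exact: vertex_v|].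
split => //; have Fv : (cvx p `&` [set x | dot u x = c]) v by split; [exact: vertex_v|].
have Fi : (cvx p `&` [set x | dot u x = c]) (p i) by split; [exact: cvx_vertex|].
have [q [FE Fq qp _]] := face_cvx fF; rewrite FE in Fv Fi *.
apply: (@has_dim_span _ _ _ e v) => //.
- by rewrite /row_free rank_rV e0.
- move=> j; have [l ql] := qp j; have [_ /=] := Fq j; rewrite ql => /ue[r ->].
  by exists r%:M => //; rewrite mul_scalar_mx.
move=> j; have -> : v + row j e = v + s^-1 *: (p i - v).
  by rewrite pi addrAC subrr add0r scalerA mulVf // scale1r row_id.
by apply: aff_hull_line; exact: sub_aff_hull.
Qed.

(** The supporting plane of an edge at [v] is turned about that edge until it meets a further
    generator. The vector [w] is the direction of turning, and the largest slope [rho] tells where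
    to stop. *)
Lemma face_at2 : exists F, faces 2 (cvx p) F /\ F v.
Proof.
have [u [c [e [e0 [uv uP] ue [i [s [s0 ui pi]]]]]]] := edge_data.
have [w [w0 wu we]] := orth2 u e.
have ue0 : dot u e = 0.
  have : dot u (p i) = c by [].
  rewrite pi dotDr dotZr uv => /eqP; rewrite -subr_eq0 addrAC subrr add0r.
  by rewrite mulf_eq0 (negbTE s0) => /eqP.
have [j pj] : exists j, dot u (p j) != c.
  have [j wj] := not_in_plane (dot w v) w0; exists j.
  by apply: contra wj => /eqP /ue[r ->]; rewrite dotDr dotZr we mulr0 addr0.
pose xi i := c - dot u (p i); pose rho i := (dot w (p i) - dot w v) / xi i.
have xi0 k : dot u (p k) != c -> 0 < xi k by rewrite subr_gt0 lt_neqAle uP andbT.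
have [k pk kmax] := @max_ex _ (fun i => dot u (p i) != c) rho _ pj.
pose f := w + rho k *: u; pose c' := dot f v.
have f0 : f != 0.
  apply/eqP => f0; have : dot w f = dot w w by rewrite dotDr dotZr wu mulr0 addr0.
  by rewrite f0 dot0r => /esym/dot_eq0/eqP; rewrite (negbTE w0).
have fe : dot f e = 0 by rewrite /f dotDl dotZl we ue0 mulr0 addr0.
have on l : dot u (p l) = c -> dot f (p l) = c'.
  by move=> /ue[r ->]; rewrite /c' dotDr dotZr fe mulr0 addr0.
have off l : dot u (p l) != c -> dot f (p l) - c' = xi l * (rho l - rho k).
  move=> /xi0/lt0r_neq0; rewrite /c' /f /rho !dotL uv /xi => h; field.
  by rewrite h andbT subr_eq0 eq_sym.
have fP l : dot f (p l) <= c'.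
  have [/on->//|h] := eqVneq (dot u (p l)) c.
  by rewrite -subr_le0 off // pmulr_rle0 ?xi0 // subr_le0 kmax.
have fF := face_of_functional (erefl : dot f v = c') fP.
pose F := cvx p `&` [set x | dot f x = c'].
exists F; have Fv : F v by split; [exact: vertex_v|].
split => //; split => //.
have Fi : F (p i) by split; [exact: cvx_vertex|exact: on].
have Fk : F (p k).
  split; [exact: cvx_vertex|apply/eqP; rewrite -subr_eq0 /= off //].
  by rewrite subrr mulr0.
have [q [FE Fq qp _]] := face_cvx fF; rewrite -/F in FE Fq.
have fg : dot f (p k - v) = 0.
  by case: Fk => _ /= h; rewrite dotDr dotNr h subrr.
have Bf : row_free (col_mx e (p k - v)).
  rewrite -kermx_eq0; apply/eqP/row_matrixP => l; rewrite row0.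
  have := mulmx_ker (col_mx e (p k - v)) => /(congr1 (row l)); rewrite row_mul row0.
  set t := row l _; rewrite -[t]hsubmxK mul_row_col [lsubmx t]mx11_scalar [rsubmx t]mx11_scalar.
  rewrite !mul_scalar_mx; set t1 := lsubmx t 0 0; set t2 := rsubmx t 0 0 => h.
  have t20 : t2 = 0.
    have : dot u (t1 *: e + t2 *: (p k - v)) = 0 by rewrite h dot0r.
    rewrite dotDr !dotZr ue0 mulr0 add0r dotDr dotNr uv => /eqP.
    by rewrite mulf_eq0 subr_eq0 (negbTE pk) orbF => /eqP.
  move: h; rewrite t20 scale0r addr0 => /eqP; rewrite scaler_eq0 (negbTE e0) orbF.
  by move=> /eqP ->; rewrite !raddf0 row_mx0.
rewrite FE; apply: (@has_dim_span _ _ 2 (col_mx e (p k - v)) v) => //.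
- by rewrite -FE.
- move=> l; have [_ /= h] := Fq l.
  have [t tE] : exists t : 'rV_(1 + 1), q l - v = t *m col_mx e (p k - v).
    by apply: (@orth_span2 f) => //; rewrite dotDr dotNr h subrr.
  by exists t => //; rewrite -tE addrC subrK.
rewrite -FE => l; rewrite -(@splitK 1 1 l); case: (@fintype.split 1 1 l) => r /=.
  have -> : v + row (lshift 1 r) (col_mx e (p k - v)) = v + s^-1 *: (p i - v).
    by rewrite pi addrAC subrr add0r scalerA mulVf // scale1r rowKu row_id.
  by apply: aff_hull_line; exact: sub_aff_hull.
have -> : v + row (rshift 1 r) (col_mx e (p k - v)) = p k.
  by rewrite rowKd row_id addrC subrK.
exact: sub_aff_hull.
Qed.

Lemma face_at3 : faces 3 (cvx p) (cvx p).
Proof.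
split => //; split; first by exists v; exact: vertex_v.
exists 0, 0; split; first by move=> x _ /=; rewrite dot0l.
by apply/seteqP; split => x; [move=> px; split => //=; rewrite dot0l|case].
Qed.

Lemma face_at k : (k <= 3)%N -> exists F, faces k (cvx p) F /\ F v.
Proof.
case: k => [|[|[|[|//]]]] _.
- by exists [set v]; split => //; exact: face_at0.
- exact: face_at1.
- exact: face_at2.
- by exists (cvx p); split; [exact: face_at3|exact: vertex_v].
Qed.

End Vertex.

(** If |q| <= |v| and q differs from v, then |q - v|^2 > 0 gives 2 dot v q < |q|^2 + |v|^2 <= 2
    |v|^2. *)
Lemma max_norm_vertex n (p : 'I_n -> V) : has_dim (cvx p) 3 ->
  exists v, [/\ exists i, p i = v, forall i, p i != v -> dot v (p i) < dot v v
    & forall i, dot (p i) (p i) <= dot v v].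
Proof.
move=> d3; have [x [_ [_ [w [_ [w1 _]]] _]]] := cvx_rel_ball d3.
have [j _] : exists j : 'I_n, true.
  case: n p w d3 w1 => [|n] p w _ w1; last by exists ord0.
  by move/eqP: w1; rewrite big_ord0 eq_sym oner_eq0.
have [i _ imax] := @max_ex n predT (fun i => dot (p i) (p i)) j isT.
have le k : dot (p k) (p k) <= dot (p i) (p i) by exact: imax.
exists (p i); split => //; first by exists i.
move=> k pk; have : 0 < dot (p k - p i) (p k - p i) by apply: dot_gt0; rewrite subr_eq0.
by rewrite !dotL (dotC (p k) (p i)); have := le k; lra.
Qed.

(** An edge at [v] touches the sphere at some [t] and contains another point [y]. As [y - t] is
    orthogonal to [t], |y| > 1, and no point of the polyhedron has larger norm than [v]. *)
Lemma koebe_vertex_norm n (p : 'I_n -> V) v : koebe (cvx p) ->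
  (exists i, p i = v) -> (forall i, p i != v -> dot v (p i) < dot v v) ->
  (forall i, dot (p i) (p i) <= dot v v) -> 1 < dot v v.
Proof.
move=> [/convex_polyhedronE[_ d3] kE] vp vmax le.
have [E [EP Ev]] := face_at1 d3 vmax vp.
have [t [Et tE]] := kE _ EP.
have [y [Ey yt]] : exists y, E y /\ y != t.
  apply: contrapT => /forallNP N.
  have Es : E = [set t].
    apply/seteqP; split => [y Ey|_ ->//]; apply/eqP; apply: contraT => yt.
    by exfalso; apply: (N y).
  have [_ [pt [B [Bf FE]]]] := EP.
  have all x : flat pt B x -> x = t.
    rewrite -FE Es => -[k [w [q [qt [w1 ->]]]]]; under eq_bigr do rewrite qt.
    by rewrite -scaler_suml w1 scale1r.
  have p0 : pt = t by apply: all; exists 0; rewrite ?mul0mx ?addr0.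
  have : pt + 1%:M *m B = t by apply: all; exists 1%:M.
  rewrite p0 mul1mx => /eqP; rewrite -subr_eq0 addrAC subrr add0r => /eqP B0.
  by move: Bf; rewrite B0 /row_free mxrank0.
have t1 : dot t t = 1.
  by apply/S2E; have : (aff_hull E `&` S2) t by [rewrite tE]; case.
have [d dE] : exists d, d = y - t by exists (y - t).
have d0 : 0 < dot d d by apply: dot_gt0; rewrite dE subr_eq0.
have td : dot t d = 0.
  (* The parameter of the second intersection of the line with the sphere; since [t] is the only
     intersection, the two coincide. *)
  pose s := - (2 * dot t d) / dot d d.
  have : (aff_hull E `&` S2) (t + s *: d).
    split; first by rewrite dE; apply: aff_hull_line; exact: sub_aff_hull.
    apply/S2E; rewrite !dotL (dotC d t) t1 /s; field; exact: lt0r_neq0.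
  rewrite tE /= => /eqP; rewrite -subr_eq0 addrAC subrr add0r scaler_eq0.
  rewrite /s mulf_eq0 invr_eq0 (gt_eqF d0) orbF oppr_eq0 mulf_eq0 pnatr_eq0 /=.
  by move=> /orP[/eqP//|/eqP dz]; rewrite dz dot0r.
have y1 : 1 < dot y y.
  have -> : y = t + d by rewrite dE addrC subrK.
  by rewrite !dotL (dotC d t) t1 td; lra.
apply: lt_le_trans y1 _.
have yP : cvx p y by case: EP => -[_ [u [c [_ FE]]]] _; move: Ey; rewrite FE => -[].
have : eball 0 (enorm v) y.
  move: y yP {Ey yt d dE d0 td}; apply: cvx_ball => i; rewrite /eball /= subr0.
  by rewrite enorm_le_sqr ?enorm_ge0 // sqr_enorm.
by rewrite /eball /= subr0 enorm_le_sqr ?enorm_ge0 // sqr_enorm.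
Qed.

End FacesAtVertex.

(** * Lebesgue measure and centers of mass *)

Section LebesgueTuple.
Context {R : realType}.
Local Notation mR := (measurableTypeR R).

Definition box k (c : k.-tuple R) (r : R) : set (k.-tuple mR) :=
  [set t | forall i, `|tnth t i - tnth c i| <= r].

Definition cons_tuple k (p : mR * k.-tuple mR) : k.+1.-tuple mR :=
  [tuple of p.1 :: p.2].

Lemma measurable_cons_tuple k : measurable_fun setT (@cons_tuple k).
Proof. exact: measurable_cons. Qed.

Lemma measurable_box k (c : k.-tuple R) r : measurable (box c r).
Proof.
have -> : box c r = \bigcap_(i in [set: 'I_k])
    ((fun t : k.-tuple mR => tnth t i) @^-1` `[tnth c i - r, tnth c i + r]).
  apply/seteqP; split => t /= tP.
    by move=> i _ /=; rewrite in_itv /= -ler_distl; exact: tP.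
  by move=> i; have := tP i I; rewrite /= in_itv /= -ler_distl.
apply: fin_bigcap_measurable => // i _.
rewrite -[X in measurable X]setTI; exact: measurable_tnth.
Qed.

Lemma cons_tuple_box k (c : k.+1.-tuple R) r :
  @cons_tuple k @^-1` box c r =
  `[tnth c ord0 - r, tnth c ord0 + r]%classic `*` box [tuple of behead c] r.
Proof.
apply/seteqP; split => -[x t] /=.
  move=> h; split => /=.
    by rewrite in_itv /= -ler_distl; have := h ord0; rewrite /cons_tuple tnth0.
  move=> i; have := h (lift ord0 i).
  by rewrite /cons_tuple tnthS [c in tnth c (lift _ _)]tuple_eta tnthS.
move=> [] /=; rewrite in_itv /= -ler_distl => h0 h i.
have [->|[j ->]] : i = ord0 \/ exists j, i = lift ord0 j.
  by case: (unliftP ord0 i) => [j ->|->]; [right; exists j|left].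
  by rewrite /cons_tuple tnth0.
have := h j; rewrite /cons_tuple tnthS [c in tnth c (lift _ _)]tuple_eta.
by rewrite tnthS.
Qed.

Definition box_measure k (mu : set (k.-tuple mR) -> \bar R) :=
  forall c r, 0 <= r -> mu (box c r) = ((r *+ 2) ^+ k)%:E.

Lemma box_measure_sigma_finite k (mu : set (k.-tuple mR) -> \bar R) :
  box_measure mu -> sigma_finite setT mu.
Proof.
move=> bmu; exists (fun n => box [tuple of nseq k 0] n%:R); last first.
  by move=> n; split; [exact: measurable_box|rewrite bmu// ltry].
apply/esym; rewrite -subTset => t _.
exists (Num.truncn (\sum_i `|tnth t i|)).+1 => //= i.
rewrite tnth_nseq subr0; apply: ltW; apply: le_lt_trans (truncnS_gt _).
by rewrite (bigD1 i) //= lerDl sumr_ge0.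
Qed.

(** [lebesgue] is a bare set function defined by recursion. To integrate against it, a measure
    structure is rebuilt in each dimension; the product at the next stage needs sigma-finiteness,
    which the volume formula for boxes supplies. *)
Lemma lebesgue_is_measure k :
  exists2 mu : {sigma_finite_measure set (k.-tuple mR) -> \bar R},
    (mu : set _ -> \bar R) = @lebesgue R k & box_measure mu.
Proof.
elim: k => [|k [mu muE mubox]].
  have bm : box_measure (@dirac _ (0.-tuple mR) [tuple] R).
    move=> c r r0; rewrite diracE expr0 mem_set// => -[].
    by [].
  pose h := @isSigmaFinite.Build _ _ _ (@dirac _ (0.-tuple mR) [tuple] R)
    (box_measure_sigma_finite bm).
  pose nu : {sigma_finite_measure set (0.-tuple mR) -> \bar R} :=
    HB.pack (@dirac _ (0.-tuple mR) [tuple] R) h.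
  by exists nu.
pose pm := product_measure1 (@lebesgue_measure R) mu.
pose pf : {measure set (k.+1.-tuple mR) -> \bar R} :=
  measure_function_pushforward__canonical__measure_function_Measure
    pm (@measurable_cons_tuple k).
have bm : box_measure pf.
  move=> c r r0; rewrite [LHS]/= /pushforward cons_tuple_box.
  rewrite /pm product_measure1E; last exact: measurable_box.
    rewrite [X in (X * _)%E]lebesgue_measure_itv /= lte_fin.
    rewrite mubox// exprS EFinM; congr (_ * _)%E.
    have [->|rn0] := eqVneq r 0; first by rewrite addr0 subr0 ltxx mul0rn.
    have r1 : 0 < r by rewrite lt_neqAle eq_sym rn0.
    rewrite ifT; last by lra.
    by rewrite -EFinB; congr _%:E; ring.
  exact: measurable_itv.
pose h := @Measure_isSigmaFinite.Build _ _ _ pf (box_measure_sigma_finite bm).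
pose nu : {sigma_finite_measure set (k.+1.-tuple mR) -> \bar R} :=
    HB.pack (pf : set (k.+1.-tuple mR) -> \bar R) pf h.
exists nu; last exact: bm.
by rewrite /nu /= /pm /lebesgue -/lebesgue muE.
Qed.

End LebesgueTuple.

(** * Convex hulls are closed *)

Section Closedness.
Context {R : realType}.
Local Notation V := 'rV[R]_3.
Implicit Types (x y z u : V) (S F P : set V).

Lemma lipschitz_continuous_rV n (f : 'rV[R]_n -> R) K :
  (forall w v : 'rV[R]_n, `|f w - f v| <= K * `|w - v|) -> continuous f.
Proof.
move=> h x; apply: (proj2 (@cvgrPdist_le _ _ _ _ (nbhs_filter x) _ _)) => e e0; near=> y.
apply: le_trans (h _ _) _; apply: (@le_trans _ _ ((`|K| + 1) * `|x - y|)).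
  by rewrite ler_wpM2r //; have := ler_norm K; lra.
have K0 : 0 < `|K| + 1 by rewrite ltr_wpDl.
rewrite mulrC -ler_pdivlMr //; apply: ltW; near: y.
apply/nbhs_ballP; exists (e / (`|K| + 1)) => /=; first by rewrite divr_gt0.
by move=> z; rewrite -ball_normE.
Unshelve. all: by end_near. Qed.

Lemma coord_le_norm n (w : 'rV[R]_n) i : `|w 0 i| <= `|w|.
Proof.
have -> : `|w| = mx_norm w by [].
by rewrite mx_normrE; exact: (le_bigmax _ (fun ij : 'I_1 * 'I_n => `|w ij.1 ij.2|) (0, i)).
Qed.

Lemma unit_cube_compact n a b : compact [set w : 'rV[R]_n | forall i, a <= w 0 i <= b].
Proof.
have -> : [set w : 'rV[R]_n | forall i, a <= w 0 i <= b] =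
          [set w : 'rV[R]_n | forall i, `[a, b]%classic (w 0 i)].
  by apply/seteqP; split => w h i; have := h i; rewrite /= in_itv.
exact: (@rV_compact _ _ (fun=> `[a, b]%classic)) (fun=> @segment_compact _ _ _).
Qed.

(** The distance from [z] to the combination with weights [w], plus the penalty [|1 - \sum_i w i|],
    is continuous and attains its minimum on the cube of weights. The minimum is positive as [z] is
    outside, and half of it is a valid radius. *)
Lemma cvx_separated n (q : 'I_n -> V) z : ~ cvx q z ->
  exists2 r, 0 < r & forall y, enorm (y - z) <= r -> ~ cvx q y.
Proof.
move=> Nz; pose f (w : 'rV[R]_n) : V := z - \sum_i w 0 i *: q i.
pose h (w : 'rV[R]_n) := enorm (f w) + `|1 - \sum_i w 0 i|.
have hc : continuous h.
  apply: (@lipschitz_continuous_rV _ _ (\sum_i enorm (q i) + \sum_(i < n) 1)) => w v.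
  have E1 : `|enorm (f w) - enorm (f v)| <= (\sum_i enorm (q i)) * `|w - v|.
    apply: (@le_trans _ _ (enorm (f w - f v))).
      exact: enorm_dist.
    have -> : f w - f v = \sum_i (v 0 i - w 0 i) *: q i.
      under eq_bigr do rewrite scalerBl.
      by rewrite sumrB /f opprD opprK addrACA subrr add0r addrC.
    apply: le_trans (enorm_sum _ _ _) _; rewrite mulr_suml; apply: ler_sum => i _.
    rewrite enormZ mulrC ler_wpM2l ?enorm_ge0 // distrC.
    by have := coord_le_norm (w - v) i; rewrite !mxE.
  have E2 : `| `|1 - \sum_i w 0 i| - `|1 - \sum_i v 0 i| | <= (\sum_(i < n) 1) * `|w - v|.
    apply: le_trans (ler_dist_dist _ _) _.
    rewrite (_ : _ - _ = \sum_i (v 0 i - w 0 i)); last by rewrite sumrB; ring.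
    rewrite mulr_suml.
    apply: le_trans (ler_norm_sum _ _ _) _; apply: ler_sum => i _; rewrite mul1r.
    by have := coord_le_norm (w - v) i; rewrite !mxE distrC.
  rewrite mulrDl; apply: le_trans (lerD E1 E2).
  by rewrite /h opprD addrACA ler_normD.
have cube0 : [set w : 'rV[R]_n | forall i, 0 <= w 0 i <= 1] !=set0.
  by exists 0 => i; rewrite mxE lexx ler01.
have [w w01 wmin] := EVT_min_rV cube0 (@unit_cube_compact n 0 1)
  (continuous_subspaceT hc).
have h0 : 0 < h w.
  rewrite lt0r addr_ge0 ?enorm_ge0 // andbT; apply/eqP => hw.
  have n1 : enorm (f w) = 0.
    by have := enorm_ge0 (f w); have := normr_ge0 (1 - \sum_i w 0 i); move: hw; rewrite /h; lra.
  have n2 : 1 - \sum_i w 0 i = 0.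
    by apply/eqP; rewrite -normr_eq0; move: hw; rewrite /h n1 add0r => ->.
  apply: Nz; exists (fun i => w 0 i); split.
    by move=> i; move: w01; rewrite inE => /(_ i)/andP[].
  split; first by apply/eqP; rewrite eq_sym -subr_eq0 n2.
  by apply/eqP; rewrite -subr_eq0; apply/eqP/dot_eq0; rewrite -sqr_enorm n1 expr0n.
exists (h w / 2); first by rewrite divr_gt0.
move=> y yz [v [v0 [v1 yE]]].
have : h w <= h (\row_i v i).
  apply: wmin; rewrite inE /= => i; rewrite mxE v0 /= -v1 (bigD1 i) //= lerDl.
  exact: sumr_ge0.
have vE : \sum_i (\row_i v i) 0 i = 1 by under eq_bigr do rewrite mxE.
have fE : f (\row_i v i) = z - y.
  by rewrite /f yE; congr (_ - _); apply: eq_bigr => i _; rewrite mxE.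
by rewrite {2}/h fE vE subrr normr0 addr0 enormB; lra.
Qed.

End Closedness.

(** * Integrals over a face *)

Section FaceIntegral.
Context {R : realType}.
Local Notation V := 'rV[R]_3.
Local Notation mR := (measurableTypeR R).
Implicit Types (x y z u : V) (S F P : set V).

(** Gram-Schmidt, one row at a time. It shows that the choice of an orthonormal basis in [frame]
    does not fall back on its default. *)
Lemma orthonormal_rows k (B : 'M[R]_(k, 3)) : row_free B ->
  exists C : 'M[R]_(k, 3), C *m C^T = 1%:M /\ (C :=: B)%MS.
Proof.
elim: k B => [|k IH] B Bf; first by exists B; split => //; apply/matrixP => -[].
pose r : V := @usubmx _ 1 k 3 B; pose B2 := @dsubmx _ 1 k 3 B.
have BE : B = col_mx r B2 by rewrite vsubmxK.
have rB2 : \rank B2 = k.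
  apply/eqP; rewrite eqn_leq rank_leq_row /=.
  have := mxrank_adds_leqif r B2 => -[h _]; move: h.
  rewrite addsmxE -BE (eqP Bf) => h; have := leq_trans h (leq_add (rank_leq_row r) (leqnn _)).
  by rewrite add1n ltnS.
have [|C [CC CB]] := IH B2; first by rewrite /row_free rB2.
(* The component of the new row orthogonal to the rows of [C]; it is nonzero because otherwise [B]
   would have rank at most k. *)
pose r' : V := r - r *m C^T *m C.
have r'C : r' *m C^T = 0.
  by rewrite mulmxBl -!mulmxA CC mulmx1 subrr.
have r'0 : r' != 0.
  apply/eqP => h; have rB : (r <= B2)%MS.
    by rewrite -CB; move/eqP: h; rewrite subr_eq0 => /eqP ->; exact: submxMl.
  have : \rank (r + B2)%MS = k by rewrite (addsmx_idPr rB).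
  rewrite addsmxE -BE (eqP Bf) => /eqP.
  by rewrite -[X in X == _]addn1 -[X in _ == X]addn0 eqn_add2l.
have e0 := enorm_gt0 r'0; pose s := (enorm r')^-1 *: r'.
have sC : s *m C^T = 0 by rewrite -scalemxAl r'C scaler0.
have ss : s *m s^T = 1%:M.
  rewrite [LHS]mx11_scalar -[(s *m s^T) 0 0]/(dot s s) /s dotZl dotZr -sqr_enorm.
  by rewrite expr2 mulKf ?mulVf // lt0r_neq0.
have orth : col_mx s C *m (col_mx s C)^T = 1%:M.
  rewrite tr_col_mx mul_col_row CC ss sC.
  by rewrite -[C *m s^T]trmxK trmx_mul trmxK sC trmx0 -scalar_mx_block.
have eqm : (col_mx s C :=: col_mx r B2)%MS.
  apply/eqmxP; apply/andP; split; rewrite col_mx_sub; apply/andP; split.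
  - rewrite /s scalemx_sub // addmx_sub //; first by rewrite -addsmxE addsmxSl.
    rewrite -mulNmx (submx_trans (submxMl _ _)) // CB.
    by rewrite -addsmxE addsmxSr.
  - by rewrite CB -addsmxE addsmxSr.
  - have -> : r = enorm r' *: s + r *m C^T *m C.
      by rewrite /s scalerA divff ?lt0r_neq0 // scale1r /r' subrK.
    apply: addmx_sub; first by apply: scalemx_sub; rewrite -addsmxE addsmxSl.
    by apply: submx_trans (submxMl _ _) _; rewrite -addsmxE addsmxSr.
  - by rewrite -CB -addsmxE addsmxSr.
by exists (col_mx s C); split => //; move: eqm; rewrite -BE.
Qed.

Lemma frame_spec k F : has_dim F k ->
  (frame k F).2 *m (frame k F).2^T = 1%:M /\
  aff_hull F = flat (frame k F).1 (frame k F).2.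
Proof.
move=> [pt [B [/orthonormal_rows[C [CC CB]] FE]]].
apply: (@xgetPex _ (0, 0) [set oA : V * 'M[R]_(k, 3) | oA.2 *m oA.2^T = 1%:M /\
  aff_hull F = flat oA.1 oA.2]).
exists (pt, C); split => //=; rewrite FE; apply/seteqP; split => _ [t _ <-].
  have /submxP[D ->] : (t *m B <= C)%MS by rewrite CB submxMl.
  by exists D.
have /submxP[D ->] : (t *m C <= B)%MS by rewrite -CB submxMl.
by exists D.
Qed.

Lemma rat_near (r e : R) : 0 < e -> exists q : rat, `|r - ratr q| <= e.
Proof.
move=> e0; have [|q] := @rat_in_itvoo R (r - e) (r + e); first by lra.
by rewrite in_itv /= => /andP[q1 q2]; exists q; rewrite ler_distl; lra.
Qed.

(** The complement is open, hence a union of boxes with rational centers and radii 1/(n + 1), of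
    which there are countably many. *)
Lemma measurable_separated k (G : set (k.-tuple mR)) :
  (forall t, ~ G t -> exists2 r, 0 < r & forall s, box t r s -> ~ G s) ->
  measurable G.
Proof.
move=> h; rewrite -[G]setCK; apply: measurableC.
pose U := (k.-tuple rat * nat)%type.
pose B (c : U) : set (k.-tuple mR) := box [tuple of map ratr c.1] c.2.+1%:R^-1.
pose H (c : U) := if `[< B c `<=` ~` G >] then B c else set0.
have -> : ~` G = \bigcup_c H c.
  apply/seteqP; split => [t /h[r r0 tr]|t [c _]]; last first.
    by rewrite /H; case: asboolP => // + tB; apply.
  (* With 2/(n + 1) < r, a box of radius 1/(n + 1) that contains [t] lies within [box t r]. *)
  pose n := Num.truncn (2 / r); have nr : 2 / n.+1%:R < r.
    rewrite ltr_pdivrMr ?ltr0n // mulrC -ltr_pdivrMr //; exact: truncnS_gt.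
  have n0 : 0 < n.+1%:R^-1 :> R by rewrite invr_gt0 ltr0n.
  have /choice[q hq] (i : 'I_k) : exists q : rat, `|tnth t i - ratr q| <= n.+1%:R^-1.
    exact: rat_near.
  pose c : U := ([tuple q i | i < k], n).
  have tB : B c t by move=> i; rewrite tnth_map tnth_mktuple; exact: hq.
  exists c => //; rewrite /H; case: asboolP => // N; exfalso; apply: N => s sB.
  have near2 (b1 b2 b3 e : R) : `|b1 - b3| <= e -> `|b2 - b3| <= e -> 2 * e < r ->
      `|b1 - b2| <= r.
    by have := ler_distD b3 b1 b2; rewrite (distrC b3 b2); lra.
  by apply: tr => i; exact: near2 (sB i) (tB i) nr.
apply: countable_bigcupT_measurable; first exact: countableP.
by move=> c; rewrite /H; case: ifP => _ //; exact: measurable_box.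
Qed.

Section Frame.
Variables (k : nat) (F : set V).
Hypothesis dF : has_dim F k.
Let fm : k.-tuple mR -> V := frame_map F.

Lemma frame_map_aff t : aff_hull F (fm t).
Proof. by rewrite (frame_spec dF).2; exists (\row_i tnth t i). Qed.

Lemma frame_map_surj x : aff_hull F x -> exists t, fm t = x.
Proof.
rewrite (frame_spec dF).2 => -[t _ <-]; exists [tuple t 0 i | i < k].
rewrite /fm /frame_map; congr (_ + _ *m _).
by apply/rowP => i; rewrite mxE tnth_mktuple.
Qed.

Lemma frame_row_norm i : enorm (row i (frame k F).2) = 1.
Proof.
have /matrixP/(_ i i) := (frame_spec dF).1; rewrite [RHS]mxE eqxx /= => h.
apply/S2E; rewrite -[RHS]h /dot !mxE; apply: eq_bigr => j _; by rewrite !mxE.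
Qed.

Lemma frame_mapB t s :
  fm t - fm s = (\row_i (tnth t i - tnth s i)) *m (frame k F).2.
Proof.
rewrite /fm /frame_map opprD addrACA subrr add0r -mulmxBl; congr (_ *m _).
by apply/rowP => i; rewrite !mxE.
Qed.

Lemma frame_map_coord t s i : `|tnth t i - tnth s i| <= enorm (fm t - fm s).
Proof.
have -> : tnth t i - tnth s i = dot (fm t - fm s) (row i (frame k F).2).
  rewrite frame_mapB /dot tr_row colE !mulmxA -(mulmxA _ _ (frame k F).2^T).
  by rewrite (frame_spec dF).1 mulmx1 -colE !mxE.
by apply: le_trans (dot_le _ _) _; rewrite frame_row_norm mulr1.
Qed.

Lemma frame_map_le t s r : (forall i, `|tnth t i - tnth s i| <= r) ->
  enorm (fm t - fm s) <= k%:R * r.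
Proof.
move=> h; rewrite frame_mapB mulmx_sum_row.
apply: le_trans (enorm_sum _ _ _) _.
have -> : k%:R * r = \sum_(i < k) r by rewrite sumr_const card_ord mulr_natl.
by apply: ler_sum => i _; rewrite enormZ frame_row_norm mulr1 mxE.
Qed.

End Frame.

Section Bounds.
Variables (k n : nat) (q : 'I_n -> V).
Local Notation F := (cvx q).
Hypothesis dF : has_dim F k.
Let fm : k.-tuple mR -> V := frame_map F.
Let G := fm @^-1` F.

Lemma measurable_frame_preimage : measurable G.
Proof.
apply: measurable_separated => t /cvx_separated[r r0 h].
(* [frame_map] stretches coordinatewise distances by at most k; dividing by k + 1 also covers k =
   0. *)
exists (r / k.+1%:R); first by rewrite divr_gt0 // ltr0n.
move=> s st; apply: h; apply: le_trans (frame_map_le dF st) _.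
rewrite mulrCA ger_pMr // ler_pdivrMr ?ltr0n // mul1r ler_nat; exact: leqnSn.
Qed.

Lemma cvx_bounded : exists2 M, 0 <= M & forall x, F x -> enorm x <= M.
Proof.
exists (\sum_i enorm (q i)); first by apply: sumr_ge0 => i _; exact: enorm_ge0.
move=> x Fx; rewrite -[x]subr0; apply: (@cvx_ball _ _ q 0 _ _ _ Fx) => i.
rewrite /eball /= subr0.
by rewrite (bigD1 i) //= lerDl sumr_ge0 // => j _; exact: enorm_ge0.
Qed.

Lemma frame_preimage_box M : (forall x, F x -> enorm x <= M) ->
  exists c, G `<=` box c (2 * M).
Proof.
move=> h; have [[c Gc]|N] := pselect (G !=set0); last first.
  by exists [tuple of nseq k 0] => t Gt; exfalso; apply: N; exists t.
exists c => t Gt i; apply: le_trans (frame_map_coord dF _ _ _) _.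
by apply: le_trans (enormD _ _) _; rewrite enormN; have := h _ Gt; have := h _ Gc; rewrite /fm; lra.
Qed.

Lemma measurable_frame_dot u : measurable_fun setT (fun t => dot u (fm t)).
Proof.
have -> : (fun t => dot u (fm t)) = (fun t : k.-tuple mR =>
    dot u (frame k F).1 + \sum_i tnth t i * dot u (row i (frame k F).2)).
  apply/funext => t; rewrite /fm /frame_map dotDr; congr (_ + _).
  rewrite mulmx_sum_row dot_sumr; apply: eq_bigr => i _.
  by rewrite dotZr mxE.
apply: measurable_realfun.measurable_funD => //; apply: measurable_sum => i.
by apply: measurable_realfun.measurable_funM => //; exact: measurable_tnth.
Qed.

Variable mu : {sigma_finite_measure set (k.-tuple mR) -> \bar R}.
Hypothesis muE : (mu : set _ -> \bar R) = @lebesgue R k.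
Hypothesis muB : box_measure mu.

Lemma frame_preimage_finite : (mu G < +oo)%E.
Proof.
have [M M0 hM] := cvx_bounded; have [c Gc] := frame_preimage_box hM.
apply: (@le_lt_trans _ _ (mu (box c (2 * M)))).
  apply: le_measure => //; rewrite inE; first exact: measurable_frame_preimage.
  exact: measurable_box.
by rewrite muB ?mulr_ge0 // ltry.
Qed.

Lemma integrable_frame (f : V -> R) : measurable_fun setT (f \o fm) ->
  (exists M, forall x, F x -> `|f x| <= M) -> mu.-integrable G (EFin \o (f \o fm)).
Proof.
move=> mf [M hM]; apply: measurable_bounded_integrable.
- exact: measurable_frame_preimage.
- exact: frame_preimage_finite.
- exact: measurable_funS mf.
- exists M; split; rewrite ?num_real // => M' MM' t Gt.
  by apply: le_trans (ltW MM'); exact: hM.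
Qed.

Lemma face_integralE f : face_integral k F f = \int[mu]_(t in G) f (fm t).
Proof. by rewrite /face_integral -muE. Qed.

Lemma integrable_dot u c :
  mu.-integrable G (EFin \o ((fun x => dot u x - c) \o fm)).
Proof.
apply: integrable_frame.
  by apply: measurable_realfun.measurable_funB => //; exact: measurable_frame_dot.
have [M M0 hM] := cvx_bounded; exists (enorm u * M + `|c|) => x /hM xM.
apply: le_trans (ler_normB _ _) _; rewrite lerD2r.
by apply: le_trans (dot_le _ _) _; rewrite ler_wpM2l ?enorm_ge0.
Qed.

(** [cm] is defined coordinate by coordinate; this relates it to integrals of a single affine
    function, which can be bounded by signs. *)
Lemma face_integral_affine u c :
  face_integral k F (fun x => dot u x - c) =
  \sum_i u 0 i * face_integral k F (fun x => x 0 i) - c * face_integral k F (fun=> 1).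
Proof.
have mG := measurable_frame_preimage.
have ei i : (fun x : V => x 0 i) = (fun x => dot (delta_mx 0 i) x - 0).
  apply/funext => x; rewrite subr0 dotE (bigD1 i) //= mxE !eqxx mul1r big1 ?addr0 //.
  by move=> j ji; rewrite mxE (negbTE ji) mul0r.
have ii i : mu.-integrable G (EFin \o ((fun x : V => x 0 i) \o fm)).
  by rewrite ei; exact: integrable_dot.
have int1 : mu.-integrable G (EFin \o ((fun=> 1 : R) \o fm)).
  by apply: integrable_frame; [exact: measurable_cst|exists 1 => x _; rewrite normr1].
rewrite !face_integralE sum3.
have -> : (fun t => dot u (fm t) - c) = (fun t =>
    (u 0 i0 * fm t 0 i0 + u 0 i1 * fm t 0 i1 + u 0 i2 * fm t 0 i2) - c * 1).
  by apply/funext => t; rewrite dot3 mulr1.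
have iz i : mu.-integrable G (EFin \o (fun t => u 0 i * fm t 0 i)).
  by have := integrableZl mG (u 0 i) (ii i).
rewrite RintegralB //; last 2 first.
- have := integrableD mG (integrableD mG (iz i0) (iz i1)) (iz i2); exact.
- exact: (integrableZl mG c int1).
rewrite RintegralD //; last first.
  by have := integrableD mG (iz i0) (iz i1); exact.
rewrite RintegralD // !RintegralZl //; try exact: ii.
by rewrite !(face_integralE (fun x : V => x 0 i0), face_integralE (fun x : V => x 0 i1),
  face_integralE (fun x : V => x 0 i2)).
Qed.

(** The integrand is at least [H] on [B2], and at least [- M1] on a set [B1] that contains all
    points where it is not positive. Such points have norm at most [M2], so any two are within
    [2 * M2] and a box of side [4 * M2] serves as [B1]. *)
Lemma face_integral_ge u c M1 M2 H (B2 : set (k.-tuple mR)) : 0 <= M1 -> 0 <= M2 ->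
  (forall x, F x -> - M1 <= dot u x - c) ->
  (forall x, F x -> dot u x <= c -> enorm x <= M2) ->
  measurable B2 -> (forall t, B2 t -> G t /\ H <= dot u (fm t) - c) -> 0 <= H ->
  H * fine (mu B2) - M1 * (4 * M2) ^+ k <= face_integral k F (fun x => dot u x - c).
Proof.
move=> M10 M20 h1 h2 mB2 hB2 H0; have mG := measurable_frame_preimage.
have [B1 [mB1 B1le B1h]] : exists B1 : set (k.-tuple mR), [/\ measurable B1,
    fine (mu B1) <= (4 * M2) ^+ k /\ (mu B1 < +oo)%E &
    forall t, G t -> dot u (fm t) <= c -> B1 t].
  have [[t0 [G0 le0]]|N] := pselect (exists t, G t /\ dot u (fm t) <= c).
    exists (box t0 (2 * M2)); split; first exact: measurable_box.
      rewrite muB ?mulr_ge0 //= ltry; split => //.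
      by rewrite (_ : 2 * M2 *+ 2 = 4 * M2) //; ring.
    move=> t Gt le i; apply: le_trans (frame_map_coord dF _ _ _) _.
    apply: le_trans (enormD _ _) _; rewrite enormN.
    by have := h2 _ Gt le; have := h2 _ G0 le0; rewrite /fm; lra.
  exists set0; split => //.
    by rewrite measure0 /= exprn_ge0 ?mulr_ge0.
  by move=> t Gt le; exfalso; apply: N; exists t.
have iind B : measurable B -> mu.-integrable G (EFin \o \1_B).
  move=> mB; apply: measurable_bounded_integrable => //.
  - exact: frame_preimage_finite.
  - exists 1; split; rewrite ?num_real // => M' MM' t Gt /=.
    by apply: le_trans (ltW MM'); rewrite indicE ger0_norm // lern1; case: (_ \in _).
have iz B r : measurable B -> mu.-integrable G (EFin \o (fun t => r * \1_B t)).
  by move=> mB; exact: (integrableZl mG r (iind B mB)).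
have Rind B : measurable B -> \int[mu]_(t in G) \1_B t = fine (mu (B `&` G)).
  by move=> mB; rewrite /Rintegral integral_indic.
rewrite face_integralE.
apply: (@le_trans _ _ (\int[mu]_(t in G) (H * \1_B2 t - M1 * \1_B1 t))).
  rewrite RintegralB ?RintegralZl ?Rind //; try exact: iz; try exact: iind.
  rewrite lerB //.
    by rewrite setIidl // => t /hB2[].
  rewrite ler_wpM2l //; apply: le_trans B1le.1; apply: fine_le.
  - rewrite ge0_fin_numE //; apply: le_lt_trans B1le.2.
    by apply: le_measure => //; rewrite inE //; exact: measurableI.
  - by rewrite ge0_fin_numE //; exact: B1le.2.
  - by apply: le_measure => //; rewrite inE //; exact: measurableI.
apply: le_Rintegral => //.
- by have := integrableB mG (iz _ H mB2) (iz _ M1 mB1); exact.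
- exact: integrable_dot.
move=> t Gt; rewrite !indicE.
have := h1 _ Gt; case: (boolP (t \in B2)) => [/set_mem/hB2[_ hH]|_] m1 /=.
  by rewrite mulr1; have : 0 <= M1 * (t \in B1)%:R by [rewrite mulr_ge0]; lra.
rewrite mulr0 sub0r; case: (boolP (t \in B1)) => [_|tB1] /=; first by rewrite mulr1.
rewrite mulr0 oppr0 subr_ge0; apply: ltW; rewrite ltNge; apply: contra tB1 => le.
by rewrite inE; exact: B1h.
Qed.

End Bounds.

Lemma face_integral_ge_weak k n (q : 'I_n -> V) u c M1 M2 : has_dim (cvx q) k ->
  0 <= M1 -> 0 <= M2 ->
  (forall x, cvx q x -> - M1 <= dot u x - c) ->
  (forall x, cvx q x -> dot u x <= c -> enorm x <= M2) ->
  - M1 * (4 * M2) ^+ k <= face_integral k (cvx q) (fun x => dot u x - c).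
Proof.
move=> dF M10 M20 h1 h2; have [mu muE muB] := @lebesgue_is_measure R k.
have := @face_integral_ge k n q dF mu muE muB u c M1 M2 0 set0 M10 M20 h1 h2.
by rewrite measure0 mul0r sub0r mulNr; apply.
Qed.

Lemma face_integral_ge_ball k n (q : 'I_n -> V) u c M1 M2 H y s : has_dim (cvx q) k ->
  0 <= M1 -> 0 <= M2 -> 0 <= H -> 0 <= s ->
  (forall x, cvx q x -> - M1 <= dot u x - c) ->
  (forall x, cvx q x -> dot u x <= c -> enorm x <= M2) ->
  aff_hull (cvx q) y ->
  (forall z, aff_hull (cvx q) z -> enorm (z - y) <= s -> cvx q z /\ H <= dot u z - c) ->
  H * (s / k.+1%:R *+ 2) ^+ k - M1 * (4 * M2) ^+ k
    <= face_integral k (cvx q) (fun x => dot u x - c).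
Proof.
move=> dF M10 M20 H0 s0 h1 h2 yF hy; have [mu muE muB] := @lebesgue_is_measure R k.
have [c0 c0y] := frame_map_surj dF yF.
have r0 : 0 <= s / k.+1%:R by rewrite divr_ge0.
have := @face_integral_ge k n q dF mu muE muB u c M1 M2 H (box c0 (s / k.+1%:R)) M10 M20 h1 h2.
rewrite muB //=; apply => //; first exact: measurable_box.
move=> t tb; apply: hy; first exact: frame_map_aff.
rewrite -c0y; apply: le_trans (frame_map_le dF tb) _.
by rewrite mulrCA ler_piMr // ler_pdivrMr ?ltr0n // mul1r ler_nat; exact: leqnSn.
Qed.

Lemma face_volume_ge0 k F : 0 <= face_integral k F (fun=> 1).
Proof.
have [mu muE muB] := @lebesgue_is_measure R k.
by rewrite /face_integral -muE fine_ge0 //; apply: integral_ge0.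
Qed.

End FaceIntegral.

(** * Centers of mass *)

Section CenterOfMass.
Context {R : realType}.
Local Notation V := 'rV[R]_3.
Implicit Types (x y z u : V) (S F P : set V).

(** A face is determined by the set of generators that lie on it. *)
Lemma finite_faces k n (p : 'I_n -> V) : finite_set (faces k (cvx p)).
Proof.
apply: (@sub_finite_set _ _
  ((fun I : {set 'I_n} => conv_hull [set p i | i in [set i | i \in I]]) @` setT)); last first.
  exact/finite_image/finite_finset.
move=> F [/face_cvx[q [FE Fq qp pq]] _]; exists [set i | `[< F (p i) >]]%SET => //.
rewrite [RHS]FE -conv_hull_range; congr conv_hull; apply/seteqP; split.
  by move=> _ [i + <-]; rewrite /= inE => /asboolP/pq <-; exists i.
move=> _ [i _ <-]; have [j qj] := qp i; exists j => //=.
by rewrite inE; apply/asboolP; rewrite -qj.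
Qed.

Lemma face_volume_gt0 k n (q : 'I_n -> V) : has_dim (cvx q) k ->
  0 < face_integral k (cvx q) (fun=> 1).
Proof.
move=> dF; have [x0 [r [r0 Fx0 h]]] := cvx_rel_ball dF.
(* With [u = 0] and [c = -1] the integrand is the constant 1, so the estimate bounds the volume from
   below by that of a box inside the relative ball. *)
have := @face_integral_ge_ball R k n q 0 (-1) 0 0 1 x0 r dF (lexx 0) (lexx 0) ler01 (ltW r0).
have -> : (fun x : V => dot 0 x - -1) = (fun=> 1) by apply/funext => x; rewrite dot0l; ring.
rewrite mul0r subr0 mul1r => H; apply: lt_le_trans (H _ _ _ _).
- by rewrite exprn_gt0 // mulrn_wgt0 // divr_gt0 // ltr0n.
- by move=> x _; rewrite dot0l; lra.
- by move=> x _; rewrite dot0l; lra.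
- exact: sub_aff_hull.
- by move=> z zF zr; split; [exact: h|rewrite dot0l; lra].
Qed.

(** One face has an integral large enough to outweigh the worst negative contribution of all others.
    The faces are parametrized by a set [D], meant to be the faces of the original polyhedron, so
    that their number does not vary with the inversion. *)
Lemma cm_gt k n (p : 'I_n -> V) (D : set (set V)) (h : set V -> set V) u c M1 M2 H y s G0 :
  finite_set D -> faces k (cvx p) = h @` D -> set_inj D h ->
  0 <= M1 -> 0 <= M2 -> 0 <= H -> 0 <= s ->
  (forall x, cvx p x -> - M1 <= dot u x - c) ->
  (forall x, cvx p x -> dot u x <= c -> enorm x <= M2) ->
  D G0 -> aff_hull (h G0) y ->
  (forall z, aff_hull (h G0) z -> enorm (z - y) <= s -> h G0 z /\ H <= dot u z - c) ->
  (size (finmap.enum_fset (fset_set D)))%:R * (M1 * (4 * M2) ^+ k) <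
    H * (s / k.+1%:R *+ 2) ^+ k ->
  c < dot u (cm k (cvx p)).
Proof.
move=> fD fE hinj M10 M20 H0 s0 h1 h2 DG0 yG hy big.
set r := finmap.enum_fset (fset_set D).
have rD F : F \in r -> D F by move=> Fr; have : F \in fset_set D by []; rewrite in_fset_set // inE.
have skE f : skel_integral k (cvx p) f = \sum_(F <- r) face_integral k (h F) f.
  by rewrite /skel_integral fE fsbig_image // fsbig_finite.
have face F : F \in r -> exists q : 'I_n -> V,
    [/\ h F = cvx q, has_dim (cvx q) k & cvx q `<=` cvx p].
  move=> /rD DF; have [fF dF] : faces k (cvx p) (h F) by rewrite fE; exists F.
  have [q [FE _ _ _]] := face_cvx fF; exists q; rewrite -FE; split => //.
  by case: fF => _ [u' [c' [_ ->]]]; exact: subIsetl.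
have G0r : G0 \in r by have : G0 \in fset_set D by rewrite in_fset_set // inE.
pose W := skel_integral k (cvx p) (fun=> 1).
have W0 : 0 < W.
  rewrite /W skE (big_rem G0) //=; have [q [-> dq _]] := face _ G0r.
  apply: ltr_pwDl; first exact: face_volume_gt0.
  by apply: sumr_ge0 => F _; exact: face_volume_ge0.
have E : dot u (cm k (cvx p)) - c =
    W^-1 * \sum_(F <- r) face_integral k (h F) (fun x => dot u x - c).
  rewrite /cm -/W dotZr -[c in LHS](mulKf (lt0r_neq0 W0)) -mulrBr; congr (_ * _).
  have -> : dot u (\row_i skel_integral k (cvx p) (fun x => x 0 i)) =
      \sum_i u 0 i * skel_integral k (cvx p) (fun x => x 0 i).
    by rewrite dotE; apply: eq_bigr => i _; rewrite mxE.
  rewrite mulrC /W skE mulr_sumr.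
  under eq_bigr => i _ do rewrite skE mulr_sumr.
  rewrite exchange_big /= -sumrB; apply: eq_big_seq => F Fr.
  have [q [-> dq _]] := face _ Fr.
  have [mu muE muB] := @lebesgue_is_measure R k.
  by rewrite (face_integral_affine dq muE muB).
rewrite -subr_gt0 E pmulr_rgt0 ?invr_gt0 // (big_rem G0) //=.
have [q [GE dq sq]] := face _ G0r; rewrite GE in yG hy *.
have g0 := @face_integral_ge_ball R k n q u c M1 M2 H y s dq M10 M20 H0 s0
  (fun x qx => h1 x (sq _ qx)) (fun x qx => h2 x (sq _ qx)) yG hy.
have rest : - ((size (rem G0 r))%:R * (M1 * (4 * M2) ^+ k)) <=
    \sum_(F <- rem G0 r) face_integral k (h F) (fun x => dot u x - c).
  have -> : - ((size (rem G0 r))%:R * (M1 * (4 * M2) ^+ k)) =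
      \sum_(F <- rem G0 r) - M1 * (4 * M2) ^+ k.
    by rewrite big_const_seq count_predT iter_addr_0 mulNr mulNrn mulr_natl.
  rewrite !big_seq; apply: ler_sum => F /mem_rem Fr.
  have [q' [-> dq' sq']] := face _ Fr.
  by apply: face_integral_ge_weak => // x /sq'; [exact: h1|exact: h2].
move: big; have sr : (size r)%:R = (size (rem G0 r))%:R + 1 :> R.
  rewrite size_rem // -[X in X%:R = _]prednK; first by rewrite -natr1.
  by case: (r) G0r.
rewrite sr mulrDl mul1r; move: g0 rest; lra.
Qed.

End CenterOfMass.

(** * The smallest enclosing ball *)

Section Circumcenter.
Context {R : realType}.
Local Notation V := 'rV[R]_3.
Implicit Types (x y z u c : V) (S F P : set V).

(** The radius [f c] needed at center [c] is the largest distance to a generator. It is a Lipschitz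
    function of [c], so it has a minimum on a compact cube. *)
Lemma smallest_ball n (p : 'I_n -> V) (j : 'I_n) : exists c r,
  cvx p `<=` eball c r /\ forall c' r', cvx p `<=` eball c' r' -> r <= r'.
Proof.
have rad c : exists2 r, (forall i, enorm (p i - c) <= r) & exists i, r = enorm (p i - c).
  have [i _ im] := @max_ex R n predT (fun i => enorm (p i - c)) j isT.
  by exists (enorm (p i - c)); [move=> k; exact: im|exists i].
have /choice[f hf] c : exists r, (forall i, enorm (p i - c) <= r) /\ exists i, r = enorm (p i - c).
  by have [r] := rad c; exists r.
have sub c : cvx p `<=` eball c (f c) by apply: cvx_ball => i; exact: (hf c).1.
have fmin c r : cvx p `<=` eball c r -> f c <= r.
  move=> h; have [i ->] := (hf c).2; exact: h (cvx_vertex _ _).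
have lip c d : f c - f d <= enorm (c - d).
  have [i ->] := (hf c).2; have := (hf d).1 i.
  have := enormD (p i - d) (d - c); rewrite addrA subrK (enormB d); lra.
have fc : continuous f.
  apply: (@lipschitz_continuous_rV _ _ _ 3%:R) => c d.
  apply: le_trans (enorm_le_norm _).
  by have := lip c d; have := lip d c; rewrite (enormB d) ler_norml; lra.
(* A center [c] that beats [p j] is at distance at most [f c < f (p j)] from [p j], so it lies in
   the cube [K]. *)
pose M := 2 * f (p j).
have M0 : 0 <= M by rewrite mulr_ge0 //; have [i ->] := (hf (p j)).2; exact: enorm_ge0.
pose K := [set c : V | forall i, - (M + enorm (p j)) <= c 0 i <= M + enorm (p j)].
have K0 : K (p j).
  by move=> i; rewrite -ler_norml; have := coord_le_enorm (p j) i; move: M0; lra.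
have [c cK cmin] := EVT_min_rV (ex_intro _ _ K0) (@unit_cube_compact R _ _ _) (continuous_subspaceT fc).
exists c, (f c); split; first exact: sub.
move=> c' r' /fmin; apply: le_trans.
have [c'K|N] := pselect (K c'); first by apply: cmin; rewrite inE.
apply: (@le_trans _ _ (f (p j))); first by apply: cmin; rewrite inE.
rewrite leNgt; apply/negP => lt; apply: N => i; rewrite -ler_norml.
apply: le_trans (coord_le_enorm _ _) _.
have := (hf c').1 j; have := enormD (c' - p j) (p j); rewrite subrK (enormB c').
rewrite /M; have : 0 <= f c' by have [l ->] := (hf c').2; exact: enorm_ge0.
lra.
Qed.

(* The ball with centre half way to the far vertex shows that the smallest
   enclosing ball cannot be centred near the origin. *)
Lemma cc_far n (p : 'I_n -> V) (j : 'I_n) M : 2 * M + 2 < enorm (p j) ->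
  (forall i, p i != p j -> enorm (p i) <= M) -> 0 <= M -> ~ B3 (cc (cvx p)).
Proof.
move=> far near M0; have [c [r [sub rmin]]] := smallest_ball p j.
have [r' [sub' rmin']] : exists r, cvx p `<=` eball (cc (cvx p)) r /\
    forall c' r', cvx p `<=` eball c' r' -> r <= r'.
  apply: (@xgetPex _ 0 [set c | exists r, cvx p `<=` eball c r /\
                  forall c' r', cvx p `<=` eball c' r' -> r <= r']).
  by exists c, r.
rewrite /B3 /eball /= subr0 => c1.
have h1 : enorm (p j) - 1 <= r'.
  have := sub' _ (cvx_vertex p j); rewrite /eball /= => h.
  by have := enormD (p j - cc (cvx p)) (cc (cvx p)); rewrite subrK; lra.
have h2 : r' <= enorm (p j) / 2 + M.
  apply: (rmin' (2^-1 *: p j)); apply: cvx_ball => i; rewrite /eball /=.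
  have [->|ij] := eqVneq (p i) (p j).
    rewrite -[X in X - _]scale1r -scalerBl enormZ ger0_norm; last by lra.
    by move: M0; lra.
  apply: le_trans (enormD _ _) _; rewrite enormN enormZ ger0_norm; last by lra.
  by have := near _ ij; lra.
lra.
Qed.

End Circumcenter.

(** * Degenerating families of inversions *)

Lemma double_midpoint {R : realType} (x y z : 'rV[R]_3) :
  x + 2 *: (z - x) - y = 2 *: (z - 2^-1 *: (x + y)).
Proof. by apply/rowP => i; rewrite !mxE; field. Qed.

Section Degeneration.
Context {R : realType}.
Local Notation V := 'rV[R]_3.
Implicit Types (x y z u d a : V) (S F P G : set V).
Variables (n : nat) (p : 'I_n -> V) (v : V).
Hypothesis vp : exists i, p i = v.
Hypothesis vmax : forall i, p i != v -> dot v (p i) < dot v v.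
Local Notation L := (dot v v).
Hypothesis v1 : 1 < L.
Local Notation P := (cvx p).

Lemma enorm_v1 : 1 < enorm v.
Proof.
by rewrite -(@ltr_pXn2r _ 2) ?nnegrE ?enorm_ge0 // sqr_enorm expr1n.
Qed.

(* The centre of the inversion lies on the ray of [v], and [eps] measures how
   far [v] is from the plane that the projective extension sends to infinity. *)
Lemma centre_exists eps : 0 < eps < 1 -> exists al, [/\ 1 < al, al < 2 &
  1 + al ^+ 2 * L - 2 * al * L = eps].
Proof.
have L1 := v1.
(* With [al = 1 + s] the quadratic becomes [1 - L + s ^+ 2 * L], and solving for [eps] gives this
   [s]. *)
move=> /andP[e0 e1]; pose s := Num.sqrt (1 - (1 - eps) / L).
have L0 : 0 < L by lra.
have q0 : 0 < (1 - eps) / L by rewrite divr_gt0 // subr_gt0.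
have q1 : (1 - eps) / L < 1 by rewrite ltr_pdivrMr // mul1r; lra.
have s2 : s ^+ 2 = 1 - (1 - eps) / L by rewrite sqr_sqrtr //; lra.
have s0 : 0 < s by rewrite sqrtr_gt0; lra.
have s1 : s < 1.
  by rewrite -(@ltr_pXn2r _ 2) ?nnegrE ?ltW // s2 expr1n; lra.
exists (1 + s); split; [lra|lra|].
have -> : 1 + (1 + s) ^+ 2 * L - 2 * (1 + s) * L = 1 - L + s ^+ 2 * L by ring.
by rewrite s2 mulrBl divfK ?lt0r_neq0 //; ring.
Qed.

(** What the limit arguments use of one inversion. Only [kap] blows up as [eps] tends to 0; the
    bounds on [a] and the bound [M] on the other generators are common to all [eps]. *)
Definition escaping M eps a :=
  [/\ [/\ 1 < dot a a, L <= dot a a, enorm a <= 2 * enorm v & idenom a v = eps],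
      Dpos a P,
      exists2 kap, 2 * (L - 1) / eps <= kap & iproj a v = - kap *: v &
      forall i, p i != v -> enorm (iproj a (p i)) <= M].

(** On the ray of [v] the denominator at [x] is [eps + 2 * al * (L - dot v x)]. At the generators
    other than [v] it is at least twice the gap [g], while the numerators are bounded because |a| <=
    2 |v|; [M] is the quotient of these bounds. *)
Lemma escaping_exists : exists2 M, 0 <= M &
  forall eps, 0 < eps < 1 -> exists a, escaping M eps a.
Proof.
have L1 := v1.
have [g g0 gle] : exists2 g, 0 < g & forall i, p i != v -> g <= L - dot v (p i).
  have [[j pj]|N] := pselect (exists j, p j != v); last first.
    by exists 1 => // i pi; exfalso; apply: N; exists i.
  have [k pk kmax] := @max_ex _ _ (fun i => p i != v) (fun i => - (L - dot v (p i))) _ pj.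
  exists (L - dot v (p k)); first by rewrite subr_gt0 vmax.
  by move=> i pi; have := kmax _ pi; rewrite lerN2.
pose E := \sum_i enorm (p i).
have E0 : 0 <= E by apply: sumr_ge0 => i _; exact: enorm_ge0.
have pE i : enorm (p i) <= E.
  by rewrite /E (bigD1 i) //= lerDl; apply: sumr_ge0 => j _; exact: enorm_ge0.
have nv := enorm_v1.
pose M := (2 * g)^-1 * (4 * L * E + (2 + 2 * (2 * enorm v * E)) * (2 * enorm v)).
have M0 : 0 <= M.
  rewrite /M mulr_ge0 ?invr_ge0 ?addr_ge0 ?mulr_ge0 ?addr_ge0 ?mulr_ge0 //; lra.
exists M => // eps e01; have [e0 _] := andP e01.
have [al [al1 al2 alE]] := centre_exists e01.
pose a := al *: v.
have aa : dot a a = al ^+ 2 * L by rewrite /a dotZl dotZr; ring.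
have al21 : 1 < al ^+ 2 by rewrite expr_gt1 //; lra.
have al24 : al ^+ 2 <= 4.
  by have : al * al <= 2 * 2 by [apply: ler_pM; lra]; rewrite expr2; lra.
have La : L <= dot a a by rewrite aa ler_peMl //; lra.
have a1 : 1 < dot a a by lra.
have na : enorm a <= 2 * enorm v.
  by rewrite /a enormZ ger0_norm; [rewrite ler_pM2r; lra|lra].
have DE x : idenom a x = eps + 2 * al * (L - dot v x).
  by rewrite /idenom aa /a dotZl -alE; ring.
have Dv : idenom a v = eps by rewrite DE subrr mulr0 addr0.
have Dp i : p i != v -> 2 * g <= idenom a (p i).
  move=> /gle h; rewrite DE; have : 2 * g <= 2 * al * (L - dot v (p i)).
    by apply: ler_pM; lra.
  by lra.
have DP : Dpos a P.
  apply: Dpos_cvx => i; have [->|/Dp] := eqVneq (p i) v; last by lra.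
  by rewrite Dv.
exists a; split => //.
  (* By the equation for [al] this numerator is [eps + 2 * al * (L - 1)], which exceeds
     [2 * (L - 1)]. *)
  exists ((1 + al ^+ 2 * L - 2 * al) / eps).
    rewrite ler_pM2r ?invr_gt0 //.
    have : 2 * (L - 1) <= 2 * al * (L - 1) by rewrite ler_pM2r; lra.
    by move: alE; lra.
  rewrite /iproj Dv aa /a !scalerA -scalerDl scalerA; congr (_ *: _).
  by rewrite dotZl; field; exact: lt0r_neq0.
move=> i pi; rewrite /iproj enormZ ger0_norm; last first.
  by rewrite invr_ge0; have := Dp _ pi; lra.
apply: ler_pM; rewrite ?invr_ge0 ?enorm_ge0 //; first by have := Dp _ pi; lra.
  by rewrite lef_pV2 ?posrE; have := Dp _ pi; lra.
apply: le_trans (enormD _ _) _; apply: lerD.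
  rewrite enormZ ger0_norm; last by lra.
  apply: ler_pM; rewrite ?enorm_ge0 //; first by lra.
  by rewrite aa; have : al ^+ 2 * L <= 4 * L by [rewrite ler_pM2r; lra]; lra.
rewrite enormZ; apply: ler_pM; rewrite ?enorm_ge0 //.
apply: le_trans (ler_normB _ _) _; rewrite (ger0_norm (ler0n _ 2)) lerD2l.
rewrite normrM (ger0_norm (ler0n _ 2)) ler_wpM2l //.
by apply: le_trans (dot_le _ _) _; apply: ler_pM; rewrite ?enorm_ge0.
Qed.

Section Escaping.
Variables (M eps : R) (a : V).
Hypotheses (M0 : 0 <= M) (e0 : 0 < eps) (esc : escaping M eps a).
Local Notation A := (iproj a).

(** At the image of [v] the functional is nonnegative, and Cauchy-Schwarz bounds it at the images of
    the other generators. *)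
Lemma escaping_dot_ge x : (A @` P) x -> - (M * enorm v) <= dot (- v) x.
Proof.
have [L1 M00 e00] := And3 v1 M0 e0.
have [[a1 La na Dv] DP [kap kapE vE] near] := esc.
have kap0 : 0 <= kap by apply: le_trans kapE; rewrite divr_ge0 ?mulr_ge0 //; lra.
rewrite image_cvx // => [[w [w0 [w1 ->]]]|i]; last by apply: DP; exact: cvx_vertex.
rewrite -subr_ge0 (dot_comb _ _ _ w1); apply: sumr_ge0 => i _; rewrite mulr_ge0 //.
rewrite opprK /=; have [->|/near h] := eqVneq (p i) v.
  rewrite vE dotNl dotZr mulNr opprK addr_ge0 ?mulr_ge0 ?enorm_ge0 //; lra.
have := dot_le (- v) (A (p i)); rewrite ler_norml enormN => /andP[h1 _].
have : enorm v * enorm (A (p i)) <= enorm v * M by rewrite ler_wpM2l ?enorm_ge0.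
lra.
Qed.

(** Write x = - (mu kap) v + y, where mu is the total weight of the image of [v] and |y| <= M. The
    hypothesis bounds mu kap |v| by 1 + M: a tiny weight may be multiplied by a huge [kap], but the
    product is controlled. *)
Lemma escaping_near x : (A @` P) x -> dot (- v) x <= enorm v -> enorm x <= 1 + 2 * M.
Proof.
have [L1 M00 e00] := And3 v1 M0 e0.
have [[a1 La na Dv] DP [kap kapE vE] near] := esc.
have kap0 : 0 <= kap by apply: le_trans kapE; rewrite divr_ge0 ?mulr_ge0 //; lra.
have nv := enorm_v1.
rewrite image_cvx // => [[w [w0 [w1 ->]]]|i]; last by apply: DP; exact: cvx_vertex.
pose mu := \sum_(i | p i == v) w i.
have mu0 : 0 <= mu by exact: sumr_ge0.
have rest1 : \sum_(i | p i != v) w i <= 1.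
  by rewrite -w1 [leRHS](bigID (fun i => p i == v)) /= lerDr.
pose y := \sum_(i | p i != v) w i *: A (p i).
have -> : \sum_i w i *: (A \o p) i = (- (mu * kap)) *: v + y.
  rewrite (bigID (fun i => p i == v)) /=; congr (_ + _).
  rewrite -mulrN -scalerA -vE scaler_suml; apply: eq_bigr => i /eqP <- //.
have yM : enorm y <= M.
  apply: le_trans (enorm_sum _ _ _) _.
  apply: (@le_trans _ _ (\sum_(i | p i != v) w i * M)).
    apply: ler_sum => i pi; rewrite enormZ ger0_norm //.
    by rewrite ler_wpM2l // near.
  by rewrite -mulr_suml ler_piMl.
rewrite dotNl dotDr dotZr mulNr => h.
have h2 := dot_le v y; rewrite ler_norml in h2; case/andP: h2 => _ h2.
have h3 : enorm v * enorm y <= enorm v * M by rewrite ler_wpM2l //; lra.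
have h4 : mu * kap * enorm v <= 1 + M.
  have : mu * kap * enorm v * enorm v <= (1 + M) * enorm v.
    by rewrite -mulrA -expr2 sqr_enorm; lra.
  by rewrite ler_pM2r //; lra.
apply: le_trans (enormD _ _) _; rewrite enormZ normrN ger0_norm ?mulr_ge0 //; lra.
Qed.

End Escaping.

(* The radius does not depend on the centre of inversion: the inverse of an
   involution is Lipschitz with a uniform constant near the image of [x0]. *)
Lemma rel_ball_image G x0 r : G `<=` P -> rel_ball G x0 r ->
  exists2 s, 0 < s & forall M eps a, escaping M eps a ->
    rel_ball (iproj a @` G) (iproj a x0) s.
Proof.
have L1 := v1.
move=> GP [r0 Gx0 hG]; have nv := enorm_v1; have n0 := enorm_ge0 x0.
(* [Dm] bounds the denominator at [x0], so [d0] is a lower bound for the denominator at its image,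
   and [C1] is a Lipschitz constant for the numerators there. *)
pose Dm := 1 + 4 * L + 4 * enorm v * enorm x0.
have Dm0 : 0 < Dm by rewrite /Dm ltr_pwDl // ?addr_ge0 ?mulr_ge0 //; lra.
pose d0 := (L - 1) ^+ 2 / Dm.
have d00 : 0 < d0 by rewrite divr_gt0 // exprn_gt0 // subr_gt0.
pose C1 := 4 * L + 4 * enorm v * (enorm x0 + 2 * enorm v).
have C10 : 0 < C1 by rewrite /C1 ltr_pwDl // ?mulr_ge0 ?addr_ge0 //; lra.
(* The first bound keeps the denominator above [d0 / 2] near the image of [x0]; with it, the second
   brings the preimage within [r] of [x0]. *)
have min0 : 0 < Num.min (d0 / (8 * enorm v)) (r * d0 / (2 * C1)).
  rewrite lt_min; apply/andP; split; apply: divr_gt0 => //.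
  - by apply: mulr_gt0 => //; lra.
  - exact: mulr_gt0.
  - exact: mulr_gt0.
exists (Num.min (d0 / (8 * enorm v)) (r * d0 / (2 * C1))) => //.
move=> M eps a [[a1 La na Dv] DP _ _].
have DG : Dpos a G by move=> x /GP /DP.
have D0 := DG _ Gx0.
have am : dot a a <= 4 * L.
  rewrite -!sqr_enorm (_ : 4 * _ = (2 * enorm v) ^+ 2); last by ring.
  by rewrite ler_pXn2r ?nnegrE ?mulr_ge0 ?enorm_ge0.
split; [exact: min0|by exists x0|].
move=> z zG; set y := iproj a x0; rewrite le_min => /andP[zs1 zs2].
pose d := z - y; have zE : z = y + d by rewrite addrC subrK.
have dD := enorm_ge0 d.
have yE : iproj a y = x0 by rewrite iprojK // lt0r_neq0.
have Dy : d0 <= idenom a y.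
  rewrite idenom_iproj ?lt0r_neq0 // /d0; apply: ler_pM.
  - exact: sqr_ge0.
  - by rewrite invr_ge0 ltW.
  - by rewrite !expr2; apply: ler_pM; lra.
  rewrite lef_pV2 ?posrE // /idenom /Dm.
  have := dot_le a x0; rewrite ler_norml => /andP[h1 _].
  have : enorm a * enorm x0 <= 2 * enorm v * enorm x0 by rewrite ler_wpM2r.
  lra.
have ad : `|dot a d| <= 2 * enorm v * enorm d.
  by apply: le_trans (dot_le _ _) _; rewrite ler_wpM2r.
have Dz : d0 / 2 <= idenom a z.
  rewrite zE /idenom dotDr; move: Dy; rewrite /idenom.
  have := ad; rewrite ler_norml => /andP[_ h1].
  have : 4 * enorm v * enorm d <= d0 / 2.
    move: zs1; rewrite ler_pdivlMr; last by lra.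
    by rewrite -/d; lra.
  lra.
have Dz0 : 0 < idenom a z by move: d00; lra.
exists (iproj a z); last by rewrite iprojK // lt0r_neq0.
apply: hG.
  rewrite -(imageK a1 DG); apply: aff_image => //; last exact: lt0r_neq0.
  exact: Dpos_image.
have Dy0 : idenom a y != 0 by rewrite lt0r_neq0 //; move: d00; lra.
have Dyd : idenom a (y + d) != 0 by rewrite -zE lt0r_neq0.
rewrite -yE zE (iproj_add Dy0 Dyd) addrAC subrr add0r -zE enormZ.
rewrite ger0_norm; last by rewrite invr_ge0 ltW.
rewrite mulrC ler_pdivrMr //.
apply: (@le_trans _ _ (C1 * enorm d)); last first.
  have : r * (d0 / 2) <= r * idenom a z by rewrite ler_pM2l.
  move: zs2; rewrite ler_pdivlMr; last by lra.
  by rewrite -/d; lra.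
rewrite /itangent yE; apply: le_trans (enormD _ _) _; rewrite /C1 [leRHS]mulrDl.
apply: lerD; first by rewrite enormZ ger0_norm; [rewrite ler_wpM2r //; lra|lra].
rewrite enormZ [leRHS]mulrAC; apply: ler_pM; rewrite ?enorm_ge0 //.
  by rewrite normrM (ger0_norm (ler0n _ 2)); move: ad; lra.
by apply: le_trans (enormD _ _) _; rewrite enormN; lra.
Qed.

Hypothesis d3 : has_dim P 3.

(** A face [G] through [v] keeps a relative ball of fixed radius [s] about the image [y] of [x0].
    Shrinking this ball by half toward the image of [v] gives a ball of radius [s / 2] about the
    midpoint. It lies in the image of [G] by convexity, and there the functional [- v] is at least
    half of [kap * L - M * enorm v]. *)
Lemma cm_escapes k : (k <= 3)%N -> exists2 e, 0 < e & forall M eps a,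
  0 <= M -> escaping M eps a -> 0 < eps < 1 ->
  eps * ((M + 1) * ((1 + 2 * M) ^+ k + 1)) < e -> ~ B3 (cm k (iproj a @` P)).
Proof.
have L1 := v1.
move=> k3; have [G [GP Gv]] := face_at d3 vmax vp k3.
have [q GE] : exists q : 'I_n -> V, G = cvx q.
  by case: GP => /face_cvx[q [? _ _ _]] _; exists q.
have [x0 [r rb]] : exists x0 r, rel_ball G x0 r.
  by case: GP => _; rewrite GE => /cvx_rel_ball.
have GsP : G `<=` P by case: GP => -[_ [u' [c' [_ ->]]]] _; exact: subIsetl.
have [s s0 hs] := rel_ball_image GsP rb.
have nv := enorm_v1.
pose N : R := (size (finmap.enum_fset (fset_set (faces k P))))%:R.
have N0 : 0 <= N by [].
pose b := (s / 2 / k.+1%:R *+ 2) ^+ k.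
have b0 : 0 < b by rewrite exprn_gt0 // mulrn_wgt0 // !divr_gt0 // ltr0n.
pose C := N * (enorm v * 4 ^+ k) + 2 * enorm v * b.
have C0 : 0 < C.
  rewrite ltr_pwDr // ?mulr_gt0 ?mulr_ge0 ?exprn_ge0 //; lra.
exists ((L - 1) * L * b / C) => [|M eps a M0 esc /andP[e0 e1] small].
  by rewrite divr_gt0 ?mulr_gt0 //; lra.
have [[a1 La na Dv] DP [kap kapE vE] near] := esc.
have Dp i : 0 < idenom a (p i) by apply: DP; exact: cvx_vertex.
have QE := image_cvx a1 Dp.
have DG : Dpos a G by move=> x /GsP /DP.
have [_ Gy hGy] := hs _ _ _ esc.
pose A := iproj a; pose qv := A v; pose y := A x0.
have qvG : (A @` G) qv by exists v.
have kL : 0 <= kap by apply: le_trans kapE; rewrite divr_ge0 ?mulr_ge0 //; lra.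
(* The lower bound on the half-size ball, less the threshold |v| of the unit ball test. *)
pose H := (kap * L - M * enorm v) / 2 - enorm v.
have big : N * ((M + 1) * enorm v * (4 * (1 + 2 * M)) ^+ k) < H * b.
  have h1 : (L - 1) * L / eps <= kap * L / 2.
    have : 2 * (L - 1) / eps * L <= kap * L by rewrite ler_pM2r //; lra.
    by rewrite mulrAC; lra.
  pose T := (1 + 2 * M) ^+ k; have T0 : 0 <= T by rewrite exprn_ge0 //; lra.
  have h2 : (M + 1) * (T + 1) * C < (L - 1) * L * b / eps.
    by rewrite ltr_pdivlMr // mulrC mulrA -ltr_pdivlMr.
  have h3 : (L - 1) * L * b / eps <= kap * L / 2 * b.
    by rewrite mulrAC ler_pM2r.
  have h4 : 0 <= N * (enorm v * 4 ^+ k) by rewrite !mulr_ge0 ?exprn_ge0 //; lra.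
  have h5 : 0 <= (M + 1) * (N * (enorm v * 4 ^+ k)) by rewrite mulr_ge0 //; lra.
  have h6 : 0 <= M * enorm v * b by rewrite !mulr_ge0 //; lra.
  have h7 : 0 <= (M + 1) * T * (2 * enorm v * b) by rewrite !mulr_ge0 //; lra.
  have E : N * ((M + 1) * enorm v * (4 * (1 + 2 * M)) ^+ k) =
      (M + 1) * T * (N * (enorm v * 4 ^+ k)) by rewrite exprMn -/T; ring.
  rewrite E /H; move: h2; rewrite /C !mulrDl !mulrDr.
  rewrite mulrDl in h5.
  have := ltW b0; move: h3 h6 h7; nra.
have H0 : 0 <= H.
  have : 0 <= H * b; last by rewrite pmulr_lge0.
  apply: le_trans (ltW big); rewrite !mulr_ge0 ?exprn_ge0 ?mulr_ge0 //; lra.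
apply: (@not_B3 _ (- v)); rewrite enormN QE.
apply: (@cm_gt _ _ _ _ (faces k P) (fun F => A @` F) (- v) _ ((M + 1) * enorm v) (1 + 2 * M)
  H (2^-1 *: (qv + y)) (s / 2) G) => //.
- exact: finite_faces.
- by rewrite -QE image_facesE.
- move=> F F' /set_mem FP /set_mem F'P; apply: image_inj => //.
    exact: Dpos_face FP.
  exact: Dpos_face F'P.
- by rewrite mulr_ge0 //; lra.
- by lra.
- by lra.
- by move=> x; rewrite -QE => /(escaping_dot_ge M0 e0 esc); lra.
- by move=> x; rewrite -QE; exact: (escaping_near M0 e0 esc).
- have -> : 2^-1 *: (qv + y) = qv + 2^-1 *: (y - qv).
    rewrite scalerDr scalerBr addrCA addrC; congr (_ + _).
    by rewrite -[X in X - _]scale1r -scalerBl; congr (_ *: _); field.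
  by apply: aff_hull_line; exact: sub_aff_hull.
move=> z zG zs.
(* Doubling from the image of [v] sends the ball about the midpoint to the ball of radius [s] about
   [y]. *)
have z2 : (A @` G) (qv + 2 *: (z - qv)).
  apply: hGy; first by apply: aff_hull_line => //; exact: sub_aff_hull.
  rewrite double_midpoint.
  by rewrite enormZ ger0_norm //; move: zs; lra.
have zE : z = qv + 2^-1 *: ((qv + 2 *: (z - qv)) - qv).
  by rewrite [_ + _ - qv]addrAC subrr add0r scalerA mulVf ?pnatr_eq0 // scale1r addrC subrK.
split.
  have GE' : A @` G = cvx (A \o q).
    by rewrite GE image_cvx // => i; apply: DG; rewrite GE; exact: cvx_vertex.
  rewrite GE' in qvG z2 *; rewrite zE; apply: cvx_line => //; lra.
have z2P : (A @` P) (qv + 2 *: (z - qv)) by case: z2 => x /GsP Px <-; exists x.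
have := escaping_dot_ge M0 e0 esc z2P; rewrite /H.
have qd : dot (- v) qv = kap * L by rewrite /qv /A vE dotNl dotZr; ring.
have -> : dot (- v) (qv + 2 *: (z - qv)) = 2 * dot (- v) z - dot (- v) qv.
  by rewrite dotDr dotZr dotDr dotNr; ring.
rewrite qd; lra.
Qed.

End Degeneration.

(** * Circumcenter of mass *)

Section CrossProduct.
Context {R : realType}.
Local Notation V := 'rV[R]_3.
Implicit Types (a b c d u x y z : V).

(** Locked so that [mxE] does not open it into list lookups in the coordinate computations; [crossE]
    gives the coordinates. *)
Definition cross b c : V := locked (\row_(i < 3)
  [:: b 0 i1 * c 0 i2 - b 0 i2 * c 0 i1;
      b 0 i2 * c 0 i0 - b 0 i0 * c 0 i2;
      b 0 i0 * c 0 i1 - b 0 i1 * c 0 i0]`_i).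

Lemma cross0 b c : cross b c 0 i0 = b 0 i1 * c 0 i2 - b 0 i2 * c 0 i1.
Proof. by rewrite /cross -lock mxE. Qed.
Lemma cross1 b c : cross b c 0 i1 = b 0 i2 * c 0 i0 - b 0 i0 * c 0 i2.
Proof. by rewrite /cross -lock mxE. Qed.
Lemma cross2 b c : cross b c 0 i2 = b 0 i0 * c 0 i1 - b 0 i1 * c 0 i0.
Proof. by rewrite /cross -lock mxE. Qed.
Definition crossE := (cross0, cross1, cross2).

Lemma det3_coord a b c : det3 a b c =
  a 0 i0 * (b 0 i1 * c 0 i2 - b 0 i2 * c 0 i1) +
  a 0 i1 * (b 0 i2 * c 0 i0 - b 0 i0 * c 0 i2) +
  a 0 i2 * (b 0 i0 * c 0 i1 - b 0 i1 * c 0 i0).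
Proof.
rewrite /det3 (expand_det_row _ i0) sum3 /cofactor.
rewrite !(expand_det_row _ 0) !big_ord_recl !big_ord0 /cofactor !det_mx11 !mxE /=.
have e0 : ord0 = 0 :> 'I_2 by [].
have e1 : lift (ord0 : 'I_2) (0 : 'I_1) = 1 by apply/val_inj.
have e2 : lift (ord0 : 'I_2) (ord0 : 'I_1) = 1 by apply/val_inj.
have e3 : lift (1 : 'I_2) (0 : 'I_1) = 0 by apply/val_inj.
have l00 : lift i0 (0 : 'I_2) = i1 by apply/val_inj.
have l01 : lift i0 (1 : 'I_2) = i2 by apply/val_inj.
have l10 : lift i1 (0 : 'I_2) = i0 by apply/val_inj.
have l11 : lift i1 (1 : 'I_2) = i2 by apply/val_inj.
have l20 : lift i2 (0 : 'I_2) = i0 by apply/val_inj.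
have l21 : lift i2 (1 : 'I_2) = i1 by apply/val_inj.
rewrite ?e1 ?e2 ?e3 ?e0 ?l00 ?l01 ?l10 ?l11 ?l20 ?l21.
by rewrite /bump /= (_ : (1 %% 3 + 1 %% 3) %% 3 = 2)%N // (_ : 1 %% 3 = 1)%N //; ring.
Qed.

Lemma det3_dot a b c : det3 a b c = dot a (cross b c).
Proof. by rewrite det3_coord dot3 !crossE. Qed.

Lemma det3C a b c : det3 b c a = det3 a b c.
Proof. by rewrite !det3_coord; ring. Qed.

Lemma det3N a b c : det3 b a c = - det3 a b c.
Proof. by rewrite !det3_coord; ring. Qed.

(** The squared area of the parallelogram on [b] and [c]; it vanishes exactly when they are linearly
    dependent. *)
Definition gram b c := dot b b * dot c c - dot b c ^+ 2.

Lemma dot_cross_l b c : dot b (cross b c) = 0.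
Proof. by rewrite dot3 !crossE; ring. Qed.
Lemma dot_cross_r b c : dot c (cross b c) = 0.
Proof. by rewrite dot3 !crossE; ring. Qed.
Lemma dot_cross_cross b c : dot (cross b c) (cross b c) = gram b c.
Proof. by rewrite /gram !dot3 !crossE; ring. Qed.
Lemma cross_anti b c : cross c b = - cross b c.
Proof. by apply: rowP3; rewrite !mxE !crossE; ring. Qed.

Lemma gram_ge0 b c : 0 <= gram b c.
Proof. by rewrite -dot_cross_cross dot_ge0. Qed.

Lemma gram_decomp b c y : gram b c *: y =
  (dot y b * dot c c - dot y c * dot b c) *: b +
  (dot y c * dot b b - dot y b * dot b c) *: c + dot y (cross b c) *: cross b c.
Proof.
by apply: rowP3; rewrite !mxE !crossE /gram !dot3 !crossE; ring.
Qed.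

(** The three-term Plücker relation for four vectors in the plane obtained by projecting along
    [u]. *)
Lemma det3_plucker u d l k g :
  det3 u d l * det3 u k g + det3 u l k * det3 u d g + det3 u k d * det3 u l g = 0.
Proof. by rewrite !det3_coord; ring. Qed.

(** Cramer's rule: a vector is recovered from its products with a basis. *)
Lemma det3_dual a b c d : det3 a b c *: d =
  dot a d *: cross b c + dot b d *: cross c a + dot c d *: cross a b.
Proof.
by apply: rowP3; rewrite !mxE !crossE det3_coord !dot3; ring.
Qed.

Lemma det3_apex a b c y : det3 (b - a) (c - a) (y - a) = - det3 (a - y) (b - y) (c - y).
Proof. by rewrite !det3_coord !mxE; ring. Qed.

Lemma det3_le a b c : `|det3 a b c| <= enorm a * enorm b * enorm c.
Proof.
rewrite det3_dot; apply: le_trans (dot_le _ _) _.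
rewrite -mulrA ler_wpM2l ?enorm_ge0 // enorm_le_sqr ?mulr_ge0 ?enorm_ge0 //.
by rewrite dot_cross_cross /gram exprMn !sqr_enorm gerBl sqr_ge0.
Qed.

(** The determinant of a multiple of the identity plus a matrix of rank one. *)
Lemma det3_rank1 a w (s : R) b c y :
  det3 (s *: b + (2 * dot a b) *: w) (s *: c + (2 * dot a c) *: w)
    (s *: y + (2 * dot a y) *: w) = s ^+ 2 * det3 b c y * (s + 2 * dot a w).
Proof. by rewrite !det3_coord !dot3 !mxE; ring. Qed.

(** Each difference is [itangent] over a denominator, and [itangent] is a rank-one perturbation of a
    scalar map. The last factor of its determinant is minus the denominator at the image of [x],
    whence the reversal of orientation. *)
Lemma det3_iproj a x b c y : 1 < dot a a ->
  idenom a x != 0 -> idenom a b != 0 -> idenom a c != 0 -> idenom a y != 0 ->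
  det3 (iproj a b - iproj a x) (iproj a c - iproj a x) (iproj a y - iproj a x) =
  - (dot a a - 1) ^+ 4 / (idenom a x * idenom a b * idenom a c * idenom a y)
    * det3 (b - x) (c - x) (y - x).
Proof.
move=> a1 hx hb hc hy.
have E z : idenom a z != 0 ->
    iproj a z - iproj a x = (idenom a z)^-1 *: itangent a x (z - x).
  move=> hz; have zE : z = x + (z - x) by rewrite addrC subrK.
  have hz' : idenom a (x + (z - x)) != 0 by rewrite -zE.
  by rewrite {1}zE (iproj_add hx hz') -zE addrAC subrr add0r.
rewrite !E // /itangent.
have S s1 s2 s3 (d1 d2 d3 : V) : det3 (s1 *: d1) (s2 *: d2) (s3 *: d3) = s1 * s2 * s3 * det3 d1 d2 d3.
  by rewrite !det3_coord !mxE; ring.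
rewrite S det3_rank1.
have -> : dot a a - 1 + 2 * dot a (iproj a x - a) = - (dot a a - 1) ^+ 2 / idenom a x.
  rewrite mulNr -idenom_iproj // /idenom dotDr dotNr; ring.
by field; rewrite hx hb hc hy.
Qed.

Definition phi a b c : V :=
  dot a a *: cross b c + dot b b *: cross c a + dot c c *: cross a b.

Lemma phiC a b c : phi b c a = phi a b c.
Proof. by apply/rowP => i; rewrite !mxE; ring. Qed.

(* [phi a b c / (2 * det3 a b c)] is the circumcentre of the simplex with
   vertices [0], [a], [b] and [c]. *)
Lemma phi_circumcenter a b c : det3 a b c != 0 ->
  exists d, [/\ 2 * dot a d = dot a a, 2 * dot b d = dot b b & 2 * dot c d = dot c c].
Proof.
move=> h; exists ((2 * det3 a b c)^-1 *: phi a b c).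
have E x : 2 * dot x ((2 * det3 a b c)^-1 *: phi a b c) = dot x (phi a b c) / det3 a b c.
  by rewrite dotZr; field.
have E1 : dot a (phi a b c) = dot a a * det3 a b c by rewrite /phi det3_coord !dot3 !mxE !crossE; ring.
have E2 : dot b (phi a b c) = dot b b * det3 a b c by rewrite /phi det3_coord !dot3 !mxE !crossE; ring.
have E3 : dot c (phi a b c) = dot c c * det3 a b c by rewrite /phi det3_coord !dot3 !mxE !crossE; ring.
by rewrite !E E1 E2 E3 !mulfK.
Qed.

Lemma phi_unique a b c d : 2 * dot a d = dot a a -> 2 * dot b d = dot b b ->
  2 * dot c d = dot c c -> (2 * det3 a b c) *: d = phi a b c.
Proof. by move=> h1 h2 h3; rewrite -scalerA det3_dual !scalerDr !scalerA h1 h2 h3. Qed.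

(** The change of [phi] under a translation by [x], sorted by pairs of vertices so that it becomes a
    sum of antisymmetric terms over the oriented edges. *)
Definition edge_defect x b c : V :=
  dot x x *: cross b c + cross x (dot b b *: c - dot c c *: b)
  - 2 *: cross x (dot b x *: c - dot c x *: b) - (2 * dot x (cross b c)) *: x.

Lemma edge_defect_anti x b c : edge_defect x c b = - edge_defect x b c.
Proof.
by apply: rowP3; rewrite /edge_defect !mxE !crossE !mxE !dot3 !crossE; ring.
Qed.

Lemma phi_shift x a b c :
  (2 * det3 (a - x) (b - x) (c - x)) *: x + phi (a - x) (b - x) (c - x) =
  phi a b c + (edge_defect x a b + edge_defect x b c + edge_defect x c a).
Proof.
by apply: rowP3; rewrite /edge_defect /phi !mxE !crossE !mxE det3_coord !dot3 !mxE !crossE; ring.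
Qed.

Lemma det3_shift x a b c : det3 (a - x) (b - x) (c - x) =
  det3 a b c - (dot x (cross a b) + dot x (cross b c) + dot x (cross c a)).
Proof. by rewrite !det3_coord !dot3 !mxE !crossE; ring. Qed.

(** As [phi] is twice the determinant times the circumcenter, this is the condition that the
    circumcenter is equidistant from 0 and [s *: u], divided by [s]. *)
Lemma dot_phi_axis u s b c : dot u (phi (s *: u) b c) = s * dot u u * det3 (s *: u) b c.
Proof. by rewrite det3_coord /phi !dot3 !mxE !crossE !mxE; ring. Qed.

Lemma dot_phi_le u a b c M : enorm a <= M -> enorm b <= M -> enorm c <= M ->
  `|dot u (phi a b c)| <= 3 * (M ^+ 2 * (enorm u * M * M)).
Proof.
move=> aM bM cM; have M0 : 0 <= M := le_trans (enorm_ge0 a) aM.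
have key x y z : enorm x <= M -> enorm y <= M -> enorm z <= M ->
    `|dot x x * det3 u y z| <= M ^+ 2 * (enorm u * M * M).
  move=> xM yM zM; rewrite normrM; apply: ler_pM => //.
    by rewrite ger0_norm ?dot_ge0 // -sqr_enorm ler_pXn2r ?nnegrE ?enorm_ge0.
  apply: le_trans (det3_le _ _ _) _; apply: ler_pM; rewrite ?mulr_ge0 ?enorm_ge0 //.
  by apply: ler_pM; rewrite ?enorm_ge0.
have -> : dot u (phi a b c) =
    dot a a * det3 u b c + dot b b * det3 u c a + dot c c * det3 u a b.
  by rewrite /phi !dotDr !dotZr !det3_dot.
have := key _ _ _ aM bM cM; have := key _ _ _ bM cM aM; have := key _ _ _ cM aM bM.
set B := M ^+ 2 * _ => h1 h2 h3.
apply: le_trans (ler_normD _ _) _.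
by have := ler_normD (dot a a * det3 u b c) (dot b b * det3 u c a); lra.
Qed.

End CrossProduct.

(** * Facets of simplicial polyhedra *)

Section Simplicial.
Context {R : realType}.
Local Notation V := 'rV[R]_3.
Implicit Types (x y z u a b c e : V) (S F P : set V).

(** Besides making each generator an extreme point, this excludes repetitions, so that vertices can
    be handled through their indices. *)
Definition extremal n (p : 'I_n -> V) := forall i (w : 'I_n -> R),
  (forall j, 0 <= w j) -> \sum_j w j = 1 -> p i = \sum_j w j *: p j -> w i = 1.

Lemma weight_le1 n (w : 'I_n -> R) i : (forall j, 0 <= w j) -> \sum_j w j = 1 -> w i <= 1.
Proof. by move=> w0 <-; rewrite (bigD1 i) //= lerDl sumr_ge0. Qed.

Lemma weight_eq1 n (w : 'I_n -> R) i j : (forall j, 0 <= w j) -> \sum_j w j = 1 ->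
  w i = 1 -> j != i -> w j = 0.
Proof.
move=> w0; rewrite (bigD1 i) //= => + wi ji; rewrite wi => /eqP.
rewrite -subr_eq0 addrAC subrr add0r psumr_eq0 // => /allP/(_ j).
by rewrite mem_index_enum => /(_ isT); rewrite ji /= => /eqP.
Qed.

Lemma weight_single (U : lmodType R) n (w : 'I_n -> R) i (p : 'I_n -> U) :
  (forall j, 0 <= w j) -> \sum_j w j = 1 -> w i = 1 -> \sum_j w j *: p j = p i.
Proof.
move=> w0 w1 wi; rewrite (bigD1 i) //= wi scale1r big1 ?addr0 // => j ji.
by rewrite (weight_eq1 w0 w1 wi ji) scale0r.
Qed.

(** Take the least possible number of generators. If some [p i] had a representation with own weight
    below 1, solving it for [p i] would express it by the others, and it could be dropped. *)
Lemma extremal_exists m (q : 'I_m -> V) :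
  exists n (p : 'I_n -> V), cvx q = cvx p /\ extremal p.
Proof.
pose Q k := `[< exists p : 'I_k -> V, cvx q = cvx p >].
have Qm : exists k, Q k by exists m; apply/asboolP; exists q.
case: (ex_minnP Qm) => n /asboolP[p qp] nmin; exists n, p; split => // i w w0 w1 pi.
apply/eqP; apply: contraT => wi; have w1' : 0 < 1 - w i.
  by rewrite subr_gt0 lt_neqAle wi weight_le1.
case: n p qp nmin i w w0 w1 pi wi w1' => [|n] p qp nmin i w w0 w1 pi wi w1'; first by case: (i).
suff /nmin : Q n by rewrite ltnn.
apply/asboolP; exists (p \o lift i); rewrite qp; apply/seteqP; split.
  apply: cvx_comb => j; case: (unliftP i j) => [l ->|->]; first exact: (cvx_vertex (p \o lift i) l).
  exists (fun l => w (lift i l) / (1 - w i)); split.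
    by move=> l; rewrite divr_ge0 // ltW.
  have w1E : \sum_(l < n) w (lift i l) = 1 - w i.
    by rewrite -w1 (bigD1_ord i) //= addrAC subrr add0r.
  split; first by rewrite -mulr_suml w1E divff // lt0r_neq0.
  have E : (1 - w i) *: p i = \sum_(l < n) w (lift i l) *: p (lift i l).
    by rewrite scalerBl scale1r {1}pi (bigD1_ord i) //= addrAC subrr add0r.
  under eq_bigr do rewrite mulrC -scalerA.
  by rewrite -scaler_sumr -E scalerA mulVf ?scale1r // lt0r_neq0.
by apply: cvx_comb => l; exact: cvx_vertex.
Qed.

Definition tri a b c : 'I_3 -> V := fun i => [:: a; b; c]`_i.

Lemma range_tri a b c : range (tri a b c) = [set a; b; c].
Proof.
apply/seteqP; split => [_ [i _ <-]|x /=].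
  by elim/ord3P: i; rewrite /tri /=; [left; left|left; right|right].
by case=> [[->|->]|->]; [exists i0|exists i1|exists i2].
Qed.

Lemma conv_hull_tri a b c : conv_hull [set a; b; c] = cvx (tri a b c).
Proof. by rewrite -range_tri conv_hull_range. Qed.

Lemma triP a b c i : [\/ tri a b c i = a, tri a b c i = b | tri a b c i = c].
Proof. by elim/ord3P: i; [apply: Or31|apply: Or32|apply: Or33]. Qed.

Lemma afc_tri a b c s t : afc (tri a b c) (a + (s *: (b - a) + t *: (c - a))).
Proof.
exists (fun i => [:: 1 - s - t; s; t]`_i); rewrite !sum3 /tri /=; split; first by ring.
by apply/rowP => i; rewrite !mxE; ring.
Qed.

Lemma gram_residue b c :
  dot (dot b b *: c - dot c b *: b) (dot b b *: c - dot c b *: b) =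
  dot b b * gram b c.
Proof. by rewrite /gram !dotL (dotC c b); ring. Qed.

Lemma row_free_gram b c : gram b c != 0 -> row_free (col_mx b c).
Proof.
move=> g0; rewrite -kermx_eq0; apply/eqP/row_matrixP => l; rewrite row0.
have := mulmx_ker (col_mx b c) => /(congr1 (row l)); rewrite row_mul row0.
set t := row l _; rewrite -[t]hsubmxK mul_row_col [lsubmx t]mx11_scalar [rsubmx t]mx11_scalar.
rewrite !mul_scalar_mx; set s := lsubmx t 0 0; set r := rsubmx t 0 0 => h.
have hb : s * dot b b + r * dot b c = 0.
  by rewrite -!dotZr -dotDr h dot0r.
have hc : s * dot b c + r * dot c c = 0.
  by rewrite (dotC b c) -!dotZr -dotDr h dot0r.
have s0 : s * gram b c = 0.
  rewrite /gram (_ : _ * _ = (s * dot b b + r * dot b c) * dot c c -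
    (s * dot b c + r * dot c c) * dot b c); last by ring.
  by rewrite hb hc !mul0r subr0.
have r0 : r * gram b c = 0.
  rewrite /gram (_ : _ * _ = (s * dot b c + r * dot c c) * dot b b -
    (s * dot b b + r * dot b c) * dot b c); last by ring.
  by rewrite hb hc !mul0r subr0.
move/eqP: s0; rewrite mulf_eq0 (negbTE g0) orbF => /eqP ->.
move/eqP: r0; rewrite mulf_eq0 (negbTE g0) orbF => /eqP ->.
by rewrite !raddf0 row_mx0.
Qed.

Lemma plane_decomp a b c y : gram (b - a) (c - a) != 0 ->
  dot (y - a) (cross (b - a) (c - a)) = 0 ->
  exists s t, y = a + (s *: (b - a) + t *: (c - a)).
Proof.
move=> g0 h; have := gram_decomp (b - a) (c - a) (y - a).
rewrite h scale0r addr0.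
move: (gram _ _) g0 (_ - dot (y - a) (c - a) * _) (_ - dot (y - a) (b - a) * _).
move=> g g0 s t E; exists (s / g), (t / g).
by rewrite !(mulrC _ g^-1) -!scalerA -scalerDr -E scalerA mulVf // scale1r addrC subrK.
Qed.

Lemma plane_has_dim2 n (q : 'I_n -> V) a b c : gram (b - a) (c - a) != 0 ->
  cvx q a -> cvx q b -> cvx q c ->
  (forall i, dot (q i - a) (cross (b - a) (c - a)) = 0) -> has_dim (cvx q) 2.
Proof.
move=> g0 qa qb qc h.
apply: (@has_dim_span _ _ _ 2 (col_mx (b - a) (c - a)) a) => //.
- exact: row_free_gram.
- move=> i; have [s [t ->]] := plane_decomp g0 (h i).
  have E : row_mx s%:M t%:M *m col_mx (b - a) (c - a) = s *: (b - a) + t *: (c - a).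
    by rewrite mul_row_col !mul_scalar_mx.
  by exists (row_mx s%:M t%:M : 'rV_(1 + 1)) => //; congr (_ + _); exact: E.
move=> l; rewrite -(@splitK 1 1 l); case: (@fintype.split 1 1 l) => r /=.
  have E : row (lshift 1 r) (col_mx (b - a) (c - a)) = b - a by rewrite rowKu row_id.
  apply: (eq_ind_r (fun z => aff_hull (cvx q) (a + z)) _ E).
  by rewrite addrC subrK; exact: sub_aff_hull.
have E : row (rshift 1 r) (col_mx (b - a) (c - a)) = c - a by rewrite rowKd row_id.
apply: (eq_ind_r (fun z => aff_hull (cvx q) (a + z)) _ E).
by rewrite addrC subrK; exact: sub_aff_hull.
Qed.

(** [triangle] admits repeated or collinear corners; the dimension of a facet rules these out by
    this lemma. *)
Lemma dim2_not_line F x e : has_dim F 2 -> ~ F `<=` flat x e.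
Proof.
move=> [pt [B [Bf FE]]] Fl.
have line y : flat pt B y -> flat x e y.
  by rewrite -FE => -[n [w [q [qF [w1 ->]]]]]; apply: flat_comb => // i; exact: Fl.
have Be : (B <= e)%MS.
  apply/row_subP => j.
  have h0 : flat x e pt by apply: line; exists 0; rewrite ?mul0mx ?addr0.
  have h1 : flat x e (pt + row j B) by apply: line; exists (delta_mx 0 j); rewrite // -rowE.
  have [t E] := flat_sub h0 h1; move/addrI: E => ->; exact: submxMl.
have := mxrankS Be; move: Bf => /eqP ->; rewrite leqNgt => /negP; apply.
by apply: leq_ltn_trans (rank_leq_row e) _.
Qed.

Section Facets.
Variables (n : nat) (p : 'I_n -> V).
Local Notation P := (cvx p).
Hypothesis ex : extremal p.
Hypothesis d3 : has_dim P 3.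

Lemma extremal_inj : injective p.
Proof.
move=> i j pij; have := @ex i (fun l => (l == j)%:R).
rewrite sum_delta1 sum_delta => /(_ (fun=> ler0n _ _) erefl pij).
by case: eqP => // _ /eqP; rewrite eq_sym oner_eq0.
Qed.

(** Expanding the [q t] in the generators, the averaged coefficient of [p i] must be 1. No
    coefficient exceeds 1, so some [q t] of nonzero weight has coefficient 1 and equals [p i]. *)
Lemma extremal_cvx m (q : 'I_m -> V) i : (forall t, P (q t)) -> cvx q (p i) ->
  exists t, q t = p i.
Proof.
move=> /choice[v hv] [s [s0 [s1 pi]]].
have W1 : \sum_t s t * v t i = 1.
  apply: (@ex i (fun l => \sum_t s t * v t l)).
  - by move=> l; apply: sumr_ge0 => t _; rewrite mulr_ge0 // (hv t).1.
  - rewrite exchange_big /= -[RHS]s1; apply: eq_bigr => t _.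
    by rewrite -mulr_sumr (hv t).2.1 mulr1.
  rewrite pi; under [RHS]eq_bigr do rewrite scaler_suml.
  rewrite exchange_big /=; apply: eq_bigr => t _.
  by rewrite {1}(hv t).2.2 scaler_sumr; apply: eq_bigr => l _; rewrite scalerA.
have [t st] : exists t, s t != 0.
  apply: contrapT => /forallNP N; move/eqP: s1; rewrite big1 ?(eq_sym 0) ?oner_eq0 // => t _.
  by have /negP := N t; rewrite negbK => /eqP.
have : \sum_t s t * (1 - v t i) = 0.
  by under eq_bigr do rewrite mulrBr mulr1; rewrite sumrB s1 W1 subrr.
move=> /psumr_eq0P h; exists t.
have := h (fun t _ => mulr_ge0 (s0 t) _) t isT => /(_ _)/eqP.
rewrite mulf_eq0 (negbTE st) subr_eq0 => vt.
have vti : v t i = 1.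
  apply/esym/eqP; apply: vt => r; rewrite subr_ge0.
  by apply: weight_le1; [exact: (hv r).1|exact: (hv r).2.1].
by rewrite (hv t).2.2 (weight_single _ (hv t).1 (hv t).2.1 vti).
Qed.

Definition orient i j k l := det3 (p j - p i) (p k - p i) (p l - p i).

(** A facet together with its outward orientation, expressed by indices. The strict inequality
    excludes collinear triples, for which every [orient] is 0. *)
Definition facing i j k : bool :=
  `[< (forall l, orient i j k l <= 0) /\ exists l, orient i j k l < 0 >].

Lemma orient_cyc i j k l : orient j k i l = orient i j k l.
Proof. by rewrite /orient !det3_coord !mxE; ring. Qed.

Lemma orient_swap i j k l : orient i k j l = - orient i j k l.
Proof. by rewrite /orient det3N. Qed.

Lemma orient_dot i j k l :
  orient i j k l = dot (p l - p i) (cross (p j - p i) (p k - p i)).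
Proof. by rewrite /orient det3C -det3_dot det3C. Qed.

Lemma facing_cyc i j k : facing j k i = facing i j k.
Proof.
apply/asboolP/asboolP => -[h [l hl]]; split.
- by move=> l'; rewrite -(orient_cyc i j k).
- by exists l; rewrite -(orient_cyc i j k).
- by move=> l'; rewrite (orient_cyc i j k).
- by exists l; rewrite (orient_cyc i j k).
Qed.

Lemma facing_swap i j k : facing i j k -> ~~ facing i k j.
Proof.
move=> /asboolP[_ [l hl]]; apply/asboolP => -[h _].
by have := h l; rewrite orient_swap; lra.
Qed.

Lemma facing_neq i j k : facing i j k -> [/\ i != j, j != k & i != k].
Proof.
move=> /asboolP[_ [l]]; rewrite /orient => h.
by split; apply/eqP => E; move: h; rewrite E ?subrr !det3_coord ?mxE; lra.
Qed.

Lemma facing_gram i j k : facing i j k -> gram (p j - p i) (p k - p i) != 0.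
Proof.
move=> /asboolP[_ [l hl]]; apply/eqP => g0; move: hl; rewrite orient_dot.
have /dot_eq0 -> : dot (cross (p j - p i) (p k - p i)) (cross (p j - p i) (p k - p i)) = 0.
  by rewrite dot_cross_cross.
by rewrite dot0r ltxx.
Qed.

Definition face_plane i j k := P `&` [set y | dot (cross (p j - p i) (p k - p i)) y =
  dot (cross (p j - p i) (p k - p i)) (p i)].

Lemma face_planeP i j k l : face_plane i j k (p l) <-> orient i j k l = 0.
Proof.
rewrite orient_dot dotC dotDr dotNr; split => [[_ /= ->]|h]; first by rewrite subrr.
by split; [exact: cvx_vertex|apply/eqP; rewrite -subr_eq0 /= h].
Qed.

Lemma face_plane_vertices i j k : [/\ face_plane i j k (p i),
  face_plane i j k (p j) & face_plane i j k (p k)].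
Proof.
by split; apply/face_planeP; rewrite /orient !det3_coord ?mxE; ring.
Qed.

Lemma facing_face i j k : facing i j k -> faces 2 P (face_plane i j k).
Proof.
move=> f; have [Fi Fj Fk] := face_plane_vertices i j k.
have fF : is_face P (face_plane i j k).
  split; first by exists (p i).
  exists (cross (p j - p i) (p k - p i)), (dot (cross (p j - p i) (p k - p i)) (p i)).
  split => //; apply: cvx_le => l.
  by move/asboolP: f => [/(_ l) + _]; rewrite orient_dot dotC dotDr dotNr subr_le0.
split => //; have [q [FE Fq qp _]] := face_cvx fF; rewrite FE in Fi Fj Fk *.
apply: (plane_has_dim2 (facing_gram f)) => // m.
have [l ql] := qp m; have := Fq m; rewrite ql => /face_planeP.
by rewrite orient_dot.
Qed.

Hypothesis simp : simplicial P.

(** The face in this plane is a triangle, and every generator on it is one of the three corners. The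
    distinct [p i], [p j], [p k] already use them up. *)
Lemma facing_zero i j k l : facing i j k -> orient i j k l = 0 ->
  [\/ l = i, l = j | l = k].
Proof.
move=> f /face_planeP Fl; have [Fi Fj Fk] := face_plane_vertices i j k.
have [a [b [c]]] := simp (facing_face f); rewrite conv_hull_tri => FE.
have sub m : face_plane i j k (p m) -> p m \in [:: a; b; c].
  rewrite FE => h; have [t ht] : exists t, tri a b c t = p m.
    apply: extremal_cvx => // t; have : cvx (tri a b c) (tri a b c t) by exact: cvx_vertex.
    by rewrite -FE => -[].
  by rewrite -ht !inE; case: (triP a b c t) => ->; rewrite eqxx ?orbT.
have [ij jk ik] := facing_neq f.
have pu : uniq [:: p i; p j; p k].
  by rewrite /= !inE !(inj_eq extremal_inj) negb_or ij ik jk.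
have s3 : {subset [:: p i; p j; p k] <= [:: a; b; c]}.
  by apply/allP; rewrite /= (sub _ Fi) (sub _ Fj) (sub _ Fk).
have [_ E] := uniq_min_size pu s3 (leqnn _).
have := sub _ Fl; rewrite -E !inE !(inj_eq extremal_inj).
by case/or3P => /eqP ->; [apply: Or31|apply: Or32|apply: Or33].
Qed.

Lemma face_plane_tri i j k : facing i j k ->
  face_plane i j k = cvx (tri (p i) (p j) (p k)).
Proof.
move=> f; have [Fi Fj Fk] := face_plane_vertices i j k.
have [q [FE Fq qp _]] := face_cvx (facing_face f).1; rewrite FE in Fi Fj Fk *.
apply/seteqP; split; apply: cvx_comb => m; last by case: (triP (p i) (p j) (p k) m) => ->.
have [l ql] := qp m; have := Fq m; rewrite ql => /face_planeP /(facing_zero f).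
by case=> ->; [exact: (cvx_vertex _ i0)|exact: (cvx_vertex _ i1)|exact: (cvx_vertex _ i2)].
Qed.

Lemma facet_facing F : faces 2 P F ->
  exists i j k, facing i j k /\ F = cvx (tri (p i) (p j) (p k)).
Proof.
move=> fF; have [a [b [c]]] := simp fF; rewrite conv_hull_tri => FE.
have [q [FE' Fq qp _]] := face_cvx fF.1.
have [_ dF] := fF.
have FP : F `<=` P by case: fF => -[_ [u [c' [_ ->]]]] _; exact: subIsetl.
have mem t : P (tri a b c t) by apply: FP; rewrite FE; exact: cvx_vertex.
have qabc m : exists t, tri a b c t = q m.
  have [l ql] := qp m; rewrite ql; apply: extremal_cvx => //.
  by rewrite -ql -FE.
(* a missing corner would leave all generators of [F] on a line *)
have corner y1 y2 y3 : (forall t, [\/ tri a b c t = y1, tri a b c t = y2 | tri a b c t = y3]) ->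
    exists i, p i = y1.
  move=> ty; apply: contrapT => N; apply: (@dim2_not_line F y2 (y3 - y2) dF).
  rewrite FE' => _ [w [_ [w1 ->]]]; apply: flat_comb => // m.
  have [t qt] := qabc m; have [l ql] := qp m.
  have [E|E|E] := ty t; first by exfalso; apply: N; exists l; rewrite -ql -qt.
    by rewrite -qt E; exists 0; rewrite ?mul0mx ?addr0.
  by rewrite -qt E; exists 1%:M; rewrite // mul1mx addrC subrK.
have [i pi] : exists i, p i = a by apply: (corner a b c) => t; exact: triP.
have [j pj] : exists j, p j = b.
  by apply: (corner b c a) => t; have [->|->|->] := triP a b c t; [apply: Or33|apply: Or31|apply: Or32].
have [k pk] : exists k, p k = c.
  by apply: (corner c a b) => t; have [->|->|->] := triP a b c t; [apply: Or32|apply: Or33|apply: Or31].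
rewrite -pi -pj -pk in FE.
pose N := cross (p j - p i) (p k - p i).
(* Otherwise the three corners, and with them the facet, would lie on a line. *)
have g0 : gram (p j - p i) (p k - p i) != 0.
  apply/eqP => g0; have cs0 : N = 0 by apply: dot_eq0; rewrite dot_cross_cross.
  pose b' := p j - p i; pose c' := p k - p i.
  have [bz|b0] := eqVneq b' 0.
    apply: (@dim2_not_line F (p i) c' dF); rewrite FE => _ [w [_ [w1 ->]]].
    apply: flat_comb => // t; have [->|->|->] := triP (p i) (p j) (p k) t.
    - by exists 0; rewrite ?mul0mx ?addr0.
    - by exists 0; rewrite // mul0mx addr0; apply/esym/eqP; rewrite -subr_eq0; apply/eqP.
    - by exists 1%:M; rewrite // mul1mx addrC subrK.
  apply: (@dim2_not_line F (p i) b' dF); rewrite FE => _ [w [_ [w1 ->]]].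
  apply: flat_comb => // t; have [->|->|->] := triP (p i) (p j) (p k) t.
  - by exists 0; rewrite ?mul0mx ?addr0.
  - by exists 1%:M; rewrite // mul1mx addrC subrK.
  exists ((dot c' b' / dot b' b')%:M) => //; rewrite mul_scalar_mx.
  have : dot b' b' *: c' = dot c' b' *: b'.
    apply/eqP; rewrite -subr_eq0; apply/eqP/dot_eq0.
    transitivity (dot b' b' * gram b' c'); last by rewrite g0 mulr0.
    exact: gram_residue.
  move=> E; rewrite mulrC -scalerA -E scalerA mulVf ?scale1r; last by rewrite lt0r_neq0 // dot_gt0.
  by rewrite addrC subrK.
have [[_ [u [c0 [Pu FP']]]] _] := fF.
have Fpt t : F (tri (p i) (p j) (p k) t) by rewrite FE; exact: cvx_vertex.
have onF y : F y -> dot u y = c0 by rewrite FP' => -[].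
have ui : dot u (p i) = c0 := onF _ (Fpt i0).
have uj : dot u (p j) = c0 := onF _ (Fpt i1).
have uk : dot u (p k) = c0 := onF _ (Fpt i2).
(* The supporting normal [u] is orthogonal to two edges, hence parallel to [N]. The sign of
   [dot u N] then decides which of the two orientations of the triangle is outward. *)
have uN : gram (p j - p i) (p k - p i) *: u = dot u N *: N.
  have ub : dot u (p j - p i) = 0 by rewrite dotDr dotNr ui uj subrr.
  have uc : dot u (p k - p i) = 0 by rewrite dotDr dotNr ui uk subrr.
  by rewrite gram_decomp ub uc !mul0r subrr !scale0r !add0r.
have oE l : dot u N * orient i j k l =
    gram (p j - p i) (p k - p i) * (dot u (p l) - c0).
  rewrite orient_dot -/N (dotC (p l - p i)) -dotZl -uN dotZl; congr (_ * _).
  by rewrite dotDr dotNr ui.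
have g1 : 0 < gram (p j - p i) (p k - p i) by rewrite lt0r g0 gram_ge0.
have [l0 hl0] : exists l, dot u (p l) < c0.
  have N0 : N != 0 by apply/eqP => N0; move: g0; rewrite -dot_cross_cross -/N N0 dot0r eqxx.
  have [l hl] := not_in_plane d3 (dot N (p i)) N0.
  exists l; rewrite lt_neqAle (Pu _ (cvx_vertex p l)) andbT; apply/eqP => ul.
  have : F (p l) by rewrite FP'; split; [exact: cvx_vertex|].
  rewrite FE => -[w [_ [w1 E]]]; move/eqP: hl; apply.
  rewrite E; apply/eqP; rewrite -subr_eq0 (dot_comb _ _ _ w1) big1 // => t _.
  have zj : dot N (p j) - dot N (p i) = 0 by rewrite -dotNr -dotDr dotC dot_cross_l.
  have zk : dot N (p k) - dot N (p i) = 0 by rewrite -dotNr -dotDr dotC dot_cross_r.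
  by have [->|->|->] := triP (p i) (p j) (p k) t; rewrite ?zj ?zk ?subrr mulr0.
have ule l : dot u (p l) - c0 <= 0 by rewrite subr_le0; exact: Pu (cvx_vertex p l).
have [uN0|uN0|uN0] := ltgtP (dot u N) 0; last first.
- have := oE l0; rewrite uN0 mul0r => /esym/eqP.
  by rewrite mulf_eq0 (negbTE g0) subr_eq0 (lt_eqF hl0).
- exists i, j, k; split => //; apply/asboolP; split => [l|].
    by rewrite -(pmulr_rle0 _ uN0) oE pmulr_rle0.
  by exists l0; rewrite -(pmulr_rlt0 _ uN0) oE pmulr_rlt0 // subr_lt0.
- exists i, k, j; split; last first.
    rewrite FE; apply/seteqP; split; apply: cvx_comb => t.
      by have [->|->|->] := triP (p i) (p j) (p k) t;
        [exact: (cvx_vertex _ i0)|exact: (cvx_vertex _ i2)|exact: (cvx_vertex _ i1)].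
    by have [->|->|->] := triP (p i) (p k) (p j) t;
        [exact: (cvx_vertex _ i0)|exact: (cvx_vertex _ i2)|exact: (cvx_vertex _ i1)].
  apply/asboolP; split => [l|].
    by rewrite orient_swap oppr_le0 -(nmulr_rle0 _ uN0) oE pmulr_rle0.
  by exists l0; rewrite orient_swap oppr_lt0 -(nmulr_rlt0 _ uN0) oE pmulr_rlt0 // subr_lt0.
Qed.

End Facets.
End Simplicial.

(** * Circumcenters of simplices and cancellation along edges *)

Section CircumcenterOfMass.
Context {R : realType}.
Local Notation V := 'rV[R]_3.
Implicit Types (x y z u a b c : V) (S F P : set V).

Lemma tri_cyc a b c : cvx (tri b c a) = cvx (tri a b c).
Proof.
rewrite -!conv_hull_tri; congr conv_hull; apply/seteqP.
by split => y /= [[->|->]|->]; [left; right|right|left; left|right|left; left|left; right].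
Qed.

Lemma gram_cyc a b c : gram (c - b) (a - b) = gram (b - a) (c - a).
Proof. by rewrite /gram !dot3 !mxE; ring. Qed.

(** The solution of a linear system in the Gram matrix of [b] and [c]. When they are the sides of a
    triangle at [a], the functional [u] exposes [a]. *)
Lemma exposing_vector b c : exists u, dot u b = - gram b c /\ dot u c = - gram b c.
Proof.
exists (- ((dot c c - dot b c) *: b + (dot b b - dot b c) *: c)).
by rewrite /gram !dotL (dotC c b); split; ring.
Qed.

Lemma vertex_tri a b c : gram (b - a) (c - a) != 0 -> vertices (cvx (tri a b c)) a.
Proof.
move=> g0; have g1 : 0 < gram (b - a) (c - a) by rewrite lt0r g0 gram_ge0.
have [u [ub uc]] := exposing_vector (b - a) (c - a).
apply: (@exposed_vertex _ _ _ _ u); first exact: (cvx_vertex _ i0).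
move=> i; have [->|->|->] := triP a b c i; first by rewrite eqxx.
  by move=> _; rewrite -subr_lt0 -dotNr -dotDr ub oppr_lt0.
by move=> _; rewrite -subr_lt0 -dotNr -dotDr uc oppr_lt0.
Qed.

Lemma vertices_tri a b c y : gram (b - a) (c - a) != 0 ->
  vertices (cvx (tri a b c)) y <-> [\/ y = a, y = b | y = c].
Proof.
move=> g0; split => [[/face_cvx[q [yE _ qt _]] _]|].
  have : cvx q (q i0) by exact: cvx_vertex.
  by rewrite -yE => /= <-; have [t ->] := qt i0; exact: triP.
case=> ->; first exact: vertex_tri.
  by rewrite -tri_cyc; apply: vertex_tri; rewrite gram_cyc.
by rewrite -tri_cyc -tri_cyc; apply: vertex_tri; rewrite gram_cyc gram_cyc.
Qed.

Lemma enorm_eq_dot a d r : enorm d = r -> (enorm (a - d) = r <-> 2 * dot a d = dot a a).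
Proof.
move=> dr; rewrite -dr.
have E : dot (a - d) (a - d) - dot d d = dot a a - 2 * dot a d.
  by rewrite dot_sub (dotC d a); ring.
split=> [h|h].
  have : dot (a - d) (a - d) - dot d d = 0 by rewrite -!sqr_enorm h subrr.
  by rewrite E; lra.
by rewrite /enorm; congr Num.sqrt; move: E; rewrite h; lra.
Qed.

(** With [x] moved to the origin, [phi_circumcenter] shows that the choice in [circumcenter] is not
    a default, and [phi_unique] determines its value. *)
Lemma circumcenter_tri x a b c : gram (b - a) (c - a) != 0 ->
  det3 (a - x) (b - x) (c - x) != 0 ->
  (2 * det3 (a - x) (b - x) (c - x)) *: (circumcenter x (cvx (tri a b c)) - x) =
  phi (a - x) (b - x) (c - x).
Proof.
move=> g0 det0; have [d [da db dc]] := phi_circumcenter det0.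
have shift y z : y - z = (y - x) - (z - x) by rewrite opprB addrA subrK.
have [r [xr vr]] : exists r, enorm (x - circumcenter x (cvx (tri a b c))) = r /\
    forall y, vertices (cvx (tri a b c)) y -> enorm (y - circumcenter x (cvx (tri a b c))) = r.
  apply: (@xgetPex _ 0 [set p | exists r, enorm (x - p) = r /\
                  forall y, vertices (cvx (tri a b c)) y -> enorm (y - p) = r]).
  exists (x + d), (enorm d); split; first by rewrite opprD addrA subrr add0r enormN.
  move=> y /(vertices_tri _ g0); rewrite opprD addrA.
  by case=> ->; apply/(enorm_eq_dot _ erefl).
set q := circumcenter _ _ in xr vr *.
rewrite enormB in xr.
apply: phi_unique; apply/(enorm_eq_dot _ xr); rewrite -shift; apply: vr; apply/(vertices_tri _ g0).
- by apply: Or31.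
- by apply: Or32.
- by apply: Or33.
Qed.

Section Sums.
Variables (n : nat) (p : 'I_n -> V).
Local Notation P := (cvx p).
Hypothesis ex : extremal p.
Hypothesis d3 : has_dim P 3.
Hypothesis simp : simplicial P.
Local Notation T3 := ('I_n * 'I_n * 'I_n)%type.

(** Exchanging [k] and [k'] changes the sign of the orientation, which is nonpositive both ways; so
    it is 0 and the second apex lies in the plane of the first facet. *)
Lemma facing_unique i j k k' : facing p i j k -> facing p i j k' -> k = k'.
Proof.
move=> f f'; have h1 : orient p i j k k' <= 0 by move/asboolP: f => [].
have h2 : orient p i j k' k <= 0 by move/asboolP: f' => [].
have h3 : orient p i j k' k = - orient p i j k k'.
  by rewrite /orient !det3_coord; ring.
have /(facing_zero ex simp f) : orient p i j k k' = 0 by apply/eqP; rewrite eq_le h1 -oppr_le0 -h3.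
have [_ jk' ik'] := facing_neq f'.
by case=> E //; move: jk' ik'; rewrite E eqxx.
Qed.

(* Around the edge from [p i] to [p j] the other vertices are ordered by slope;
   the extreme one spans the second facet at that edge. *)
Lemma facing_opp i j k : facing p i j k -> exists d, facing p j i d.
Proof.
(* In the projection along the edge, [w l m] is the planar orientation of [l] and [m], and all
   points lie on one side of the ray to [k]. [det3_plucker] turns the comparison of slopes into the
   sign of [w d l]. *)
move=> f; pose u := p j - p i; pose w l m := det3 u (p l - p i) (p m - p i).
have wk l : orient p i j k l = w k l by [].
have w_anti l m : w l m = - w m l by rewrite /w !det3_coord; ring.
have le0 l : w k l <= 0 by move/asboolP: f => [/(_ l)].
have [g wg] : exists g, w k g < 0 by move/asboolP: f => [_ [g]]; exists g.
have g0 : w k g != 0 by rewrite lt_eqF.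
have lt0 l : w k l != 0 -> w k l < 0 by rewrite lt_neqAle => ->; exact: le0.
have [d d0 dmax] := @max_ex _ _ (fun l => w k l != 0) (fun l => w l g / - w k l) _ g0.
have wdl l : w k l != 0 -> 0 <= w d l.
  move=> l0; have := dmax _ l0; have kl := lt0 _ l0; have kd := lt0 _ d0.
  rewrite ler_pdivrMr ?oppr_gt0 // mulrAC ler_pdivlMr ?oppr_gt0 // => h.
  have pl : w d l * w k g + w l k * w d g + w k d * w l g = 0 by exact: det3_plucker.
  rewrite -(@nmulr_lle0 _ (w k g)) //.
  by move: pl; rewrite (w_anti l k); lra.
have wd l : 0 <= w d l.
  have [l0|] := eqVneq (w k l) 0; last exact: wdl.
  have [->|->|->] := facing_zero ex simp f l0.
  - by rewrite /w subrr !det3_coord !mxE; lra.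
  - by rewrite (_ : w d j = 0) // /w /u !det3_coord; ring.
  - by rewrite w_anti oppr_ge0 le0.
have oE l : orient p j i d l = - w d l by rewrite /orient /w /u !det3_coord !mxE; ring.
exists d; apply/asboolP; split => [l|]; first by rewrite oE oppr_le0.
by exists k; rewrite oE -w_anti lt0.
Qed.

(** The boundary is a closed oriented surface: an oriented edge lies in at most one facet, and its
    reverse occurs whenever it does. The sum is thus its own negative. *)
Lemma edge_cancel (U : lmodType R) (e : 'I_n -> 'I_n -> U) :
  (forall i j, e j i = - e i j) ->
  \sum_(t : T3 | facing p t.1.1 t.1.2 t.2) e t.1.1 t.1.2 = 0.
Proof.
move=> e_anti; pose c i j : U := if `[< exists k, facing p i j k >] then e i j else 0.
have -> : \sum_(t : T3 | facing p t.1.1 t.1.2 t.2) e t.1.1 t.1.2 = \sum_i \sum_j c i j.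
  rewrite -(pair_big_dep xpredT (fun t : 'I_n * 'I_n => fun k => facing p t.1 t.2 k)
    (fun t k => e t.1 t.2)) /=.
  rewrite -(pair_big xpredT xpredT (fun i j => \sum_(k | facing p i j k) e i j)) /=.
  apply: eq_bigr => i _; apply: eq_bigr => j _; rewrite /c.
  case: asboolP => [[k f]|N].
    rewrite (big_pred1 k) // => l /=; apply/idP/eqP => [f'|->//].
    exact: facing_unique f' f.
  by rewrite big_pred0 // => k; apply/negP => f; apply: N; exists k.
have c_anti i j : c j i = - c i j.
  rewrite /c; have -> : (exists k, facing p j i k) = (exists k, facing p i j k).
    by apply/propext; split => -[k /facing_opp].
  by case: asboolP => _; rewrite ?oppr0.
set s := \sum_i _; have h : s = - s.
  rewrite {1}/s exchange_big /= -sumrN; apply: eq_bigr => i _.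
  by rewrite -sumrN; apply: eq_bigr => j _; exact: c_anti.
have : 2%:R *: s = 0 by rewrite scaler_nat mulr2n {1}h addNr.
by move/eqP; rewrite scaler_eq0 pnatr_eq0 /= => /eqP.
Qed.

(* Each facet is represented by the cyclic ordering that starts with its
   smallest index. *)
Definition low (t : T3) := [&& facing p t.1.1 t.1.2 t.2, (t.1.1 < t.1.2)%N & (t.1.1 < t.2)%N].

(** Among the three rotations of a facing triple exactly one starts with the smallest index, so a
    sum over all facing triples meets each facet three times. *)
Lemma cyc_sum (U : nmodType) (g : 'I_n -> 'I_n -> 'I_n -> U) :
  \sum_(t : T3 | low t) (g t.1.1 t.1.2 t.2 + g t.1.2 t.2 t.1.1 + g t.2 t.1.1 t.1.2) =
  \sum_(t : T3 | facing p t.1.1 t.1.2 t.2) g t.1.1 t.1.2 t.2.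
Proof.
pose rot (t : T3) : T3 := (t.1.2, t.2, t.1.1).
have rotK : cancel (rot \o rot) rot by move=> [[i j] k].
have rotK' : cancel rot (rot \o rot) by move=> [[i j] k].
rewrite !big_split /= [RHS](bigID (fun t : T3 => (t.1.1 < t.1.2)%N && (t.1.1 < t.2)%N)) /=.
rewrite -addrA; congr (_ + _).
rewrite [RHS](bigID (fun t : T3 => (t.1.2 < t.1.1)%N && (t.1.2 < t.2)%N)) /= addrC.
congr (_ + _).
  rewrite [RHS](reindex (rot \o rot)) /=; last by exists rot => t _; [exact: rotK|exact: rotK'].
  apply: eq_bigl => -[[i j] k]; rewrite /low /= -(facing_cyc p i j k) -(facing_cyc p j k i).
  case f : facing => //=; apply/idP/idP => [/andP[ij ik]|/andP[_ /andP[h1 h2]]].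
    by rewrite ij ik !andbT negb_and -leqNgt (ltnW ik).
  by rewrite h2 h1.
rewrite [RHS](reindex rot) /=; last by exists (rot \o rot) => t _; [exact: rotK'|exact: rotK].
apply: eq_bigl => -[[i j] k]; rewrite /low /= (facing_cyc p i j k).
case f : facing => //=; have [ij jk ik] := facing_neq f.
move: ij jk ik; rewrite -!(inj_eq val_inj) /= => ij jk ik.
lia.
Qed.

End Sums.
End CircumcenterOfMass.

(** * The circumcenter of mass as a quotient of two sums *)

Section CcmFormula.
Context {R : realType}.
Local Notation V := 'rV[R]_3.
Implicit Types (x y z u a b c : V) (S F P : set V).
Variables (n : nat) (p : 'I_n -> V).
Local Notation P := (cvx p).
Hypothesis ex : extremal p.
Hypothesis d3 : has_dim P 3.
Hypothesis simp : simplicial P.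
Local Notation T3 := ('I_n * 'I_n * 'I_n)%type.
Let Fc (t : T3) : set V := cvx (tri (p t.1.1) (p t.1.2) (p t.2)).

Lemma corner_mem i j k l : cvx (tri (p i) (p j) (p k)) (p l) -> [\/ l = i, l = j | l = k].
Proof.
move=> h; have [|t ht] := extremal_cvx ex _ h.
  by move=> t; case: (triP (p i) (p j) (p k) t) => ->; exact: cvx_vertex.
by move: ht; have [->|->|->] := triP (p i) (p j) (p k) t => /(extremal_inj ex) ->;
  [apply: Or31|apply: Or32|apply: Or33].
Qed.

Lemma facet_low : faces 2 P = [set Fc t | t in [set t | low p t]].
Proof.
apply/seteqP; split => [F /(facet_facing ex d3 simp)[i [j [k [f FE]]]]|_ [t /= tl <-]]; last first.
  case/and3P: tl => f _ _; have := facing_face f.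
  by rewrite (face_plane_tri ex simp f).
have [ij jk ik] := facing_neq f.
move: (ij) (jk) (ik); rewrite -!(inj_eq val_inj) /= => ij' jk' ik'.
have [h|h] : (i < j)%N && (i < k)%N \/ ((j < i)%N && (j < k)%N \/ (k < i)%N && (k < j)%N) by lia.
  by exists (i, j, k); rewrite //= /low f.
case: h => h.
  exists (j, k, i); last by rewrite /Fc /= tri_cyc.
  by rewrite /= /low /= (facing_cyc p i j k) f /= andbC.
exists (k, i, j); last by rewrite /Fc /= -tri_cyc -FE.
by rewrite /= /low /= -(facing_cyc p k i j) f.
Qed.

(** Equal triangles have the same corners, hence the same smallest index. The remaining two could
    only be exchanged, and that would reverse the orientation. *)
Lemma low_inj : set_inj [set t | low p t] Fc.
Proof.
move=> [[i j] k] [[i' j'] k'] /set_mem /= /and3P[/= f ij ik] /set_mem /= /and3P[/= f' ij' ik'].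
rewrite /Fc /= => E.
have mem l : [\/ l = i', l = j' | l = k'] -> [\/ l = i, l = j | l = k].
  move=> h; apply: corner_mem; rewrite E.
  by case: h => ->; [exact: (cvx_vertex _ i0)|exact: (cvx_vertex _ i1)|exact: (cvx_vertex _ i2)].
have mem' l : [\/ l = i, l = j | l = k] -> [\/ l = i', l = j' | l = k'].
  move=> h; apply: corner_mem; rewrite -E.
  by case: h => ->; [exact: (cvx_vertex _ i0)|exact: (cvx_vertex _ i1)|exact: (cvx_vertex _ i2)].
have ii : i = i'.
  apply/val_inj => /=.
  have := mem i' (Or31 _ _ erefl); have := mem' i (Or31 _ _ erefl).
  by case=> /(congr1 val) /= h1 [] /(congr1 val) /= h2; lia.
rewrite -ii in f' ij' ik' mem mem' *.
have [_ jk _] := facing_neq f; have [_ jk' _] := facing_neq f'.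
have : [\/ j' = i, j' = j | j' = k] by apply: mem; apply: Or32.
have : [\/ k' = i, k' = j | k' = k] by apply: mem; apply: Or33.
case=> kE [] jE; try by move: ij' ik' jk'; rewrite ?kE ?jE ?ltnn ?eqxx.
- by move: (facing_swap f); rewrite -kE -jE f'.
Qed.

Lemma facet_sum (U : nmodType) (f : set V -> U) :
  \sum_(F \in faces 2 P) f F = \sum_(t : T3 | low p t) f (Fc t).
Proof.
rewrite facet_low (fsbig_image _ _ _ low_inj) -[RHS]big_filter.
have -> : [set t | low p t] = [set` [seq t <- index_enum T3 | low p t]].
  by apply/seteqP; split => t /=; rewrite mem_filter mem_index_enum andbT.
by rewrite -fsbig_seq // filter_uniq // index_enum_uniq.
Qed.

Lemma det3_last b c y : det3 b c y = dot (cross b c) y.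
Proof. by rewrite det3_coord dot3 !crossE; ring. Qed.

Lemma facing_le i j k y : facing p i j k -> P y ->
  det3 (p j - p i) (p k - p i) (y - p i) <= 0.
Proof.
move=> f Py; pose N := cross (p j - p i) (p k - p i).
have E z : det3 (p j - p i) (p k - p i) (z - p i) = dot N z - dot N (p i).
  by rewrite -dotNr -dotDr det3_last.
have Nle : P `<=` [set z | dot N z <= dot N (p i)].
  apply: cvx_le => l; rewrite -subr_le0 -E.
  by move/asboolP: f => [/(_ l)].
by rewrite E subr_le0; exact: Nle Py.
Qed.

Lemma facing_interior i j k x : facing p i j k -> P x ->
  0 <= det3 (p i - x) (p j - x) (p k - x).
Proof. by move=> f Px; have := facing_le f Px; rewrite det3_apex oppr_le0. Qed.

Lemma signed_volume_tri x i j k : facing p i j k ->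
  signed_volume P x (cvx (tri (p i) (p j) (p k))) = det3 (p i - x) (p j - x) (p k - x) / 6.
Proof.
move=> f; have [ij jk ik] := facing_neq f; have inj := extremal_inj ex.
have [a [b [c [FE h ->]]]] : exists a b c,
    [/\ cvx (tri (p i) (p j) (p k)) = conv_hull [set a; b; c],
        forall y, P y -> det3 (b - a) (c - a) (y - a) <= 0 &
        signed_volume P x (cvx (tri (p i) (p j) (p k))) = det3 (a - x) (b - x) (c - x) / 6].
  apply: (@xgetPex _ 0 [set m | exists a b c,
    [/\ cvx (tri (p i) (p j) (p k)) = conv_hull [set a; b; c],
        forall y, P y -> det3 (b - a) (c - a) (y - a) <= 0 &
        m = det3 (a - x) (b - x) (c - x) / 6]]).
  exists (det3 (p i - x) (p j - x) (p k - x) / 6), (p i), (p j), (p k); split => //.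
    by rewrite conv_hull_tri.
  by move=> y; exact: facing_le.
rewrite conv_hull_tri in FE.
have FP : cvx (tri (p i) (p j) (p k)) `<=` P.
  by apply: cvx_comb => t; case: (triP (p i) (p j) (p k) t) => ->; exact: cvx_vertex.
have mem l : cvx (tri (p i) (p j) (p k)) (p l) -> [\/ p l = a, p l = b | p l = c].
  rewrite FE => pl; have [|t <-] := extremal_cvx ex _ pl; last exact: triP.
  by move=> t; apply: FP; rewrite FE; exact: cvx_vertex.
have mi := mem i (cvx_vertex (tri (p i) (p j) (p k)) i0).
have mj := mem j (cvx_vertex (tri (p i) (p j) (p k)) i1).
have mk := mem k (cvx_vertex (tri (p i) (p j) (p k)) i2).
have [l hl] : exists l, orient p i j k l < 0 by move/asboolP: f => [].
have hl' := h _ (cvx_vertex p l).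
congr (_ / _).
(* Of the 27 assignments, 21 repeat a corner, three are rotations and three are odd. *)
case: mi => Ei; case: mj => Ej; case: mk => Ek;
  try (by case/negP: ij; apply/eqP/inj; rewrite Ei Ej);
  try (by case/negP: jk; apply/eqP/inj; rewrite Ej Ek);
  try (by case/negP: ik; apply/eqP/inj; rewrite Ei Ek);
  rewrite -?Ei -?Ej -?Ek in hl' *; try by [rewrite !det3_coord; ring];
  exfalso; move: hl'; rewrite (_ : det3 _ _ _ = - orient p i j k l);
  [move: hl; lra|rewrite /orient !det3_coord !mxE; ring
  |move: hl; lra|rewrite /orient !det3_coord !mxE; ring
  |move: hl; lra|rewrite /orient !det3_coord !mxE; ring].
Qed.

Lemma off_plane_det i j k x : facing p i j k -> off_facet_planes P x ->
  det3 (p i - x) (p j - x) (p k - x) != 0.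
Proof.
move=> f off; apply/eqP => d0.
have := off _ (facing_face f); rewrite (face_plane_tri ex simp f); apply.
have h : dot (x - p i) (cross (p j - p i) (p k - p i)) = 0.
  by rewrite -det3_dot -det3C det3_apex d0 oppr0.
have [s [t ->]] := plane_decomp (facing_gram f) h.
by rewrite aff_hull_cvx; exact: afc_tri.
Qed.

(** The center of a ball inside the polyhedron works: if it were on a facet plane, a step along the
    outward normal would stay in the ball but leave the polyhedron. *)
Lemma off_facet_planes_exists : exists x, off_facet_planes P x.
Proof.
have [x0 [r [r0 Px hx]]] := cvx_rel_ball d3; exists x0 => F FP.
have [i [j [k [f ->]]]] := facet_facing ex d3 simp FP.
rewrite aff_hull_cvx => -[w [w1 x0E]]; pose N := cross (p j - p i) (p k - p i).
have g1 : 0 < gram (p j - p i) (p k - p i) by rewrite lt0r (facing_gram f) gram_ge0.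
have zj : dot N (p j) - dot N (p i) = 0 by rewrite -dotNr -dotDr dotC dot_cross_l.
have zk : dot N (p k) - dot N (p i) = 0 by rewrite -dotNr -dotDr dotC dot_cross_r.
have x0N : dot N x0 - dot N (p i) = 0.
  rewrite x0E (dot_comb _ _ _ w1) big1 // => t _.
  by have [->|->|->] := triP (p i) (p j) (p k) t; rewrite ?zj ?zk ?subrr mulr0.
have NN : dot N N = gram (p j - p i) (p k - p i) by exact: dot_cross_cross.
have N0 : 0 < enorm N.
  by rewrite /enorm sqrtr_gt0 NN.
have Py : P (x0 + (r / enorm N) *: N).
  apply: hx; last first.
    rewrite addrAC subrr add0r enormZ ger0_norm ?divr_ge0 ?(ltW r0) ?(ltW N0) //.
    by rewrite divfK // lt0r_neq0.
  have [pt [B [Bf ->]]] := d3.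
  exists ((x0 + (r / enorm N) *: N - pt) *m invmx B) => //.
  by rewrite mulmxKV -?row_free_unit // addrC subrK.
have := facing_le f Py; rewrite det3_last -/N dotDr dotNr dotDr dotZr.
rewrite addrAC x0N add0r leNgt => /negP; apply.
by rewrite mulr_gt0 ?divr_gt0 // NN.
Qed.

(** Six times the signed volume, computed from the apex [x]. *)
Definition det_sum x := \sum_(t : T3 | low p t)
  det3 (p t.1.1 - x) (p t.1.2 - x) (p t.2 - x).

Lemma det_sum_shift x : det_sum x = det_sum 0.
Proof.
(* By [det3_shift] the terms containing [x] are antisymmetric in oriented edges; [R^o] views them as
   vectors for [edge_cancel]. *)
pose e i j : R^o := dot x (cross (p i) (p j)).
have := edge_cancel ex simp (e := e) (fun i j => _).
rewrite -(cyc_sum p (fun i j k => e i j)) => E.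
have e0 : \sum_(t : T3 | low p t) (e t.1.1 t.1.2 + e t.1.2 t.2 + e t.2 t.1.1) = 0.
  by apply: E => i j; rewrite /e cross_anti dotNr.
have -> : det_sum x = \sum_(t : T3 | low p t) (det3 (p t.1.1 - 0) (p t.1.2 - 0) (p t.2 - 0)
    - (e t.1.1 t.1.2 + e t.1.2 t.2 + e t.2 t.1.1)).
  by apply: eq_bigr => t _; rewrite !subr0 det3_shift.
by rewrite sumrB e0 subr0.
Qed.

Definition phi_sum : V := \sum_(t : T3 | low p t) phi (p t.1.1) (p t.1.2) (p t.2).

(* The boundary terms of [phi_shift] are antisymmetric functions of the
   oriented edges and cancel in pairs: this is why the choice of the apex [x]
   does not matter. *)
Lemma ccm_fromE x : off_facet_planes P x -> det_sum 0 != 0 ->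
  (2 * det_sum 0) *: ccm_from P x = phi_sum.
Proof.
move=> off W0; pose e i j : V := edge_defect x (p i) (p j).
have e0 : \sum_(t : T3 | low p t) (e t.1.1 t.1.2 + e t.1.2 t.2 + e t.2 t.1.1) = 0.
  rewrite (cyc_sum p (fun i j k => e i j)); apply: edge_cancel => // i j.
  by rewrite /e edge_defect_anti.
have fac t : low p t -> facing p t.1.1 t.1.2 t.2 by case/and3P.
rewrite /ccm_from !facet_sum.
have -> : \sum_(t : T3 | low p t) signed_volume P x (Fc t) = det_sum 0 / 6.
  rewrite -(det_sum_shift x) mulr_suml; apply: eq_bigr => t /fac f.
  exact: signed_volume_tri.
(* The volume contributes 1/6, and [phi] is twice the determinant times the circumcenter, whence
   1/12. *)
have -> : \sum_(t : T3 | low p t) signed_volume P x (Fc t) *: circumcenter x (Fc t) =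
    12%:R^-1 *: phi_sum.
  have -> : phi_sum = \sum_(t : T3 | low p t) (phi (p t.1.1) (p t.1.2) (p t.2) +
      (e t.1.1 t.1.2 + e t.1.2 t.2 + e t.2 t.1.1)).
    by rewrite big_split /= e0 addr0.
  rewrite scaler_sumr; apply: eq_bigr => t /fac f.
  rewrite signed_volume_tri // /e -phi_shift -circumcenter_tri; last 2 first.
  - exact: facing_gram f.
  - exact: off_plane_det.
  by rewrite -scalerDr (addrC x) subrK scalerA; congr (_ *: _); field.
rewrite !scalerA -[RHS]scale1r; congr (_ *: _).
by field; rewrite W0.
Qed.

Lemma ccmE : det_sum 0 != 0 -> (2 * det_sum 0) *: ccm P = phi_sum.
Proof.
move=> W0; apply: ccm_fromE => //.
by apply: (@xgetPex _ 0 [set x | off_facet_planes P x]); exact: off_facet_planes_exists.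
Qed.

End CcmFormula.

(** * Centers outside the ball *)

Section Conclusion.
Context {R : realType}.
Local Notation V := 'rV[R]_3.
Implicit Types (x y z u a b c : V) (S F P : set V).

Section Image.
Variables (n : nat) (p : 'I_n -> V) (a : V).
Hypothesis a1 : 1 < dot a a.
Hypothesis DP : Dpos a (cvx p).
Local Notation A := (iproj a).

Lemma Dpos_vertex i : 0 < idenom a (p i).
Proof. by apply: DP; exact: cvx_vertex. Qed.

(** Applying the involution to a representation of the image point gives one of [p i], with weights
    rescaled by positive factors. Weights that vanish there vanish in the original
    representation. *)
Lemma extremal_image : extremal p -> extremal (A \o p).
Proof.
move=> ex i w w0 w1 E; have Dp := Dpos_vertex.
have DA j : 0 < idenom a (A (p j)).
  by apply: (Dpos_image a1 DP); exists (p j) => //; exact: cvx_vertex.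
have Ds : 0 < idenom a (\sum_j w j *: A (p j)).
  apply: (@Dpos_cvx _ a _ (A \o p) DA).
  by exists w.
have := congr1 A E; rewrite /= iprojK ?lt0r_neq0 // iproj_comb //; last first.
  by move=> j; rewrite lt0r_neq0.
under eq_bigr do rewrite iprojK ?lt0r_neq0 //.
set v := fun j => w j * idenom a (A (p j)) / idenom a (\sum_j w j *: A (p j)).
move=> pE; have v0 j : 0 <= v j by rewrite /v divr_ge0 ?mulr_ge0 // ltW.
have v1 : \sum_j v j = 1.
  by rewrite /v -mulr_suml -idenom_comb // divff // lt0r_neq0.
have vi := ex i v v0 v1 pE.
rewrite -w1 (bigD1 i) //= big1 ?addr0 // => j ji.
have := weight_eq1 v0 v1 vi ji; rewrite /v => /eqP.
by rewrite !mulf_eq0 invr_eq0 (gt_eqF Ds) (gt_eqF (DA j)) !orbF => /eqP.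
Qed.

Lemma simplicial_image : simplicial (cvx p) -> simplicial (A @` cvx p).
Proof.
move=> simp F; rewrite image_facesE // => -[F' F'P <-].
have DF := Dpos_face DP F'P; have [b [c [d FE]]] := simp _ F'P.
rewrite conv_hull_tri in FE; exists (A b), (A c), (A d).
rewrite conv_hull_tri FE image_cvx //; last by move=> i; apply: DF; rewrite FE; exact: cvx_vertex.
by congr cvx; apply/funext; apply: ord3P.
Qed.

Lemma has_dim_image : has_dim (cvx p) 3 -> has_dim (cvx (A \o p)) 3.
Proof.
move=> d3; rewrite -image_cvx //; last exact: Dpos_vertex.
by apply: image_has_dim => //; have [x [r [_ Px _]]] := cvx_rel_ball d3; exists x.
Qed.

Lemma orient_image i j k l : orient (A \o p) i k j l =
  (dot a a - 1) ^+ 4 / (idenom a (p i) * idenom a (p k) * idenom a (p j) * idenom a (p l))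
  * orient p i j k l.
Proof.
have D0 j' : idenom a (p j') != 0 by rewrite lt0r_neq0 // Dpos_vertex.
by rewrite [LHS]det3_iproj // -/(orient p i k j l) orient_swap; ring.
Qed.

(* An inversion reverses orientation. *)
Lemma facing_image i j k : facing p i j k -> facing (A \o p) i k j.
Proof.
have q0 l : 0 < (dot a a - 1) ^+ 4 /
    (idenom a (p i) * idenom a (p k) * idenom a (p j) * idenom a (p l)).
  by rewrite divr_gt0 ?exprn_gt0 ?subr_gt0 ?mulr_gt0 ?Dpos_vertex.
move=> /asboolP[h [l hl]]; apply/asboolP; split => [l'|].
  by rewrite orient_image pmulr_rle0.
by exists l; rewrite orient_image pmulr_rlt0.
Qed.

End Image.

Section Escape.
Variables (n : nat) (p : 'I_n -> V) (v : V) (M : R).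
Hypothesis ex : extremal p.
Hypothesis d3 : has_dim (cvx p) 3.
Hypothesis vmax : forall i, p i != v -> dot v (p i) < dot v v.
Hypothesis v1 : 1 < dot v v.
Hypothesis M0 : 0 <= M.
Variable iv : 'I_n.
Hypothesis piv : p iv = v.
Local Notation L := (dot v v).
Local Notation T3 := ('I_n * 'I_n * 'I_n)%type.

Lemma facing_at_vertex : simplicial (cvx p) -> exists j k, facing p iv j k.
Proof.
move=> simp; have vp : exists i, p i = v by exists iv.
have [F [FP Fv]] := face_at d3 vmax vp (isT : (2 <= 3)%N).
have [i [j [k [f FE]]]] := facet_facing ex d3 simp FP.
move: Fv; rewrite FE -piv => /(corner_mem ex)[] E.
- by exists j, k; rewrite E.
- by exists k, i; rewrite E facing_cyc.
- by exists i, j; rewrite E -facing_cyc.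
Qed.

(** Since the apex is free, it is put at the vertex [p' l] of the image, where no term is negative.
    One facet at the escaping vertex, with [l] off its plane, then suffices: its determinant has the
    factor [1 / eps] from the denominator at [v]. *)
Lemma det_sum_large : simplicial (cvx p) -> exists2 K, 0 < K & forall eps a,
  escaping p v M eps a -> 0 < eps -> K / eps <= det_sum (iproj a \o p) 0.
Proof.
move=> simp; have L1 := v1; have [j [k f]] := facing_at_vertex simp.
have [l hl] : exists l, orient p iv j k l < 0 by move/asboolP: f => [].
pose E := \sum_i enorm (p i).
have pE i : enorm (p i) <= E.
  by rewrite /E (bigD1 i) //= lerDl; apply: sumr_ge0 => r _; exact: enorm_ge0.
have E0 : 0 <= E by apply: le_trans (pE iv); exact: enorm_ge0.
have nv := enorm_v1 v1.
pose Dm := 1 + 4 * L + 4 * enorm v * E.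
have Dm0 : 0 < Dm by rewrite /Dm ltr_pwDl // ?mulr_ge0 //; lra.
pose K := (L - 1) ^+ 4 / Dm ^+ 3 * - orient p iv j k l.
have K0 : 0 < K by rewrite mulr_gt0 ?oppr_gt0 // divr_gt0 // exprn_gt0 // subr_gt0.
(* One facing triple is kept, out of a sum that counts every facet three times. *)
exists (K / 3) => [|eps a esc e0]; first by rewrite divr_gt0.
have [[a1 La na Dv] DP _ _] := esc; set p' := iproj a \o p.
have Dp := Dpos_vertex DP.
have am : dot a a <= 4 * L.
  rewrite -!sqr_enorm (_ : 4 * _ = (2 * enorm v) ^+ 2); last by ring.
  by rewrite ler_pXn2r ?nnegrE ?mulr_ge0 ?enorm_ge0.
have DM i : idenom a (p i) <= Dm.
  rewrite /idenom /Dm; have := dot_le a (p i); rewrite ler_norml => /andP[h1 _].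
  have : enorm a * enorm (p i) <= 2 * enorm v * E.
    by apply: ler_pM; rewrite ?enorm_ge0.
  lra.
have ex' := extremal_image a1 DP ex.
have simp' : simplicial (cvx p').
  by rewrite -image_cvx //; exact: simplicial_image.
have f' := facing_image a1 DP f.
rewrite -(det_sum_shift ex' simp' (p' l)).
have Px : cvx p' (p' l) by exact: cvx_vertex.
pose g i j k := det3 (p' i - p' l) (p' j - p' l) (p' k - p' l).
have S3 : 3 * det_sum p' (p' l) = \sum_(t : T3 | facing p' t.1.1 t.1.2 t.2) g t.1.1 t.1.2 t.2.
  rewrite -cyc_sum mulr_sumr; apply: eq_bigr => t _; rewrite /g.
  have det3_sum b c d : 3 * det3 b c d = det3 b c d + det3 c d b + det3 d b c.
    by rewrite !det3_coord; ring.
  exact: det3_sum.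
rewrite mulrAC ler_pdivrMr // [leRHS]mulrC S3 (bigD1 (iv, k, j)) //=.
apply: ler_wpDr.
  by apply: sumr_ge0 => t /andP[ft _]; exact: facing_interior ft Px.
rewrite /g -[det3 _ _ _]opprK -det3_apex -/(orient p' iv k j l) (orient_image a1 DP).
rewrite -mulrN /K piv Dv mulrAC ler_pM2r ?oppr_gt0 //.
apply: (@le_trans _ _ ((L - 1) ^+ 4 / (eps * Dm ^+ 3))).
  by rewrite -mulrA -invfM (mulrC eps).
apply: ler_pM.
- by rewrite exprn_ge0 // subr_ge0 ltW.
- by rewrite invr_ge0 mulr_ge0 ?exprn_ge0 ?(ltW Dm0) ?(ltW e0).
- have a0 : 0 <= L - 1 by lra.
  have b0 : 0 <= dot a a - 1 by lra.
  by rewrite ler_pXn2r ?nnegrE // lerD2r.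
rewrite lef_pV2 ?posrE ?mulr_gt0 ?exprn_gt0 ?Dp //.
rewrite (_ : Dm ^+ 3 = Dm * Dm * Dm) -?mulrA; last by rewrite !exprS expr0; ring.
rewrite ler_pM2l //; apply: ler_pM; rewrite ?mulr_ge0 ?(ltW (Dp _)) //.
by apply: ler_pM; rewrite ?(ltW (Dp _)).
Qed.

Lemma ccm_escapes : simplicial (cvx p) -> exists2 e, 0 < e & forall eps a,
  escaping p v M eps a -> 0 < eps < e -> ~ B3 (ccm (iproj a @` cvx p)).
Proof.
move=> simp; have L1 := v1; have M00 := M0; have nv := enorm_v1 v1.
have [K K0 hK] := det_sum_large simp.
pose c := enorm v.
(* [B1] and [B2] bound the contribution of triples that avoid [iv]. Summing over all triples of
   indices makes them independent of the inversion. *)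
pose B1 := \sum_(t : T3) M * M * M.
pose B2 := \sum_(t : T3) (3 * (M ^+ 2 * (c * M * M)) + 2 * c * (M * M * M)).
have c0 : 0 < c by rewrite /c; lra.
have B10 : 0 <= B1 by apply: sumr_ge0 => t _; rewrite !mulr_ge0.
have B20 : 0 <= B2.
  by apply: sumr_ge0 => t _; rewrite addr_ge0 // !mulr_ge0 ?exprn_ge0 // ltW.
have LL : 0 < 2 * (L - 1) * L by rewrite !mulr_gt0 //; lra.
have e10 : 0 < 2 * (L - 1) * L / (2 * c + 1) by apply: divr_gt0 => //; lra.
have e20 : 0 < 3 * K / (B1 + B2 + 1) by apply: divr_gt0; [rewrite mulr_gt0|lra].
(* The first bound on [eps] yields [kap * L - 2 * c >= 1], the second [3 * W >= B1 + B2 + 1]. *)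
exists (Num.min (2 * (L - 1) * L / (2 * c + 1)) (3 * K / (B1 + B2 + 1))).
  by rewrite lt_min e10.
move=> eps a esc /andP[e0]; rewrite lt_min => /andP[es1 es2].
have [[a1 La na Dv] DP [kap kapE vE] near] := esc; set p' := iproj a \o p.
have Dp := Dpos_vertex DP.
have ex' := extremal_image a1 DP ex; have d3' := has_dim_image a1 DP d3.
have simp' : simplicial (cvx p').
  by rewrite -image_cvx //; exact: simplicial_image.
rewrite image_cvx // -/p'.
set W := det_sum p' 0.
have WK : K / eps <= W by exact: hK esc e0.
have W0 : 0 < W by apply: lt_le_trans WK; exact: divr_gt0.
have W00 : W != 0 by rewrite lt0r_neq0.
have ccmEq := ccmE ex' d3' simp' W00.
pose d (t : T3) := det3 (p' t.1.1) (p' t.1.2) (p' t.2).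
pose f (t : T3) := dot (- v) (phi (p' t.1.1) (p' t.1.2) (p' t.2)).
have Sd : \sum_(t : T3 | facing p' t.1.1 t.1.2 t.2) d t = 3 * W.
  pose g i j k := det3 (p' i) (p' j) (p' k).
  rewrite -[LHS](cyc_sum p' g) mulr_sumr; apply: eq_bigr => t _.
  rewrite !subr0 /g -(det3C (p' t.2)) !(det3C (p' t.1.1)); ring.
have Sf : \sum_(t : T3 | facing p' t.1.1 t.1.2 t.2) f t = 3 * dot (- v) (phi_sum p').
  pose g i j k := dot (- v) (phi (p' i) (p' j) (p' k)).
  rewrite -[LHS](cyc_sum p' g) /phi_sum dot_sumr mulr_sumr; apply: eq_bigr => t _.
  rewrite /g -(phiC (p' t.2)) !(phiC (p' t.1.1)); ring.
pose hv (t : T3) := [|| t.1.1 == iv, t.1.2 == iv | t.2 == iv].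
have qE : p' iv = kap *: (- v) by rewrite /p' /= piv vE scalerN scaleNr.
have LN : dot (- v) (- v) = L by rewrite dotNl dotNr opprK.
have fv t : hv t -> f t = kap * L * d t.
  rewrite /f /d => /or3P[] /eqP ->; rewrite qE.
  - by rewrite dot_phi_axis LN.
  - by rewrite -phiC dot_phi_axis LN -(det3C _ (kap *: - v)).
  - by rewrite phiC dot_phi_axis LN (det3C (kap *: - v)).
have far i : i != iv -> enorm (p' i) <= M.
  by move=> ii; apply: near; rewrite -piv (inj_eq (extremal_inj ex)).
have dN t : ~~ hv t -> `|d t| <= M * M * M.
  rewrite /hv !negb_or => /and3P[h1 h2 h3]; apply: le_trans (det3_le _ _ _) _.
  apply: ler_pM; rewrite ?mulr_ge0 ?enorm_ge0 ?far //.
  by apply: ler_pM; rewrite ?enorm_ge0 ?far.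
have fN t : ~~ hv t -> `|f t| <= 3 * (M ^+ 2 * (c * M * M)).
  rewrite /hv !negb_or => /and3P[h1 h2 h3]; rewrite /c -(enormN v).
  by apply: dot_phi_le; exact: far.
pose Q (t : T3) := facing p' t.1.1 t.1.2 t.2.
have sub_sum (F : T3 -> R) : (forall t, 0 <= F t) ->
    \sum_(t | Q t && ~~ hv t) F t <= \sum_t F t.
  move=> F0; rewrite [leRHS](bigID (fun t => Q t && ~~ hv t)) /= lerDl.
  by apply: sumr_ge0 => t _; exact: F0.
have b1 : \sum_(t | Q t && ~~ hv t) d t <= B1.
  apply: le_trans (sub_sum _ (fun=> _)); last by rewrite !mulr_ge0.
  apply: ler_sum => t /andP[_ /dN]; rewrite ler_norml => /andP[_]; exact.
have b2 : - B2 <= \sum_(t | Q t && ~~ hv t) (f t - 2 * c * d t).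
  rewrite lerNl -sumrN; apply: le_trans (sub_sum _ (fun=> _)); last first.
    by rewrite addr_ge0 // !mulr_ge0 ?exprn_ge0 // ltW.
  apply: ler_sum => t /andP[_ h]; have := fN _ h; have := dN _ h.
  rewrite !ler_norml => /andP[_ h1] /andP[h2 _].
  have : 2 * c * d t <= 2 * c * (M * M * M) by rewrite ler_pM2l //; lra.
  lra.
(* By [ccmE] the test for leaving the ball asks that [dot (- v) (phi_sum p')] exceed [2 * c * W]. On
   triples through [iv] the two summands are proportional by [fv], so the large factor
   [kap * L - 2 * c] comes out. *)
have tot : 3 * (dot (- v) (phi_sum p') - 2 * c * W) =
    (kap * L - 2 * c) * (3 * W - \sum_(t | Q t && ~~ hv t) d t) +
    \sum_(t | Q t && ~~ hv t) (f t - 2 * c * d t).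
  have Ed : 3 * W - \sum_(t | Q t && ~~ hv t) d t = \sum_(t | Q t && hv t) d t.
    by rewrite -Sd (bigID hv) /= addrK.
  rewrite Ed mulrBr -Sf (_ : 3 * (2 * c * W) = 2 * c * (3 * W)); last by ring.
  rewrite -Sd mulr_sumr -sumrB (bigID hv) /=; congr (_ + _).
  rewrite mulr_sumr; apply: eq_bigr => t /andP[_ /fv ->]; ring.
have k1 : 1 <= kap * L - 2 * c.
  have h1 : 2 * (L - 1) / eps * L <= kap * L by rewrite ler_pM2r //; lra.
  have h2 : 2 * c + 1 <= 2 * (L - 1) * L / eps.
    rewrite ler_pdivlMr // mulrC -ler_pdivlMr; last by lra.
    exact: ltW.
  by move: h1; rewrite mulrAC; lra.
have k2 : B1 + B2 + 1 <= 3 * W.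
  have h2 : B1 + B2 + 1 <= 3 * K / eps.
    rewrite ler_pdivlMr // mulrC -ler_pdivlMr; last by lra.
    exact: ltW.
  by move: h2; rewrite -mulrA; lra.
have pos : 0 < dot (- v) (phi_sum p') - 2 * c * W.
  have h : 0 < 3 * (dot (- v) (phi_sum p') - 2 * c * W); last by rewrite pmulr_rgt0 in h.
  rewrite tot; set D := 3 * W - _.
  have D1 : B2 + 1 <= D by rewrite /D; lra.
  have : D <= (kap * L - 2 * c) * D by rewrite ler_peMl //; lra.
  lra.
apply: (@not_B3 _ (- v)); rewrite enormN -/c.
have := congr1 (dot (- v)) ccmEq; rewrite dotZr -/W => E.
rewrite -(ltr_pM2l (_ : 0 < 2 * W)); last by rewrite mulr_gt0.
by rewrite E; lra.
Qed.

Lemma cc_escapes : exists2 e, 0 < e & forall eps a,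
  escaping p v M eps a -> 0 < eps < e -> ~ B3 (cc (iproj a @` cvx p)).
Proof.
have L1 := v1; have M00 := M0; have nv := enorm_v1 v1.
(* This bound makes [kap] larger than [2 * (M + 1)], as [cc_far] requires since |v| > 1. *)
exists ((L - 1) / (M + 1)) => [|eps a esc /andP[e0 es]]; first by apply: divr_gt0; lra.
have [[a1 La na Dv] DP [kap kapE vE] near] := esc.
rewrite image_cvx //; last exact: Dpos_vertex.
apply: (@cc_far _ _ _ iv M) => //; last first.
  by move=> i pi; apply: near; apply: contra pi => /eqP h; rewrite /= h piv.
rewrite /= piv vE enormZ normrN.
have h1 : 2 * (M + 1) < 2 * (L - 1) / eps.
  rewrite ltr_pdivlMr // -mulrA ltr_pM2l // mulrC -ltr_pdivlMr //; lra.
rewrite ger0_norm; last by lra.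
have : kap <= kap * enorm v by rewrite ler_peMr //; lra.
lra.
Qed.

End Escape.

Lemma escape_conclude n (p : 'I_n -> V) v M (g : set V -> V) : koebe (cvx p) ->
  (forall eps, 0 < eps < 1 -> exists a, escaping p v M eps a) ->
  (exists2 e, 0 < e & forall eps a,
    escaping p v M eps a -> 0 < eps < e -> ~ B3 (g (iproj a @` cvx p))) ->
  exists (T : V -> V) (Q : set V), mobius T /\ mobius_image T (cvx p) Q /\ ~ B3 (g Q).
Proof.
move=> kP esc [e e0 he]; have m0 : 0 < Num.min e 1 by rewrite lt_min e0 ltr01.
have me : Num.min e 1 <= e by rewrite ge_min lexx.
have m1 : Num.min e 1 <= 1 by rewrite ge_min lexx orbT.
have [|a ea] := esc (Num.min e 1 / 2); first by lra.
have [[a1 La na Dv] DP _ _] := ea.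
have [mT mI] := mobius_inversion_image a1 kP DP.
exists (inversion a \o id), (iproj a @` cvx p); do 2!split => //.
by apply: he ea _; lra.
Qed.

End Conclusion.

Theorem mainTheorem3 (R : realType) (P : set 'rV[R]_3) (hP : koebe P) :
  (forall g : set 'rV[R]_3 -> 'rV[R]_3,
     [set cc; cm 0; cm 1; cm 2; cm 3] g ->
     exists (T : 'rV[R]_3 -> 'rV[R]_3) (Q : set 'rV[R]_3),
       mobius T /\ mobius_image T P Q /\ ~ B3 (g Q)) /\
  (simplicial P ->
     exists (T : 'rV[R]_3 -> 'rV[R]_3) (Q : set 'rV[R]_3),
       mobius T /\ mobius_image T P Q /\ ~ B3 (ccm Q)).
Proof.
have [n0 [p0 PE0]] : exists n (p : 'I_n -> 'rV[R]_3), P = cvx p.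
  by case: hP => /convex_polyhedronE[].
(* One irredundant family of generators serves for all the centers; the argument for [ccm]
   identifies facets with triples of its indices. *)
have [n [p [PE ex]]] := extremal_exists p0; rewrite {}PE0 {}PE in hP *.
have d3 : has_dim (cvx p) 3 by case: (hP) => /convex_polyhedronE[].
have [v [[iv piv] vmax vnorm]] := max_norm_vertex d3.
have vp : exists i, p i = v by exists iv.
have v1 := koebe_vertex_norm hP vp vmax vnorm.
have [M M0 esc] := escaping_exists vmax v1.
have cm_case k : (k <= 3)%N -> exists (T : 'rV[R]_3 -> 'rV[R]_3) (Q : set 'rV[R]_3),
    mobius T /\ mobius_image T (cvx p) Q /\ ~ B3 (cm k Q).
  move=> k3; apply: escape_conclude hP esc _.
  have [e e0 he] := cm_escapes vp vmax v1 d3 k3.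
  pose c := (M + 1) * ((1 + 2 * M) ^+ k + 1).
  have c0 : 0 < c.
    rewrite mulr_gt0 ?ltr_wpDl ?exprn_ge0 //; first by lra.
  exists (Num.min 1 (e / c)) => [|eps a ea]; first by rewrite lt_min ltr01 divr_gt0.
  rewrite lt_min => /and3P[eps0 eps1 epse]; apply: he M0 ea _ _; first by rewrite eps0.
  by rewrite -ltr_pdivlMr.
split=> [g|simp]; last first.
  by apply: (escape_conclude hP esc); exact: (ccm_escapes ex d3 vmax v1 M0 piv simp).
case=> [[[[->|->]|->]|->]|->]; try exact: cm_case.
by apply: (escape_conclude hP esc); exact: (cc_escapes v1 M0 piv).
Qed.
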